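(* Let $k$ be an algebraically closed field of characteristic $0$. Let $n,m\ge 2$ and let $g(x)=\sum_{i=1}^n r_ix^i\in k[x]$, $f(y)=\sum_{i=1}^m s_iy^i\in k[y]$ with $r_n\neq 0$, $s_m\neq 0$. Assume that $f(y)$ either has degree at most $5$ or is a power of $y$, and that $g(x)$ either has degree at most $5$ or is a power of $x$. Let $\mathcal{C}=\{(x_0,y_0)\in k^2 : f(y_0)=g(x_0)\}$, with coordinate ring $\mathcal{O}(\mathcal{C})=k[x,y]/\langle g-f\rangle$. Then $\mathcal{C}$ is a quantum homogeneous space in the pointed affine Hopf algebra $A(g,f)$. That is, $A(g,f)$ is a pointed affine Hopf algebra, the canonical map $k[x,y]/\langle g-f\rangle\to A(g,f)$, $x\mapsto x$, $y\mapsto y$, is injective, and its image is a right coideal subalgebra of $A(g,f)$ over which $A(g,f)$ is faithfully flat as a left and as a right module.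
   Context: For letters $x,a$, let $F=k[x]*k[a^{\pm1}]$ be the free product of the polynomial algebra and the Laurent polynomial algebra. For integers $i,j\ge 0$ let $P(j,i)_{(a,x)}\in F$ be the sum of all words in $a$ and $x$ having exactly $j$ letters $a$ and $i$ letters $x$ (with $P(0,0)=1$). For $g=\sum_{i=1}^n r_ix^i$ with $n\ge2$, $r_n\ne0$, define $$A(x,a,g)=F/\langle \sigma_1,\dots,\sigma_{n-1}\rangle,\qquad \sigma_j=\sum_{i=j}^n r_iP(j,i-j)_{(a,x)}-r_ja^n .$$ It is a Hopf algebra with $\Delta(a)=a\otimes a$, $\Delta(x)=1\otimes x+x\otimes a$, $\varepsilon(a)=1$, $\varepsilon(x)=0$, $S(a)=a^{-1}$, $S(x)=-xa^{-1}$. The Hopf algebra $A(y,b,f)$ is defined in the same way from $f$ of degree $m$, with $(y,b)$ in place of $(x,a)$. Define the Hopf algebra $$A(g,f)=\big(A(x,a,g)\otimes_k A(y,b,f)\big)/\langle a^n-b^m,\ g-f\rangle,$$ where $a,x$ stand for $a\otimes1,x\otimes1$ and $b,y$ for $1\otimes b,1\otimes y$. ''Affine'' means finitely generated as a $k$-algebra; ''pointed'' means every simple subcoalgebra is one-dimensional. A right coideal subalgebra of a Hopf algebra $H$ is a subalgebra $C$ with $\Delta(C)\subseteq C\otimes H$; a quantum homogeneous space of $H$ is a (right or left) coideal subalgebra $C$ such that $H$ is a faithfully flat right and left $C$-module. *)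

(* Defs.v *)
From HB Require Import structures.
From mathcomp Require Import monalg mpoly.
From mathcomp Require Import all_boot all_order all_algebra boolp.

Set Implicit Arguments.
Unset Strict Implicit.
Unset Printing Implicit Defensive.

Import GRing.Theory.
Local Open Scope ring_scope.
Local Open Scope quotient_scope.

(* An associative unital k-algebra is a ring with a ring morphism from k to   *)
(* its centre, written c%:K; the scalar multiple of u by c is c%:K * u.       *)
(* MathComp's algType excludes the zero algebra, but for an algebra given by  *)
(* a presentation 1 != 0 is not known beforehand; and HB does not allow a     *)
(* structure with the mixins of GRing.PzRing and GRing.Lmodule, as these are  *)
(* already joined in the nonzero algebras.                                    *)
HB.mixin Record PzRing_isPzAlgebra (k : pzRingType) A of GRing.PzRing A := {
  algC : k -> A;
  algC1 : algC 1 = 1;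
  algCD : {morph algC : c d / c + d};
  algCM : {morph algC : c d / c * d};
  algCC : forall c u, GRing.comm (algC c) u }.

#[short(type="pzAlgType")]
HB.structure Definition PzAlgebra (k : pzRingType) :=
  { A of GRing.PzRing A & PzRing_isPzAlgebra k A }.

Notation "c %:K" := (algC c) (at level 2, left associativity, format "c %:K").

Fact algC0 (k : pzRingType) (A : pzAlgType k) : (0 : k)%:K = 0 :> A.
Proof. by apply: (addrI (0 : k)%:K); rewrite -algCD !addr0. Qed.

Fact algCN (k : pzRingType) (A : pzAlgType k) (c : k) : (- c)%:K = - c%:K :> A.
Proof. by apply: (addIr c%:K); rewrite -algCD !addNr algC0. Qed.

Section Instances.
Variable k : comNzRingType.

HB.instance Definition _ := @PzRing_isPzAlgebra.Build k k^o (fun c : k => c)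
  erefl (fun _ _ => erefl) (fun _ _ => erefl) (fun c u => mulrC c u).

HB.instance Definition _ := @PzRing_isPzAlgebra.Build k {poly k} polyC
  (rmorph1 _) (rmorphD _) (rmorphM _) (fun c u => mulrC c%:P u).

HB.instance Definition _ (n : nat) :=
  @PzRing_isPzAlgebra.Build k (mpoly n k) (@mpolyC n k)
  (rmorph1 _) (rmorphD _) (rmorphM _) (fun c u => mulrC (mpolyC n c) u).

Fact malgC_comm (K : monomType) (c : k) (u : {malg k[K]}) :
  GRing.comm (malgC c) u.
Proof.
rewrite /GRing.comm malgM_def fgmulUg malgM_def fgmulgU.
by apply: eq_bigr => l _; rewrite mul1m mulm1 mulrC.
Qed.

HB.instance Definition _ (K : monomType) :=
  @PzRing_isPzAlgebra.Build k {malg k[K]} (@malgC K k)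
  (rmorph1 _) (rmorphD _) (rmorphM _) (@malgC_comm K).

End Instances.

Definition alghom (k : pzRingType) (A B : pzAlgType k) (f : A -> B) : Prop :=
  [/\ {morph f : u v / u + v}, {morph f : u v / u * v}
    & forall c : k, f c%:K = c%:K].

Definition deg (k : nzRingType) (p : {poly k}) : nat := (size p).-1.

Definition peval (k : nzRingType) (A : pzAlgType k) (p : {poly k}) (z : A) : A :=
  \sum_(i < size p) (p`_i)%:K * z ^+ i.

Section QuotientAlgebra.
Variables (k : pzRingType) (A : pzAlgType k) (S : A -> Prop).

(* The two-sided ideal generated by S. *)
Inductive ideal : A -> Prop :=
| ideal_gen s of S s : ideal s
| ideal0 : ideal 0
| idealD u v of ideal u & ideal v : ideal (u + v)
| idealMl u v of ideal v : ideal (u * v)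
| idealMr u v of ideal u : ideal (u * v).

Definition ideal_eqv (u v : A) : bool := `[< ideal (u - v) >].

Fact idealN u : ideal u -> ideal (- u).
Proof. by move=> iu; rewrite -mulN1r; apply: idealMl. Qed.

Fact ideal_eqv_refl : reflexive ideal_eqv.
Proof. by move=> u; apply/asboolP; rewrite subrr; apply: ideal0. Qed.

Fact ideal_eqv_sym : symmetric ideal_eqv.
Proof.
by move=> u v; apply/asboolP/asboolP => /idealN; rewrite opprB.
Qed.

Fact ideal_eqv_trans : transitive ideal_eqv.
Proof.
move=> v u w /asboolP uv /asboolP vw; apply/asboolP.
by rewrite -(subrKA v); apply: idealD.
Qed.

Canonical ideal_equiv :=
  EquivRel ideal_eqv ideal_eqv_refl ideal_eqv_sym ideal_eqv_trans.

Definition quot := {eq_quot ideal_equiv}.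
HB.instance Definition _ : EqQuotient A ideal_eqv quot := EqQuotient.on quot.
HB.instance Definition _ := Choice.on quot.

Definition qpi (u : A) : quot := \pi u.

Lemma qpi_eq u v : qpi u = qpi v <-> ideal (u - v).
Proof.
split=> [/eqP|uv]; first by rewrite /qpi piE => /asboolP.
by apply/eqP; rewrite /qpi piE; apply/asboolP.
Qed.

Lemma qpi_repr (x : quot) : qpi (repr x) = x.
Proof. exact: reprK. Qed.

Definition qadd (x y : quot) := qpi (repr x + repr y).
Definition qopp (x : quot) := qpi (- repr x).
Definition qmul (x y : quot) := qpi (repr x * repr y).

Fact ideal_repr u : ideal (repr (qpi u) - u).
Proof. by apply/qpi_eq; rewrite qpi_repr. Qed.

Fact qaddE u v : qadd (qpi u) (qpi v) = qpi (u + v).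
Proof. by apply/qpi_eq; rewrite opprD addrACA; apply: idealD; apply: ideal_repr. Qed.

Fact qoppE u : qopp (qpi u) = qpi (- u).
Proof. by apply/qpi_eq; rewrite -opprD; apply/idealN/ideal_repr. Qed.

Fact qmulE u v : qmul (qpi u) (qpi v) = qpi (u * v).
Proof.
apply/qpi_eq; rewrite -(subrKA (repr (qpi u) * v)) -mulrBr -mulrBl.
by apply: idealD; [apply: idealMl | apply: idealMr]; apply: ideal_repr.
Qed.

Fact qind (P : quot -> Prop) : (forall u, P (qpi u)) -> forall x, P x.
Proof. by move=> Pu x; rewrite -[x]qpi_repr. Qed.

Fact qaddA : associative qadd.
Proof. by do 3![elim/qind=> ?]; rewrite !qaddE addrA. Qed.
Fact qaddC : commutative qadd.
Proof. by do 2![elim/qind=> ?]; rewrite !qaddE addrC. Qed.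
Fact qadd0 : left_id (qpi 0) qadd.
Proof. by elim/qind=> ?; rewrite qaddE add0r. Qed.
Fact qaddN : left_inverse (qpi 0) qopp qadd.
Proof. by elim/qind=> ?; rewrite qoppE qaddE addNr. Qed.
HB.instance Definition _ := GRing.isZmodule.Build quot qaddA qaddC qadd0 qaddN.

Fact qmulA : associative qmul.
Proof. by do 3![elim/qind=> ?]; rewrite !qmulE mulrA. Qed.
Fact qmul1l : left_id (qpi 1) qmul.
Proof. by elim/qind=> ?; rewrite qmulE mul1r. Qed.
Fact qmul1r : right_id (qpi 1) qmul.
Proof. by elim/qind=> ?; rewrite qmulE mulr1. Qed.
Fact qmulDl : left_distributive qmul qadd.
Proof. by do 3![elim/qind=> ?]; rewrite !(qmulE, qaddE) mulrDl. Qed.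
Fact qmulDr : right_distributive qmul qadd.
Proof. by do 3![elim/qind=> ?]; rewrite !(qmulE, qaddE) mulrDr. Qed.
HB.instance Definition _ :=
  GRing.Zmodule_isPzRing.Build quot qmulA qmul1l qmul1r qmulDl qmulDr.

Fact qcentral (c : k) (x : quot) : GRing.comm (qpi c%:K) x.
Proof. by elim/qind: x => u; rewrite /GRing.comm [LHS]qmulE [RHS]qmulE algCC. Qed.
Fact qalgCD : {morph (fun c : k => qpi c%:K) : c d / c + d}.
Proof. by move=> c d; rewrite [RHS]qaddE algCD. Qed.
Fact qalgCM : {morph (fun c : k => qpi c%:K) : c d / c * d}.
Proof. by move=> c d; rewrite [RHS]qmulE algCM. Qed.
Fact qalgC1 : qpi (1 : k)%:K = 1.
Proof. by rewrite algC1. Qed.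
HB.instance Definition _ :=
  @PzRing_isPzAlgebra.Build k quot _ qalgC1 qalgCD qalgCM qcentral.

End QuotientAlgebra.

(* The tensor product N (x) M balanced along the operators ra c, la c:        *)
(* formal sums of pure tensors modulo biadditivity and                        *)
(* ra c n (x) m = n (x) la c m. Formal sums need no signs, as                 *)
(* - (n (x) m) = (- n) (x) m. Taking for ra and la a right and a left module  *)
(* structure over a ring C yields the tensor product over C.                  *)
Section Tensor.
Variables (C : Type) (N M : zmodType) (ra : C -> N -> N) (la : C -> M -> M).

Inductive teq : seq (N * M) -> seq (N * M) -> Prop :=
| teq_refl s : teq s s
| teq_sym s t of teq s t : teq t s
| teq_trans s t u of teq s t & teq t u : teq s u
| teq_cat s s' t t' of teq s s' & teq t t' : teq (s ++ t) (s' ++ t')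
| teq_catC s t : teq (s ++ t) (t ++ s)
| teq_Dl n n' m : teq [:: (n + n', m)] [:: (n, m); (n', m)]
| teq_Dr n m m' : teq [:: (n, m + m')] [:: (n, m); (n, m')]
| teq_0l m : teq [:: (0, m)] [::]
| teq_bal c n m : teq [:: (ra c n, m)] [:: (n, la c m)].

Definition teqv s t : bool := `[< teq s t >].

Fact teqv_refl : reflexive teqv.
Proof. by move=> s; apply/asboolP; apply: teq_refl. Qed.
Fact teqv_sym : symmetric teqv.
Proof. by move=> s t; apply/asboolP/asboolP; apply: teq_sym. Qed.
Fact teqv_trans : transitive teqv.
Proof.
by move=> t s u /asboolP st /asboolP tu; apply/asboolP; apply: teq_trans st tu.
Qed.

Canonical teq_equiv := EquivRel teqv teqv_refl teqv_sym teqv_trans.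

Definition tens := {eq_quot teq_equiv}.
HB.instance Definition _ : EqQuotient _ teqv tens := EqQuotient.on tens.
HB.instance Definition _ := Choice.on tens.

Definition tpi (s : seq (N * M)) : tens := \pi s.

Lemma tpi_eq s t : tpi s = tpi t <-> teq s t.
Proof.
split=> [/eqP|st]; first by rewrite /tpi piE => /asboolP.
by apply/eqP; rewrite /tpi piE; apply/asboolP.
Qed.

Lemma tpi_repr (x : tens) : tpi (repr x) = x.
Proof. exact: reprK. Qed.

Definition tneg (s : seq (N * M)) := [seq (- p.1, p.2) | p <- s].
Definition tadd (x y : tens) := tpi (repr x ++ repr y).
Definition topp (x : tens) := tpi (tneg (repr x)).

Fact teq_repr s : teq (repr (tpi s)) s.
Proof. by apply/tpi_eq; rewrite tpi_repr. Qed.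

Fact tind (P : tens -> Prop) : (forall s, P (tpi s)) -> forall x, P x.
Proof. by move=> Ps x; rewrite -[x]tpi_repr. Qed.

Fact taddE s t : tadd (tpi s) (tpi t) = tpi (s ++ t).
Proof. by apply/tpi_eq/teq_cat; apply: teq_repr. Qed.

Fact teq_neg s : teq (tneg s ++ s) [::].
Proof.
elim: s => [|[n m] s IHs] /=; first exact: teq_refl.
apply: (@teq_trans _ ([:: (- n, m); (n, m)] ++ (tneg s ++ s))).
  rewrite -cat1s -[(n, m) :: s]cat1s !catA.
  apply: teq_cat (teq_refl _); rewrite -[[:: (- n, m); (n, m)]]cat1s -!catA.
  exact: teq_cat (teq_refl _) (teq_catC _ _).
rewrite -[[::]]cat0s; apply: teq_cat IHs; apply: teq_trans (teq_0l m).
by rewrite -(addNr n); apply/teq_sym/teq_Dl.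
Qed.

Fact taddA : associative tadd.
Proof. by do 3![elim/tind=> ?]; rewrite !taddE catA. Qed.
Fact taddC : commutative tadd.
Proof. by do 2![elim/tind=> ?]; rewrite !taddE; apply/tpi_eq/teq_catC. Qed.
Fact tadd0 : left_id (tpi [::]) tadd.
Proof. by elim/tind=> ?; rewrite taddE. Qed.
Fact taddN : left_inverse (tpi [::]) topp tadd.
Proof.
move=> x; rewrite /topp -[X in tadd _ X]tpi_repr taddE.
exact/tpi_eq/teq_neg.
Qed.
HB.instance Definition _ := GRing.isZmodule.Build tens taddA taddC tadd0 taddN.

Definition pure (n : N) (m : M) : tens := tpi [:: (n, m)].

Lemma pureDl m : {morph pure^~ m : n n' / n + n'}.
Proof. by move=> n n'; rewrite [RHS]taddE; apply/tpi_eq/teq_Dl. Qed.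
Lemma pureDr n : {morph pure n : m m' / m + m'}.
Proof. by move=> m m'; rewrite [RHS]taddE; apply/tpi_eq/teq_Dr. Qed.
Lemma pure_bal c n m : pure (ra c n) m = pure n (la c m).
Proof. exact/tpi_eq/teq_bal. Qed.

Lemma tpiE s : tpi s = \sum_(p <- s) pure p.1 p.2.
Proof.
elim: s => [|[n m] s IHs]; first by rewrite big_nil.
by rewrite big_cons -IHs [RHS]taddE.
Qed.

Lemma tens_sum (x : tens) : x = \sum_(p <- repr x) pure p.1 p.2.
Proof. by rewrite -tpiE tpi_repr. Qed.

Definition balanced (P : zmodType) (b : N -> M -> P) : Prop :=
  [/\ forall m, {morph b^~ m : n n' / n + n'},
      forall n, {morph b n : m m' / m + m'}
    & forall c n m, b (ra c n) m = b n (la c m)].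

(* The map N (x) M -> P induced by b : N x M -> P; it is computed on an       *)
(* arbitrary representative, hence meaningful for balanced b (tlift_pure).    *)
Definition tlift (P : zmodType) (b : N -> M -> P) (x : tens) : P :=
  \sum_(p <- repr x) b p.1 p.2.

Lemma tlift_tpi (P : zmodType) (b : N -> M -> P) s :
  balanced b -> tlift b (tpi s) = \sum_(p <- s) b p.1 p.2.
Proof.
case=> bDl bDr bb; rewrite /tlift.
move: (teq_repr s); move: (repr _) => r; elim=> {r s} //=.
- by move=> ? ? ? _ -> _ ->.
- by move=> ? ? ? ? _ E _ E'; rewrite !big_cat /= E E'.
- by move=> ? ?; rewrite !big_cat /= addrC.
- by move=> n n' m; rewrite !big_cons !big_nil !addr0 /= bDl.
- by move=> n m m'; rewrite !big_cons !big_nil !addr0 /= bDr.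
- move=> m; rewrite big_cons !big_nil addr0 /=.
  by apply: (addrI (b 0 m)); rewrite -bDl !addr0.
- by move=> c n m; rewrite !big_cons !big_nil /= bb.
Qed.

Lemma tlift_pure (P : zmodType) (b : N -> M -> P) n m :
  balanced b -> tlift b (pure n m) = b n m.
Proof. by move=> hb; rewrite tlift_tpi // big_seq1. Qed.

Lemma tliftD (P : zmodType) (b : N -> M -> P) :
  balanced b -> {morph tlift b : x y / x + y}.
Proof.
move=> hb; elim/tind=> s; elim/tind=> t.
by rewrite [tpi s + _]taddE !tlift_tpi // big_cat.
Qed.

Lemma tens_ext (P : zmodType) (f g : tens -> P) :
    {morph f : x y / x + y} -> {morph g : x y / x + y} ->
  (forall n m, f (pure n m) = g (pure n m)) -> f =1 g.
Proof.
have h0 (h : tens -> P) : {morph h : x y / x + y} -> h 0 = 0.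
  by move=> hD; apply: (addrI (h 0)); rewrite -hD !addr0.
move=> fD gD fg x; rewrite (tens_sum x) (big_morph f fD (h0 f fD)).
by rewrite (big_morph g gD (h0 g gD)); apply: eq_bigr => p _.
Qed.

End Tensor.

Section AlgebraTensor.
Variables (k : comPzRingType) (A B : pzAlgType k).

Local Notation lmulA := (fun (c : k) (u : A) => c%:K * u).
Local Notation lmulB := (fun (c : k) (v : B) => c%:K * v).

Definition talg := tens lmulA lmulB.
HB.instance Definition _ := GRing.Zmodule.on talg.

Definition ptens (u : A) (v : B) : talg := pure _ _ u v.

Fact ptensDl v : {morph ptens^~ v : u u' / u + u'}. Proof. exact: pureDl. Qed.
Fact ptensDr u : {morph ptens u : v v' / v + v'}. Proof. exact: pureDr. Qed.
Fact ptensZ (c : k) u v : ptens (c%:K * u) v = ptens u (c%:K * v).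
Proof. exact: pure_bal. Qed.

Definition talift (P : zmodType) (b : A -> B -> P) (x : talg) : P :=
  @tlift k A B lmulA lmulB P b x.

Definition tamul (x y : talg) : talg :=
  talift (fun u v => talift (fun u' v' => ptens (u * u') (v * v')) y) x.

Fact mul_bal u v : balanced lmulA lmulB (fun u' v' => ptens (u * u') (v * v')).
Proof.
split=> [v' u' u''|u' v' v''|c u' v'];
  rewrite ?mulrDr ?ptensDl ?ptensDr //.
by rewrite !mulrA -!algCC -!mulrA ptensZ.
Qed.

Fact mul_balr y : balanced lmulA lmulB
  (fun u v => talift (fun u' v' => ptens (u * u') (v * v')) y : talg).
Proof.
split=> [v u u'|u v v'|c u v]; rewrite /talift /tlift -?big_split;
  apply: eq_bigr => p _ /=; rewrite ?mulrDl ?ptensDl ?ptensDr //.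
by rewrite -!mulrA ptensZ.
Qed.

Fact tamulDl : left_distributive tamul +%R.
Proof. by move=> x y z; apply: (tliftD (mul_balr z)). Qed.
Fact tamulDr : right_distributive tamul +%R.
Proof.
move=> x y z; rewrite /tamul [in LHS]/talift /tlift [in X in _ = X + _]/talift /tlift.
rewrite [in X in _ = _ + X]/talift /tlift -big_split.
by apply: eq_bigr => p _; apply: (tliftD (mul_bal _ _)).
Qed.
Fact tamulE u v u' v' :
  tamul (ptens u v) (ptens u' v') = ptens (u * u') (v * v').
Proof.
apply: etrans (tlift_pure u v (mul_balr _)) _.
exact: (tlift_pure u' v' (mul_bal u v)).
Qed.

Fact tamulA : associative tamul.
Proof.
move=> x y z; move: x; apply: tens_ext => [x x'|x x'|u v].
- by rewrite tamulDl.
- by rewrite !tamulDl.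
move: y; apply: tens_ext => [y y'|y y'|u' v'].
- by rewrite tamulDl tamulDr.
- by rewrite tamulDr tamulDl.
move: z; apply: tens_ext => [z z'|z z'|u'' v''].
- by rewrite !tamulDr.
- by rewrite tamulDr.
by rewrite !tamulE !mulrA.
Qed.

Fact tamul1l : left_id (ptens 1 1) tamul.
Proof.
apply: tens_ext => // [x y|u v]; first by rewrite tamulDr.
by rewrite tamulE !mul1r.
Qed.
Fact tamul1r : right_id (ptens 1 1) tamul.
Proof.
apply: tens_ext => // [x y|u v]; first by rewrite tamulDl.
by rewrite tamulE !mulr1.
Qed.

HB.instance Definition _ :=
  GRing.Zmodule_isPzRing.Build talg tamulA tamul1l tamul1r tamulDl tamulDr.

Lemma ptensM u v u' v' : ptens u v * ptens u' v' = ptens (u * u') (v * v').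
Proof. exact: tamulE. Qed.

Definition tascal (c : k) : talg := ptens c%:K 1.

Fact tascal1 : tascal 1 = 1.
Proof. by rewrite /tascal algC1. Qed.
Fact tascalD : {morph tascal : c d / c + d}.
Proof. by move=> c d; rewrite /tascal algCD ptensDl. Qed.
Fact tascalM : {morph tascal : c d / c * d}.
Proof. by move=> c d; rewrite /tascal ptensM mul1r algCM. Qed.
Fact tascalC c x : GRing.comm (tascal c) x.
Proof.
move: x; apply: tens_ext => [x y|x y|u v].
- by rewrite mulrDr.
- by rewrite mulrDl.
by rewrite [LHS]ptensM [RHS]ptensM mul1r mulr1 algCC.
Qed.
HB.instance Definition _ :=
  @PzRing_isPzAlgebra.Build k talg tascal tascal1 tascalD tascalM tascalC.

End AlgebraTensor.

Definition atmap (k : comPzRingType) (A B A' B' : pzAlgType k)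
    (f : A -> A') (h : B -> B') : talg A B -> talg A' B' :=
  talift (fun u v => ptens (f u) (h v)).

Definition tassoc (k : comPzRingType) (A B D : pzAlgType k) :
    talg (talg A B) D -> talg A (talg B D) :=
  talift (fun t w => talift (fun u v => ptens u (ptens v w)) t).

Record hopf (k : comNzRingType) (H : pzAlgType k) := Hopf {
  comul : H -> talg H H;
  counit : H -> k^o;
  antipode : H -> H;
  comul_alghom : alghom comul;
  counit_alghom : alghom counit;
  antipodeD : {morph antipode : u v / u + v};
  antipodeZ : forall (c : k) u, antipode (c%:K * u) = c%:K * antipode u;
  comulA : forall h,
    tassoc (atmap comul id (comul h)) = atmap id comul (comul h);
  counitl : forall h, talift (fun u v => (counit u)%:K * v) (comul h) = h;
  counitr : forall h, talift (fun u v => (counit v)%:K * u) (comul h) = h;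
  antipodel : forall h,
    talift (fun u v => antipode u * v) (comul h) = (counit h)%:K;
  antipoder : forall h,
    talift (fun u v => u * antipode v) (comul h) = (counit h)%:K }.

Section HopfNotions.
Variables (k : comNzRingType) (H : pzAlgType k).

Definition subspace (D : H -> Prop) : Prop :=
  D 0 /\ forall (c : k) u v, D u -> D v -> D (c%:K * u + v).

Definition subalgebra (D : H -> Prop) : Prop :=
  [/\ subspace D, D 1 & forall u v, D u -> D v -> D (u * v)].

Definition affine : Prop :=
  exists s : seq H, forall D, subalgebra D -> {in s, forall z, D z} ->
    forall h, D h.

(* The subspace D (x) E of H (x) H. *)
Definition in_tens (D E : H -> Prop) (t : talg H H) : Prop :=
  exists2 s : seq (H * H), (forall p, p \in s -> D p.1 /\ E p.2)
    & t = \sum_(p <- s) ptens p.1 p.2.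

Variable HH : hopf H.

Definition subcoalgebra (D : H -> Prop) : Prop :=
  subspace D /\ forall d, D d -> in_tens D D (comul HH d).

Definition simple_subcoalgebra (D : H -> Prop) : Prop :=
  [/\ subcoalgebra D, exists2 d, D d & d <> 0
    & forall E : H -> Prop, subcoalgebra E -> (forall u, E u -> D u) ->
      (forall u, E u -> u = 0) \/ (forall u, D u -> E u)].

Definition one_dimensional (D : H -> Prop) : Prop :=
  exists2 d, d <> 0 & forall u, D u <-> exists c : k, u = c%:K * d.

Definition pointed : Prop :=
  forall D, simple_subcoalgebra D -> one_dimensional D.

Definition right_coideal_subalgebra (D : H -> Prop) : Prop :=
  subalgebra D /\ forall d, D d -> in_tens D (fun=> True) (comul HH d).

End HopfNotions.

(* A right R-module is a left module over the converse ring R^c. *)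
Section FaithfulFlatness.
Variable R : pzRingType.

Definition exact_at (U V W : zmodType) (f : U -> V) (g : V -> W) : Prop :=
  forall v, g v = 0 <-> exists u, f u = v.

Definition mtens (N : lmodType R^c) (M : lmodType R) :=
  tens (fun (c : R) (n : N) => (c : R^c) *: n) (fun (c : R) (m : M) => c *: m).
HB.instance Definition _ N M := GRing.Zmodule.on (mtens N M).

Definition mtmap (N N' : lmodType R^c) (M M' : lmodType R)
    (f : N -> N') (h : M -> M') : mtens N M -> mtens N' M' :=
  tlift (fun n m => (pure _ _ (f n) (h m) : mtens N' M')).

Definition faithfully_flat_left (M : lmodType R) : Prop :=
  forall (N1 N2 N3 : lmodType R^c)
         (f : {linear N1 -> N2}) (g : {linear N2 -> N3}),
  exact_at f g <->
  exact_at (mtmap f (@id M)) (mtmap g (@id M)).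

Definition faithfully_flat_right (N : lmodType R^c) : Prop :=
  forall (M1 M2 M3 : lmodType R)
         (f : {linear M1 -> M2}) (g : {linear M2 -> M3}),
  exact_at f g <->
  exact_at (mtmap (@id N) f) (mtmap (@id N) g).

End FaithfulFlatness.

(* A subalgebra D of H as a ring, and H as a left and a right D-module. *)
Section OverSubalgebra.
Variables (k : comNzRingType) (H : pzAlgType k) (D : H -> Prop).
Hypothesis Dalg : subalgebra D.

Definition subalg_pred : pred H := fun u => `[< D u >].

Definition subalg (_ : subalgebra D) := {u : H | subalg_pred u}.
HB.instance Definition _ := SubChoice.on (subalg Dalg).

Fact subalg_zmod : zmod_closed subalg_pred.
Proof.
case: Dalg => -[D0 Dlin] _ _; split=> [|u v /asboolP Du /asboolP Dv].
  exact/asboolP.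
by apply/asboolP; rewrite addrC -mulN1r -algC1 -algCN; apply: Dlin.
Qed.

Fact subalg_ring : subring_closed subalg_pred.
Proof.
case: Dalg => _ D1 DM; split=> [||u v /asboolP Du /asboolP Dv].
- exact/asboolP.
- by case: subalg_zmod.
exact/asboolP/DM.
Qed.

HB.instance Definition _ :=
  GRing.SubChoice_isSubZmodule.Build H subalg_pred (subalg Dalg) subalg_zmod.
HB.instance Definition _ :=
  GRing.SubZmodule_isSubPzRing.Build H subalg_pred (subalg Dalg) subalg_ring.

Definition left_over (_ : subalgebra D) : Type := H.
HB.instance Definition _ := GRing.Zmodule.on (left_over Dalg).

Definition lover_scale (c : subalg Dalg) (h : left_over Dalg) : left_over Dalg :=
  (val c : H) * (h : H).

Fact lover_scaleA c d h :
  lover_scale c (lover_scale d h) = lover_scale (c * d) h.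
Proof. exact: mulrA. Qed.
Fact lover_scale1 : left_id 1 lover_scale.
Proof. exact: mul1r. Qed.
Fact lover_scaleDr : right_distributive lover_scale +%R.
Proof. by move=> c; apply: mulrDr. Qed.
Fact lover_scaleDl h : {morph lover_scale^~ h : c d / c + d}.
Proof. by move=> c d; apply: mulrDl. Qed.
HB.instance Definition _ :=
  GRing.Zmodule_isLmodule.Build (subalg Dalg) (left_over Dalg)
    lover_scaleA lover_scale1 lover_scaleDr lover_scaleDl.

Definition right_over (_ : subalgebra D) : Type := H.
HB.instance Definition _ := GRing.Zmodule.on (right_over Dalg).

Definition rover_scale (c : (subalg Dalg)^c) (h : right_over Dalg) :
    right_over Dalg := (h : H) * (val (c : subalg Dalg) : H).

Fact rover_scaleA c d h :
  rover_scale c (rover_scale d h) = rover_scale (c * d) h.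
Proof. by rewrite /rover_scale -mulrA. Qed.
Fact rover_scale1 : left_id 1 rover_scale.
Proof. exact: mulr1. Qed.
Fact rover_scaleDr : right_distributive rover_scale +%R.
Proof. by move=> c u v; apply: mulrDl. Qed.
Fact rover_scaleDl h : {morph rover_scale^~ h : c d / c + d}.
Proof. by move=> c d; apply: mulrDr. Qed.
HB.instance Definition _ :=
  GRing.Zmodule_isLmodule.Build (subalg Dalg)^c (right_over Dalg)
    rover_scaleA rover_scale1 rover_scaleDr rover_scaleDl.

End OverSubalgebra.

Section QuantumHomogeneousSpace.
Variables (k : comNzRingType) (H : pzAlgType k) (HH : hopf H).

Definition right_quantum_homogeneous_space (D : H -> Prop) : Prop :=
  right_coideal_subalgebra HH D /\
  exists Dalg : subalgebra D,
    faithfully_flat_left (left_over Dalg) /\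
    faithfully_flat_right (right_over Dalg).
End QuantumHomogeneousSpace.

Definition free_alg (k : comNzRingType) (I : choiceType) : pzAlgType k :=
  {malg k[{fmonom I}]}.

Section FreeProduct.
Variables (k : comNzRingType) (A B : pzAlgType k).

Definition letter (l : (A + B)%type) : free_alg k (A + B)%type :=
  mkmalgU (fmu l) 1.

(* The relations making the letters from A and those from B multiply, add     *)
(* and scale as they do in A and in B.                                        *)
Inductive freeprod_rel : free_alg k (A + B)%type -> Prop :=
| fpDl u v : freeprod_rel
    (letter (inl (u + v)) - (letter (inl u) + letter (inl v)))
| fpMl u v : freeprod_rel
    (letter (inl (u * v)) - letter (inl u) * letter (inl v))
| fpCl (c : k) : freeprod_rel (letter (inl c%:K) - c%:K)
| fpDr u v : freeprod_rel
    (letter (inr (u + v)) - (letter (inr u) + letter (inr v)))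
| fpMr u v : freeprod_rel
    (letter (inr (u * v)) - letter (inr u) * letter (inr v))
| fpCr (c : k) : freeprod_rel (letter (inr c%:K) - c%:K).

Definition freeprod : pzAlgType k := quot freeprod_rel.
Definition finl (u : A) : freeprod := qpi _ (letter (inl u)).
Definition finr (v : B) : freeprod := qpi _ (letter (inr v)).

End FreeProduct.

Section Axag.
Variable k : comNzRingType.

(* k[a, a^-1] = k[X0, X1] / (X0 X1 - 1), with a = X0 and a^-1 = X1. The type  *)
(* mpoly 2 k is written out as monalg redefines the notation {mpoly k[2]}.    *)
Definition laurent_rel (z : mpoly 2 k) : Prop :=
  z = 'X_ord0 * 'X_(lift ord0 ord0) - 1.
Definition laurent : pzAlgType k := quot laurent_rel.
Definition laurentX : laurent := qpi laurent_rel 'X_ord0.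
Definition laurentV : laurent := qpi laurent_rel 'X_(lift ord0 ord0).

(* k[x] * k[a^{+-1}] *)
Definition xafree : pzAlgType k := freeprod {poly k} laurent.
Definition xafree_x : xafree := finl _ 'X.
Definition xafree_a : xafree := finr _ laurentX.
Definition xafree_ainv : xafree := finr _ laurentV.

(* The sum of all words with j letters a and i letters x. *)
Definition word_sum (A : pzRingType) (a x : A) (j i : nat) : A :=
  \sum_(w : (j + i).-tuple bool | count_mem true w == j)
    \prod_(b <- w) (if b then a else x).

Variable g : {poly k}.

Definition sigma (j : nat) : xafree :=
  \sum_(j <= i < (deg g).+1) (g`_i)%:K * word_sum xafree_a xafree_x j (i - j)
  - (g`_j)%:K * xafree_a ^+ deg g.

Definition sigma_rel (z : xafree) : Prop :=
  exists2 j, (1 <= j < deg g)%N & z = sigma j.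

Definition Axag : pzAlgType k := quot sigma_rel.
Definition Axag_x : Axag := qpi sigma_rel xafree_x.
Definition Axag_a : Axag := qpi sigma_rel xafree_a.
Definition Axag_ainv : Axag := qpi sigma_rel xafree_ainv.

End Axag.

Section Agf.
Variables (k : comNzRingType) (g f : {poly k}).

(* A(y,b,f) is Axag f, with y and b for its elements Axag_x and Axag_a. *)
Definition Atens : pzAlgType k := talg (Axag g) (Axag f).
Definition Atens_x : Atens := ptens (Axag_x g) 1.
Definition Atens_a : Atens := ptens (Axag_a g) 1.
Definition Atens_ainv : Atens := ptens (Axag_ainv g) 1.
Definition Atens_y : Atens := ptens 1 (Axag_x f).
Definition Atens_b : Atens := ptens 1 (Axag_a f).
Definition Atens_binv : Atens := ptens 1 (Axag_ainv f).

Definition Agf_rel (z : Atens) : Prop :=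
  z = Atens_a ^+ deg g - Atens_b ^+ deg f \/
  z = peval g Atens_x - peval f Atens_y.

Definition Agf : pzAlgType k := quot Agf_rel.
Definition Agf_x : Agf := qpi Agf_rel Atens_x.
Definition Agf_a : Agf := qpi Agf_rel Atens_a.
Definition Agf_ainv : Agf := qpi Agf_rel Atens_ainv.
Definition Agf_y : Agf := qpi Agf_rel Atens_y.
Definition Agf_b : Agf := qpi Agf_rel Atens_b.
Definition Agf_binv : Agf := qpi Agf_rel Atens_binv.

(* The Hopf structure of A(g,f) is determined by its values on generators.    *)
Definition Agf_hopf_spec (HH : hopf Agf) : Prop :=
  [/\ [/\ comul HH Agf_a = ptens Agf_a Agf_a,
          comul HH Agf_x = ptens 1 Agf_x + ptens Agf_x Agf_a,
          counit HH Agf_a = 1 & counit HH Agf_x = 0],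
      antipode HH Agf_a = Agf_ainv /\
      antipode HH Agf_x = - (Agf_x * Agf_ainv),
      [/\ comul HH Agf_b = ptens Agf_b Agf_b,
          comul HH Agf_y = ptens 1 Agf_y + ptens Agf_y Agf_b,
          counit HH Agf_b = 1 & counit HH Agf_y = 0]
    & antipode HH Agf_b = Agf_binv /\
      antipode HH Agf_y = - (Agf_y * Agf_binv)].

(* The coordinate ring k[x, y] / (g(x) - f(y)), with x = X0 and y = X1. *)
Definition curve_rel (z : mpoly 2 k) : Prop :=
  z = peval g 'X_ord0 - peval f 'X_(lift ord0 ord0).
Definition curve_ring : pzAlgType k := quot curve_rel.
Definition curve_x : curve_ring := qpi curve_rel 'X_ord0.
Definition curve_y : curve_ring := qpi curve_rel 'X_(lift ord0 ord0).

End Agf.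

(* Main.v *)
From HB Require Import structures.
From mathcomp Require Import monalg mpoly.
From mathcomp Require Import all_boot all_order all_algebra boolp.
From mathcomp Require Import zify.
From mathcomp Require classical_sets.
Require Import Defs.

Set Implicit Arguments.
Unset Strict Implicit.
Unset Printing Implicit Defensive.

Import GRing.Theory.
Local Open Scope ring_scope.

(** Let w = a^n. The relations of A(x,a,g) say that g(x + t a) = g(x) + g(t) w for
    a central variable t, and the whole proof rests on this identity.

    A homomorphism from A(g, f) to an algebra B is the same as six elements of B
    that satisfy the relations ([Agf_lift]). For the comultiplication, t is
    replaced by (x + t a) (x) 1, which commutes with 1 (x) x and 1 (x) a. In terms
    of coefficients: the sums of all words with prescribed numbers of letters are
    the entries of a matrix that is multiplicative for the comultiplication
    ([Q_comul]), and the inverse of this matrix gives the antipode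
    ([Q_antipode]). As A(g, f) is generated by group-like and skew-primitive
    elements, it is pointed ([pointed_generated]): the number of skew-primitive
    factors defines a coalgebra filtration, and the elements of lowest degree in
    a simple subcoalgebra produce a group-like element.

    Since g(x + t a) commutes with x + t a, both w and g(x) are central. Order
    the words in x and a by length, and lexicographically with x < a. The
    coefficient of t^j in the identity above has the leading word a^j x^(n-j). It
    suffices to resolve the overlaps of the leading words for consecutive values
    of j, and such an overlap is resolved by a coefficient of the commutation of
    x + t a with g(x + t a) ([relation_syzygy]). So over k[w, 1/w] the relations
    form a Groebner basis, and rewriting to normal form is well defined on
    A(x,a,g) ([nf_relation]). The normal words are the words x^l e with e normal
    and not starting with x. Hence A(x,a,g) is a free left module over
    k[x, w, 1/w].

    The two central elements w and g(x) of A(x,a,g) are identified with the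
    corresponding elements of A(y,b,f). Combining both normal forms, A(g, f) is a
    free left module over O[w, 1/w], where O is the coordinate ring of the curve
    ([coordinates_exist], [spanned_all]). The coordinates are obtained by letting
    A(g, f) act by right translation on the functionals on pairs of words that
    kill the relations ([functional_Agf]), and applying it to the functional that
    takes a coefficient of the normal form. As A(g, f) is free over O, with 1 in a
    basis, O embeds in it and A(g, f) is faithfully flat over O on the left
    ([free_faithfully_flat_left]). The relations are symmetric under reversal of
    words, which gives an antiautomorphism that fixes O ([reversal_exists]) and
    carries the result to the right. *)

(** * Homomorphisms and generators of algebras *)

Lemma morph0 (U V : zmodType) (f : U -> V) : {morph f : u v / u + v} -> f 0 = 0.
Proof. by move=> fD; apply: (addrI (f 0)); rewrite -fD !addr0. Qed.

Section Alghom.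
Variable k : comNzRingType.
Implicit Types A B C : pzAlgType k.

Lemma alghom0 A B (f : A -> B) : alghom f -> f 0 = 0.
Proof. by case=> /morph0. Qed.

Lemma alghom1 A B (f : A -> B) : alghom f -> f 1 = 1.
Proof. by case=> _ _ fK; rewrite -[1 in LHS](@algC1 k) fK algC1. Qed.

Lemma alghomN A B (f : A -> B) : alghom f -> {morph f : u / - u}.
Proof.
move=> hf u; apply: (addrI (f u)); case: (hf) => fD _ _.
by rewrite -fD !subrr (alghom0 hf).
Qed.

Lemma alghomB A B (f : A -> B) : alghom f -> {morph f : u v / u - v}.
Proof. by move=> hf u v; rewrite -(alghomN hf); case: hf. Qed.

Lemma alghomX A B (f : A -> B) n : alghom f -> {morph f : u / u ^+ n}.
Proof.
move=> hf u; elim: n => [|n IH]; first by rewrite !expr0 (alghom1 hf).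
by rewrite !exprS -IH; case: hf.
Qed.

Lemma alghom_sum A B (f : A -> B) (hf : alghom f) I (r : seq I) (P : pred I) F :
  f (\sum_(i <- r | P i) F i) = \sum_(i <- r | P i) f (F i).
Proof. by apply: (big_morph f _ (alghom0 hf)); case: hf. Qed.

Lemma alghom_prod A B (f : A -> B) (hf : alghom f) I (r : seq I) (P : pred I) F :
  f (\prod_(i <- r | P i) F i) = \prod_(i <- r | P i) f (F i).
Proof. by apply: (big_morph f _ (alghom1 hf)); case: hf. Qed.

Lemma alghomZ A B (f : A -> B) (c : k) u :
  alghom f -> f (c%:K * u) = c%:K * f u.
Proof. by case=> _ fM fK; rewrite fM fK. Qed.

Lemma alghom_id A : alghom (id : A -> A). Proof. by []. Qed.

Lemma alghom_comp A B C (f : B -> C) (h : A -> B) :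
  alghom f -> alghom h -> alghom (f \o h).
Proof.
move=> [fD fM fK] [hD hM hK]; split=> [u v|u v|c] /=.
- by rewrite hD fD.
- by rewrite hM fM.
by rewrite hK fK.
Qed.

Lemma alghom_peval A B (f : A -> B) (p : {poly k}) u :
  alghom f -> f (peval p u) = peval p (f u).
Proof.
move=> hf; rewrite /peval (alghom_sum hf); apply: eq_bigr => i _.
by rewrite (alghomZ _ _ hf) (alghomX _ hf).
Qed.

Lemma alghom_word_sum A B (f : A -> B) a x j i :
  alghom f -> f (word_sum a x j i) = word_sum (f a) (f x) j i.
Proof.
move=> hf; rewrite /word_sum (alghom_sum hf); apply: eq_bigr => w _.
by rewrite (alghom_prod hf); apply: eq_bigr => b _; case: b.
Qed.

(** ** Subalgebras *)

Lemma subalg_algC A (D : A -> Prop) (c : k) : subalgebra D -> D c%:K.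
Proof.
by move=> [[D0 Dl] D1 _]; rewrite -[_%:K]mulr1 -[_ * _]addr0; apply: Dl.
Qed.

Lemma subalgD A (D : A -> Prop) u v : subalgebra D -> D u -> D v -> D (u + v).
Proof.
by move=> [[_ Dl] _ _] Du Dv; rewrite -[u]mul1r -(@algC1 k); apply: Dl.
Qed.

Lemma subalgebraI A (D : A -> Prop) :
    (forall c : k, D c%:K) -> (forall u v, D u -> D v -> D (u + v)) ->
  (forall u v, D u -> D v -> D (u * v)) -> subalgebra D.
Proof.
move=> DK DD DM; split=> //; last by rewrite -(@algC1 k).
by split=> [|c u v Du Dv]; [rewrite -(@algC0 k) | apply/DD/Dv/DM].
Qed.

Lemma subalg_sum A (D : A -> Prop) I (r : seq I) (P : pred I) F :
  subalgebra D -> (forall i, P i -> D (F i)) -> D (\sum_(i <- r | P i) F i).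
Proof.
move=> hD DF; elim/big_rec: _ => [|i u Pi Du]; first by case: hD => -[].
by apply: (subalgD hD) => //; apply: DF.
Qed.

Lemma subalgX A (D : A -> Prop) u n : subalgebra D -> D u -> D (u ^+ n).
Proof.
case=> _ D1 DM Du; elim: n => [|n IH]; first by rewrite expr0.
by rewrite exprS; apply: DM.
Qed.

Lemma alghom_eqalg A B (f h : A -> B) :
  alghom f -> alghom h -> subalgebra (fun u => f u = h u).
Proof.
move=> [fD fM fK] [hD hM hK]; apply: subalgebraI => [c|u v E E'|u v E E'].
- by rewrite fK hK.
- by rewrite fD hD E E'.
by rewrite fM hM E E'.
Qed.

(** Generation is used as an induction principle. *)
Definition generated A (S : A -> Prop) :=
  forall D : A -> Prop, subalgebra D -> (forall z, S z -> D z) -> forall u, D u.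

Lemma generated_eq A B (S : A -> Prop) (f h : A -> B) :
  generated S -> alghom f -> alghom h -> (forall z, S z -> f z = h z) -> f =1 h.
Proof. by move=> gS hf hh; apply: gS; apply: alghom_eqalg. Qed.

Lemma alghom_preimage A B (f : A -> B) (D : B -> Prop) :
  alghom f -> subalgebra D -> subalgebra (fun u => D (f u)).
Proof.
move=> hf hD; case: (hf) => fD fM fK; apply: subalgebraI => [c|u v|u v].
- by rewrite fK; apply: subalg_algC.
- by rewrite fD; apply: subalgD.
by rewrite fM; case: hD => _ _; apply.
Qed.

(** ** Evaluation of polynomials *)

Section Evaluation.
Variable B : pzAlgType k.

Let trivial_alghom A : 1 = 0 :> B -> alghom (fun _ : A => 0 : B).
Proof.
move=> B0; have eqB (u v : B) : u = v by rewrite -[u]mul1r -[v]mul1r B0 !mul0r.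
by split=> [u v|u v|c]; apply: eqB.
Qed.

Let trivial_eq : 1 = 0 :> B -> forall u v : B, u = v.
Proof. by move=> B0 u v; rewrite -[u]mul1r -[v]mul1r B0 !mul0r. Qed.

(* Polynomials are evaluated in rings with 1 != 0; in the zero algebra there is *)
(* nothing to prove.                                                            *)
Section Nonzero.
Hypothesis B1 : 1 != 0 :> B.

Definition nzB : nzRingType :=
  HB.pack (PzAlgebra.sort B) (GRing.PzSemiRing_isNonZero.Build B B1).

Fact nz_scalar_monoid_morphism : monoid_morphism (algC : k -> nzB).
Proof. by split; [exact: (@algC1 k B) | exact: (@algCM k B)]. Qed.

Fact nz_scalar_zmod_morphism : zmod_morphism (algC : k -> nzB).
Proof. by move=> c d; rewrite (algCD c (- d)) algCN. Qed.

Definition nz_scalar : {rmorphism k -> nzB} := HB.pack (algC : k -> nzB)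
  (GRing.isZmodMorphism.Build k nzB _ nz_scalar_zmod_morphism)
  (GRing.isMonoidMorphism.Build k nzB _ nz_scalar_monoid_morphism).

End Nonzero.

Lemma poly_evaluation (x : B) :
  exists2 ev : {poly k} -> B, alghom ev & ev 'X = x.
Proof.
have [B0|B1] := eqVneq (1 : B) 0.
  by exists (fun=> 0); [apply: trivial_alghom | apply: trivial_eq].
have cx : commr_rmorph (nz_scalar B1) (x : nzB B1) by move=> c; apply: commr_sym; apply: (@algCC k B).
exists (horner_morph cx); first split=> [u v|u v|c].
- exact: (rmorphD (horner_morph cx)).
- exact: (rmorphM (horner_morph cx)).
- exact: (horner_morphC cx).
exact: (horner_morphX cx).
Qed.


Lemma mpoly2_evaluation (u v : B) : GRing.comm u v ->
  exists2 ev : mpoly 2 k -> B, alghom ev &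
    ev 'X_ord0 = u /\ ev 'X_(lift ord0 ord0) = v.
Proof.
move=> uv; have [B0|B1] := eqVneq (1 : B) 0.
  by exists (fun=> 0); [apply: trivial_alghom | split; apply: trivial_eq].
pose h (i : 'I_2) : nzB B1 := if i == ord0 then u else v.
have mmap1E m : mpoly.mmap1 h m = h ord0 ^+ m ord0 * h (lift ord0 ord0) ^+ m (lift ord0 ord0).
  by rewrite /mpoly.mmap1 !big_ord_recl big_ord0 mulr1.
have mmap1M m1 m2 : mpoly.mmap1 h (m1 + m2)%MM = mpoly.mmap1 h m1 * mpoly.mmap1 h m2.
  rewrite !mmap1E !mnmDE !exprD -!mulrA; congr (_ * _); rewrite !mulrA.
  by congr (_ * _); apply/commrX/commr_sym/commrX.
pose ev := mpoly.mmap (nz_scalar B1) h.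
have evD : {morph ev : p q / p + q} by move=> p q; exact: mpoly.mmapD.
have evZ c p : ev (c *: p) = c%:K * ev p by exact: mpoly.mmapZ.
have ev0 : ev 0 = 0 by exact: mpoly.mmap0.
have evX m : ev 'X_[m] = mpoly.mmap1 h m by exact: mpoly.mmapX.
exists ev; last by rewrite !evX !mpoly.mmap1U.
split=> [//|p q|c]; last first.
  exact: (mpoly.mmapC h (nz_scalar B1) c).
elim/mpolyind: p => [|c m p _ _ IH]; first by rewrite mul0r ev0 mul0r.
rewrite mulrDl !evD mulrDl IH; congr (_ + _).
rewrite -scalerAl !evZ -mulrA; congr (_ * _); clear IH.
elim/mpolyind: q => [|d m' q _ _ IH']; first by rewrite mulr0 ev0 mulr0.
rewrite mulrDr !evD mulrDr IH'; congr (_ + _).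
rewrite -scalerAr !evZ -mpolyXD !evX mmap1M !mulrA; congr (_ * _).
exact: (@algCC k B).
Qed.

Lemma free_evaluation (I : choiceType) (h : I -> B) :
  exists2 ev : free_alg k I -> B, alghom ev &
    forall i, ev (mkmalgU (fmu i) 1) = h i.
Proof.
have [B0|B1] := eqVneq (1 : B) 0.
  by exists (fun=> 0); [apply: trivial_alghom | move=> i; apply: trivial_eq].
pose hm (m : {fmonom I}) : nzB B1 := \prod_(i <- (m : seq I)) h i.
have hmM : mmorphism hm.
  by split=> [m m'|]; rewrite /hm ?fm1 ?big_nil // fmM big_cat.
pose hS : {mmorphism {fmonom I} -> nzB B1} := HB.pack hm
  (monalg.isMultiplicative.Build {fmonom I} (nzB B1) hm hmM).
pose ev := monalg.mmap (nz_scalar B1) hS.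
have comm : forall (p : {malg k[{fmonom I}]}) m m', GRing.comm ((nz_scalar B1) (monalg.mcoeff m p)) (hS m').
  by move=> p m m'; apply: (@algCC k B).
have evM := monalg.commr_mmap_is_multiplicative comm.
exists ev; first split=> [p q|p q|c].
- exact: (@monalg.mmapD _ _ _ (nz_scalar B1) hS p q).
- exact: evM.1.
- exact: (@monalg.mmapC _ _ _ (nz_scalar B1) hS c).
move=> i; rewrite /ev monalg.mmapU /= /hm fmU big_seq1.
by rewrite algC1 mul1r.
Qed.

End Evaluation.

Lemma mpoly2_generated :
  generated (fun z : mpoly 2 k => z = 'X_ord0 \/ z = 'X_(lift ord0 ord0)).
Proof.
move=> D hD DX p; have [[D0 Dl] D1 DM] := hD.
elim/mpolyind: p => // c m p _ _ Dp.
rewrite -mul_mpolyC; apply: Dl => //; rewrite mpolyXE_id.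
elim/big_rec: _ => // i q _ Dq; apply: DM => //; apply: subalgX => //.
apply: DX; case: (unliftP ord0 i) => [j ->|->]; [right|by left].
by rewrite (ord1 j).
Qed.

Lemma poly_generated : generated (fun z : {poly k} => z = 'X).
Proof.
move=> D hD DX p; elim/poly_ind: p => [|p c Dp]; first by case: hD => -[].
apply: subalgD => //; last exact: (subalg_algC c hD).
by case: hD => _ _; apply=> //; apply: DX.
Qed.

Lemma free_generated (I : choiceType) :
  generated (fun z : free_alg k I => exists i, z = mkmalgU (fmu i) 1).
Proof.
move=> D hD DX p; have [[D0 Dl] D1 DM] := hD.
rewrite (monalgE p); apply: subalg_sum => // m _.
have -> : mkmalgU m (monalg.mcoeff m p) = (monalg.mcoeff m p)%:K * mkmalgU m 1 :> free_alg k I.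
  by rewrite [RHS]malgM_def fgmulUU mul1m mulr1.
rewrite -[_ * _]addr0; apply: Dl => //.
case: m => m; elim: m => [|i m IH]; first by rewrite -fmoneE.
have -> : mkmalgU (FMonom (i :: m)) 1 = mkmalgU (fmu i) 1 * mkmalgU (FMonom m) 1 :> free_alg k I.
  rewrite [RHS]malgM_def fgmulUU mulr1; congr mkmalgU; apply/eqP.
  by rewrite fmP fmM fmU.
by apply: DM => //; apply: DX; exists i.
Qed.

End Alghom.

(** * Universal properties *)

Section QuotientLift.
Variables (k : comNzRingType) (A : pzAlgType k) (S : A -> Prop).

Lemma qpi_alghom : alghom (qpi S).
Proof.
split=> [u v|u v|c] //; first by rewrite [RHS]qaddE.
by rewrite [RHS]qmulE.
Qed.

Lemma qpi0 s : S s -> qpi S s = 0.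
Proof. by move=> Ss; apply/qpi_eq; rewrite subr0; apply: ideal_gen. Qed.

Lemma quot_lift (B : pzAlgType k) (f : A -> B) :
    alghom f -> (forall s, S s -> f s = 0) ->
  exists2 F : quot S -> B, alghom F & forall u, F (qpi S u) = f u.
Proof.
move=> hf fS; have [fD fM fK] := hf.
have fI u : ideal S u -> f u = 0.
  elim=> {u} [s /fS //||u v _ fu _ fv|u v _ fv|u v _ fu].
  - exact: alghom0.
  - by rewrite fD fu fv addr0.
  - by rewrite fM fv mulr0.
  by rewrite fM fu mul0r.
have FE u : f (repr (qpi S u)) = f u.
  apply/eqP; rewrite -subr_eq0 -(alghomB hf); apply/eqP/fI.
  exact: ideal_repr.
exists (f \o @repr _ _) => [|u] /=; last exact: FE.
split=> [x y|x y|c] /=; last exact: etrans (FE _) (fK c).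
- by rewrite -[x in LHS]qpi_repr -[y in LHS]qpi_repr [qpi _ _ + _]qaddE FE fD.
by rewrite -[x in LHS]qpi_repr -[y in LHS]qpi_repr [qpi _ _ * _]qmulE FE fM.
Qed.

Lemma quot_generated (G : A -> Prop) :
  generated G -> generated (fun z => exists2 u, G u & z = qpi S u).
Proof.
move=> gG D hD DG; elim/qind=> u; move: u; apply: gG => [|u Gu].
  exact: (alghom_preimage qpi_alghom hD).
by apply: DG; exists u.
Qed.

End QuotientLift.

Section FreeProductLift.
Variables (k : comNzRingType) (A B : pzAlgType k).

Lemma finl_alghom : alghom (@finl k A B).
Proof.
have [qD qM qK] := qpi_alghom (@freeprod_rel k A B).
split=> [u v|u v|c].
- apply: etrans (qD _ _); apply/qpi_eq; apply: ideal_gen; exact: fpDl.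
- apply: etrans (qM _ _); apply/qpi_eq; apply: ideal_gen; exact: fpMl.
by apply/qpi_eq; apply: ideal_gen; exact: fpCl.
Qed.

Lemma finr_alghom : alghom (@finr k A B).
Proof.
have [qD qM qK] := qpi_alghom (@freeprod_rel k A B).
split=> [u v|u v|c].
- apply: etrans (qD _ _); apply/qpi_eq; apply: ideal_gen; exact: fpDr.
- apply: etrans (qM _ _); apply/qpi_eq; apply: ideal_gen; exact: fpMr.
by apply/qpi_eq; apply: ideal_gen; exact: fpCr.
Qed.

Lemma freeprod_lift (C : pzAlgType k) (f : A -> C) (h : B -> C) :
    alghom f -> alghom h ->
  exists2 F : freeprod A B -> C, alghom F &
    (forall u, F (finl B u) = f u) /\ (forall v, F (finr A v) = h v).
Proof.
move=> hf hh; have [fD fM fK] := hf; have [hD hM hK] := hh.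
have [ev hev evE] := free_evaluation (fun l => match l with inl u => f u | inr v => h v end).
have [eD eM eK] := hev; have evE' l : ev (letter l) = match l with inl u => f u | inr v => h v end by exact: evE.
have [s []|F hF FE] := @quot_lift _ _ (@freeprod_rel k A B) _ _ hev.
- by move=> u v; rewrite (alghomB hev) eD !evE' fD subrr.
- by move=> u v; rewrite (alghomB hev) eM !evE' fM subrr.
- by move=> c; rewrite (alghomB hev) eK !evE' fK subrr.
- by move=> u v; rewrite (alghomB hev) eD !evE' hD subrr.
- by move=> u v; rewrite (alghomB hev) eM !evE' hM subrr.
- by move=> c; rewrite (alghomB hev) eK !evE' hK subrr.
by exists F => //; split=> u; rewrite FE evE'.
Qed.

Lemma freeprod_generated (G1 : A -> Prop) (G2 : B -> Prop) :
  generated G1 -> generated G2 ->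
  generated (fun z => (exists2 u, G1 u & z = finl B u) \/ (exists2 v, G2 v & z = finr A v)).
Proof.
move=> g1 g2 D hD DG; apply: (quot_generated (@free_generated k (A + B)%type)) => //.
move=> z [_ [[u|v] ->] ->].
- move: u; apply: g1 => [|u Gu]; first exact: (alghom_preimage finl_alghom hD).
  by apply: DG; left; exists u.
move: v; apply: g2 => [|u Gu]; first exact: (alghom_preimage finr_alghom hD).
by apply: DG; right; exists u.
Qed.

End FreeProductLift.

Section TensorLift.
Variables (k : comNzRingType) (A B : pzAlgType k).

Lemma ptensl_alghom : alghom (fun u : A => ptens u (1 : B)).
Proof.
split=> [u v|u v|c]; [exact: ptensDl | | by []].
by rewrite ptensM mulr1.
Qed.

Lemma ptensr_alghom : alghom (fun v : B => ptens (1 : A) v).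
Proof.
split=> [u v|u v|c]; [exact: ptensDr | by rewrite ptensM mulr1 | ].
by rewrite -[c%:K in LHS]mulr1 -ptensZ mulr1.
Qed.

Lemma ptensE (u : A) (v : B) : ptens u v = ptens u 1 * ptens 1 v.
Proof. by rewrite ptensM mulr1 mul1r. Qed.

Lemma ptensC (u : A) (v : B) : GRing.comm (ptens u (1 : B)) (ptens (1 : A) v).
Proof. by rewrite /GRing.comm !ptensM !mulr1 !mul1r. Qed.

Lemma ptensZl (c : k) (u : A) (v : B) : ptens (c%:K * u) v = c%:K * ptens u v.
Proof. by rewrite [RHS]ptensM mul1r. Qed.

Lemma ptensZr (c : k) (u : A) (v : B) : ptens u (c%:K * v) = c%:K * ptens u v.
Proof. by rewrite -ptensZ ptensZl. Qed.

Lemma ptens0l (v : B) : ptens (0 : A) v = 0.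
Proof. exact: morph0 (ptensDl v). Qed.

Lemma ptens0r (u : A) : ptens u (0 : B) = 0.
Proof. exact: morph0 (ptensDr u). Qed.

Lemma talg_ind (P : talg A B -> Prop) :
    P 0 -> (forall x y, P x -> P y -> P (x + y)) ->
  (forall u v, P (ptens u v)) -> forall x, P x.
Proof.
by move=> P0 PD Pp x; rewrite (tens_sum x); apply: big_ind => // p _; apply: Pp.
Qed.

(** Both sides are biadditive in x and y, so pure tensors suffice. *)
Lemma talg_morphM (C : pzRingType) (F : talg A B -> C) :
    {morph F : x y / x + y} ->
    (forall u v u' v', F (ptens u v * ptens u' v') = F (ptens u v) * F (ptens u' v')) ->
  {morph F : x y / x * y}.
Proof.
move=> FD Fp x y; have F0 := morph0 FD.
elim/talg_ind: x => [|x x' IH IH'|u v]; first by rewrite mul0r F0 mul0r.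
  by rewrite mulrDl !FD IH IH' mulrDl.
elim/talg_ind: y => [|x x' IH IH'|u' v'] //; first by rewrite mulr0 F0 mulr0.
by rewrite mulrDr !FD IH IH' mulrDr.
Qed.

Section Lift.
Variables (C : pzAlgType k) (f : A -> C) (h : B -> C).
Hypotheses (hf : alghom f) (hh : alghom h).
Hypothesis fh : forall u v, GRing.comm (f u) (h v).

Let lift_balanced : balanced (fun (c : k) (u : A) => c%:K * u)
  (fun (c : k) (v : B) => c%:K * v) (fun u v => f u * h v).
Proof.
case: hf hh => fD fM fK [hD hM hK]; split=> [v u u'|u v v'|c u v].
- by rewrite fD mulrDl.
- by rewrite hD mulrDr.
by rewrite fM hM fK hK algCC mulrA.
Qed.

Lemma talift_ptens u v : talift (fun u v => f u * h v) (ptens u v) = f u * h v.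
Proof. exact: tlift_pure. Qed.

Lemma talift_alghom : alghom (talift (fun u v => f u * h v)).
Proof.
have tD : {morph talift (fun u v => f u * h v) : x y / x + y}.
  exact: tliftD lift_balanced.
have [[fD fM fK] [hD hM hK]] := (hf, hh).
split=> // [|c]; last by apply: etrans (talift_ptens _ _) _; rewrite fK (alghom1 hh) mulr1.
apply: talg_morphM => // u v u' v'.
rewrite ptensM !talift_ptens fM hM -!mulrA; congr (_ * _).
by rewrite !mulrA; congr (_ * _); apply: fh.
Qed.

End Lift.

Lemma talg_generated (G1 : A -> Prop) (G2 : B -> Prop) :
  generated G1 -> generated G2 ->
  generated (fun z : talg A B => (exists2 u, G1 u & z = ptens u 1)
                                 \/ (exists2 v, G2 v & z = ptens 1 v)).
Proof.
move=> g1 g2 D hD DG; elim/talg_ind => [||u v].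
- by case: hD => -[].
- by move=> x y Dx Dy; apply: subalgD.
rewrite ptensE; case: (hD) => _ _; apply.
- move: u; apply: g1 => [|u Gu]; first exact: (alghom_preimage ptensl_alghom hD).
  by apply: DG; left; exists u.
move: v; apply: g2 => [|v Gv]; first exact: (alghom_preimage ptensr_alghom hD).
by apply: DG; right; exists v.
Qed.

End TensorLift.

Section TensorMap.
Variables (k : comNzRingType).
Implicit Types A B C D : pzAlgType k.

Lemma atmapE A B A' B' (f : A -> A') (h : B -> B') :
  atmap f h = talift (fun u v => ptens (f u) 1 * ptens 1 (h v)).
Proof.
rewrite /atmap; congr talift; apply/funext => u; apply/funext => v.
by rewrite -ptensE.
Qed.

Lemma atmap_alghom A B A' B' (f : A -> A') (h : B -> B') :
  alghom f -> alghom h -> alghom (atmap f h).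
Proof.
move=> hf hh; rewrite atmapE; apply: talift_alghom.
- exact: (alghom_comp (ptensl_alghom _ _) hf).
- exact: (alghom_comp (ptensr_alghom _ _) hh).
by move=> u v; apply: ptensC.
Qed.

Lemma atmap_ptens A B A' B' (f : A -> A') (h : B -> B') u v :
  alghom f -> alghom h -> atmap f h (ptens u v) = ptens (f u) (h v).
Proof.
move=> hf hh; rewrite atmapE.
rewrite (talift_ptens (alghom_comp (ptensl_alghom _ _) hf)
                      (alghom_comp (ptensr_alghom _ _) hh)) /=.
by rewrite -ptensE.
Qed.

Fact assoc_inner_balanced A B D (w : D) : balanced
  (fun (c : k) (u : A) => c%:K * u) (fun (c : k) (v : B) => c%:K * v)
  (fun u v => ptens u (ptens v w)).
Proof.
split=> [v u u'|u v v'|c u v]; first exact: ptensDl.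
- by rewrite ptensDl ptensDr.
by rewrite 2!ptensZl ptensZr.
Qed.

Fact tassoc_balanced A B D : balanced
  (fun (c : k) (t : talg A B) => c%:K * t) (fun (c : k) (w : D) => c%:K * w)
  (fun t w => talift (fun u v => ptens u (ptens v w)) t).
Proof.
split=> [w t t'|t w w'|c t w].
- exact: (tliftD (assoc_inner_balanced _ _ _)).
- rewrite /talift /tlift -big_split; apply: eq_bigr => p _.
  by rewrite ptensDr ptensDr.
pose F (w' : D) := talift (fun (u : A) (v : B) => ptens u (ptens v w')).
have FD w' : {morph F w' : x y / x + y} by exact: (tliftD (assoc_inner_balanced _ _ w')).
have F0 w' := morph0 (FD w').
have Fp w' u v : F w' (ptens u v) = ptens u (ptens v w').
  exact: (tlift_pure _ _ (assoc_inner_balanced _ _ w')).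
rewrite -/(F w) -/(F (c%:K * w)).
elim/talg_ind: t => [|t t' IH IH'|u v]; first by rewrite mulr0 !F0.
  by rewrite mulrDr !FD IH IH'.
by rewrite -ptensZl !Fp ptensZl !ptensZr.
Qed.

Lemma tassoc_ptens A B D (u : A) (v : B) (w : D) :
  tassoc (ptens (ptens u v) w) = ptens u (ptens v w).
Proof.
apply: etrans (tlift_pure _ _ (tassoc_balanced _ _ _)) _.
exact: (tlift_pure _ _ (assoc_inner_balanced _ _ _)).
Qed.

Lemma tassocD A B D : {morph @tassoc k A B D : x y / x + y}.
Proof. exact: (tliftD (tassoc_balanced _ _ _)). Qed.

Lemma tassoc_alghom A B D : alghom (@tassoc k A B D).
Proof.
have tD := @tassocD A B D; split=> [//||c]; last exact: tassoc_ptens.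
apply: talg_morphM => // t w t' w'; rewrite ptensM.
move: t; apply: tens_ext => [t1 t2|t1 t2|u v].
- by rewrite mulrDl ptensDl tD.
- by rewrite ptensDl tD mulrDl.
move: t'; apply: tens_ext => [t1 t2|t1 t2|u' v'].
- by rewrite mulrDr ptensDl tD.
- by rewrite ptensDl tD mulrDr.
rewrite -![pure _ _ _ _]/(ptens _ _) ptensM !tassoc_ptens.
by apply: esym; apply: etrans (ptensM _ _ _ _) _; rewrite ptensM.
Qed.

End TensorMap.

(** * The universal property of A(g, f) *)

Section Laurent.
Variable k : comNzRingType.

Lemma laurent_lift (B : pzAlgType k) (u v : B) : u * v = 1 -> v * u = 1 ->
  exists2 F : laurent k -> B, alghom F &
    F (laurentX k) = u /\ F (laurentV k) = v.
Proof.
move=> uv vu; have [|ev hev [evX evV]] := @mpoly2_evaluation k B u v.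
  by rewrite /GRing.comm uv vu.
have [s ->|F hF FE] := @quot_lift _ _ (@laurent_rel k) _ _ hev.
  rewrite (alghomB hev) (alghom1 hev); case: (hev) => _ -> _.
  by rewrite evX evV uv subrr.
by exists F => //; split; rewrite FE.
Qed.

Lemma laurentXV : laurentX k * laurentV k = 1.
Proof.
have [_ qM _] := qpi_alghom (@laurent_rel k).
apply: etrans (esym (qM _ _)) _.
by rewrite -(alghom1 (qpi_alghom (@laurent_rel k))); apply/qpi_eq/ideal_gen.
Qed.

Lemma laurentVX : laurentV k * laurentX k = 1.
Proof.
have [_ qM _] := qpi_alghom (@laurent_rel k).
by apply: etrans (esym (qM _ _)) _; rewrite mulrC; apply: etrans (qM _ _) laurentXV.
Qed.

Lemma laurent_generated : generated (fun z => z = laurentX k \/ z = laurentV k).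
Proof.
move=> D hD DG; apply: (quot_generated (@mpoly2_generated k)) => // z.
by case=> _ [] -> ->; apply: DG; [left|right].
Qed.

End Laurent.

(** The triples (x, a, a') that are the images of the generators under a
    homomorphism from A(x,a,g) to B; see [Axag_lift]. *)
Record Axag_data (k : comNzRingType) (g : {poly k}) (B : pzAlgType k)
    (x a a' : B) : Prop := AxagData {
  Axag_av : a * a' = 1;
  Axag_va : a' * a = 1;
  Axag_sigma : forall j, (1 <= j < deg g)%N ->
    \sum_(j <= i < (deg g).+1) (g`_i)%:K * word_sum a x j (i - j)
      = (g`_j)%:K * a ^+ deg g }.

Section Axag.
Variables (k : comNzRingType) (g : {poly k}).

(** Homomorphisms act on the relations of A(x,a,g) through this form, which is
    meaningful in every algebra. *)
Definition sigma_in (B : pzAlgType k) (x a : B) (j : nat) : B :=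
  \sum_(j <= i < (deg g).+1) (g`_i)%:K * word_sum a x j (i - j).

Lemma alghom_sigma (B C : pzAlgType k) (f : B -> C) x a j : alghom f ->
  f (sigma_in x a j - (g`_j)%:K * a ^+ deg g)
    = sigma_in (f x) (f a) j - (g`_j)%:K * f a ^+ deg g.
Proof.
move=> hf; rewrite /sigma_in (alghomB hf) (alghom_sum hf) (alghomZ _ _ hf).
rewrite (alghomX _ hf); congr (_ - _); apply: eq_bigr => i _.
by rewrite (alghomZ _ _ hf) (alghom_word_sum _ _ _ _ hf).
Qed.

Lemma Axag_data_alghom (B C : pzAlgType k) (f : B -> C) x a a' :
  alghom f -> Axag_data g x a a' -> Axag_data g (f x) (f a) (f a').
Proof.
move=> hf [av va sig]; have [fD fM fK] := hf; split.
- by rewrite -fM av (alghom1 hf).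
- by rewrite -fM va (alghom1 hf).
move=> j /sig /eqP; rewrite -subr_eq0 => /eqP /(congr1 f).
by rewrite (alghom_sigma _ _ _ hf) (alghom0 hf) => /eqP; rewrite subr_eq0 => /eqP.
Qed.

Lemma Axag_lift (B : pzAlgType k) (x a a' : B) : Axag_data g x a a' ->
  exists2 F : Axag g -> B, alghom F &
    [/\ F (Axag_x g) = x, F (Axag_a g) = a & F (Axag_ainv g) = a'].
Proof.
case=> av va sig; have [evx hx xE] := poly_evaluation x.
have [eva ha [aE vE]] := laurent_lift av va.
have [ev hev [evl evr]] := freeprod_lift hx ha.
have [s [j lt_j ->]|F hF FE] := @quot_lift _ _ (sigma_rel g) _ _ hev.
  apply: etrans (alghom_sigma _ _ _ hev) _.
  by rewrite evr evl aE xE [sigma_in _ _ _]sig // subrr.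
by exists F => //; split; rewrite FE ?evl ?evr.
Qed.

Lemma Axag_generic : Axag_data g (Axag_x g) (Axag_a g) (Axag_ainv g).
Proof.
have hq := qpi_alghom (sigma_rel g); have hr := finr_alghom {poly k} (laurent k).
have [_ qM _] := hq; have [_ rM _] := hr.
split; try by rewrite /Axag_a /Axag_ainv -qM -rM ?laurentXV ?laurentVX !alghom1.
move=> j lt_j; have := @qpi0 _ _ (sigma_rel g) (sigma g j).
move=> /(_ (ex_intro2 _ _ j lt_j erefl)) sig0; apply/eqP; rewrite -subr_eq0.
by apply/eqP; apply: etrans (esym (alghom_sigma _ _ _ hq)) sig0.
Qed.

Lemma Axag_generated :
  generated (fun z => [\/ z = Axag_x g, z = Axag_a g | z = Axag_ainv g]).
Proof.
move=> D hD DG.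
apply: (quot_generated (freeprod_generated (@poly_generated k) (@laurent_generated k))) => // z.
case=> _ [[_ ->]|[_ [] ->]] -> ->; apply: DG;
  [exact: Or31 | exact: Or32 | exact: Or33].
Qed.

End Axag.

Section Pushforward.
Variables (k : comNzRingType) (A B : pzAlgType k) (f : A -> B).
Hypothesis hf : alghom f.

Lemma alghom_subX u v n m : f (u ^+ n - v ^+ m) = f u ^+ n - f v ^+ m.
Proof. by rewrite (alghomB hf) !(alghomX _ hf). Qed.

Lemma alghom_sub_peval (p q : {poly k}) u v :
  f (peval p u - peval q v) = peval p (f u) - peval q (f v).
Proof. by rewrite (alghomB hf) !(alghom_peval _ _ hf). Qed.

End Pushforward.

(** The tuples that are the images of the generators under a homomorphism from
    A(g, f) to B; see [Agf_lift]. *)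
Record Agf_data (k : comNzRingType) (g f : {poly k}) (B : pzAlgType k)
    (x a a' y b b' : B) : Prop := AgfData {
  Agf_datax : Axag_data g x a a';
  Agf_datay : Axag_data f y b b';
  Agf_comm : forall u v, u \in [:: x; a; a'] -> v \in [:: y; b; b'] ->
    GRing.comm u v;
  Agf_ab : a ^+ deg g = b ^+ deg f;
  Agf_xy : peval g x = peval f y }.

Section Agf.
Variables (k : comNzRingType) (g f : {poly k}).

Lemma Agf_lift (B : pzAlgType k) (x a a' y b b' : B) :
    Agf_data g f x a a' y b b' ->
  exists2 F : Agf g f -> B, alghom F &
    [/\ [/\ F (Agf_x g f) = x, F (Agf_a g f) = a & F (Agf_ainv g f) = a']
      & [/\ F (Agf_y g f) = y, F (Agf_b g f) = b & F (Agf_binv g f) = b']].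
Proof.
case=> dx dy comm ab xy.
have [F1 h1 [F1x F1a F1v]] := Axag_lift dx.
have [F2 h2 [F2y F2b F2v]] := Axag_lift dy.
have F12 u v : GRing.comm (F1 u) (F2 v).
  have subC (w : B) : subalgebra (GRing.comm w).
    apply: subalgebraI => [c|z z'|z z']; [|exact: commrD|exact: commrM].
    exact/commr_sym/algCC.
  apply: (Axag_generated (alghom_preimage h2 (subC (F1 u))) _ v) => {}v Gv.
  apply: commr_sym.
  apply: (Axag_generated (alghom_preimage h1 (subC (F2 v))) _ u) => {}u Gu.
  apply/commr_sym/comm; first by case: Gu => ->; rewrite ?(F1x, F1a, F1v) !inE eqxx ?orbT.
  by case: Gv => ->; rewrite ?(F2y, F2b, F2v) !inE eqxx ?orbT.
have ht := talift_alghom h1 h2 F12.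
set t := talift _ in ht.
have tl u : t (ptens u 1) = F1 u.
  by apply: etrans (talift_ptens h1 h2 _ _) _; rewrite (alghom1 h2) mulr1.
have tr v : t (ptens 1 v) = F2 v.
  by apply: etrans (talift_ptens h1 h2 _ _) _; rewrite (alghom1 h1) mul1r.
have tx : t (Atens_x g f) = x by exact: etrans (tl _) F1x.
have ta : t (Atens_a g f) = a by exact: etrans (tl _) F1a.
have ty : t (Atens_y g f) = y by exact: etrans (tr _) F2y.
have tb : t (Atens_b g f) = b by exact: etrans (tr _) F2b.
have [s []|F hF FE] := @quot_lift _ _ (@Agf_rel k g f) _ _ ht.
- move=> ->; apply: etrans (alghom_subX ht (Atens_a g f) (Atens_b g f) _ _) _.
  by apply: etrans (congr2 (fun u v => u ^+ _ - v ^+ _) ta tb) _; rewrite ab subrr.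
- move=> ->; apply: etrans (alghom_sub_peval ht g f (Atens_x g f) (Atens_y g f)) _.
  by apply: etrans (congr2 (fun u v => peval g u - peval f v) tx ty) _; rewrite xy subrr.
exists F => //; split; split; apply: etrans (FE _) _ => //.
- exact: etrans (tl _) F1v.
- exact: etrans (tr _) F2v.
Qed.

Lemma Agf_generic : Agf_data g f (Agf_x g f) (Agf_a g f) (Agf_ainv g f)
  (Agf_y g f) (Agf_b g f) (Agf_binv g f).
Proof.
have hq := qpi_alghom (@Agf_rel k g f).
have hl := alghom_comp hq (ptensl_alghom (Axag g) (Axag f)).
have hr := alghom_comp hq (ptensr_alghom (Axag g) (Axag f)).
split.
- exact: (Axag_data_alghom hl (Axag_generic g)).
- exact: (Axag_data_alghom hr (Axag_generic f)).
- have comm u v : GRing.comm (qpi (@Agf_rel k g f) (ptens u 1)) (qpi (@Agf_rel k g f) (ptens 1 v)).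
    case: hq => _ qM _; rewrite /GRing.comm.
    by apply: etrans (esym (qM _ _)) _; apply: etrans (qM _ _); rewrite ptensC.
  by move=> u v; rewrite !inE => /or3P[] /eqP -> /or3P[] /eqP ->; apply: comm.
- apply/eqP; rewrite -subr_eq0; apply/eqP.
  by apply: etrans (esym (alghom_subX hq _ _ _ _)) _; apply: qpi0; left.
apply/eqP; rewrite -subr_eq0; apply/eqP.
by apply: etrans (esym (alghom_sub_peval hq _ _ _ _)) _; apply: qpi0; right.
Qed.

Definition Agf_generator (z : Agf g f) : Prop :=
  [\/ z = Agf_x g f, z = Agf_a g f | z = Agf_ainv g f] \/
  [\/ z = Agf_y g f, z = Agf_b g f | z = Agf_binv g f].

Lemma Agf_generated : generated Agf_generator.
Proof.
move=> D hD DG.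
apply: (quot_generated (talg_generated (@Axag_generated k g) (@Axag_generated k f))) => // z.
case=> _ [] [_ [] ->] -> ->; apply: DG.
- by left; apply: Or31.
- by left; apply: Or32.
- by left; apply: Or33.
- by right; apply: Or31.
- by right; apply: Or32.
by right; apply: Or33.
Qed.

Lemma Agf_affine : affine (Agf g f).
Proof.
pose gens x a a' y b b' : seq (Agf g f) := [:: x; a; a'; y; b; b'].
have mem x a a' y b b' z : [\/ z = x, z = a | z = a'] \/ [\/ z = y, z = b | z = b'] ->
    z \in gens x a a' y b b'.
  by case=> -[] ->; rewrite !inE eqxx ?orbT.
exists (gens (Agf_x g f) (Agf_a g f) (Agf_ainv g f)
  (Agf_y g f) (Agf_b g f) (Agf_binv g f)) => D hD DG.
by apply: (Agf_generated hD) => z Gz; apply/DG/mem.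
Qed.

End Agf.

(** * Sums of words *)

Fixpoint words (i j : nat) : seq (seq bool) :=
  match i, j with
  | 0, 0 => [:: [::]]
  | 0, _.+1 => [::]
  | i'.+1, 0 => map (cons false) (words i' 0)
  | i'.+1, j'.+1 => map (cons false) (words i' j) ++ map (cons true) (words i' j')
  end.

Lemma mem_words w i j :
  (w \in words i j) = (size w == i) && (count_mem true w == j).
Proof.
elim: i j w => [|i IH] [|j] w //=.
- by rewrite inE; case: w.
- by rewrite in_nil; case: w => [|b w] //=.
- case: w => [|b w]; first by apply/negP => /mapP[].
  rewrite /= eqSS; case: b => /=.
    by rewrite andbF; apply/negP => /mapP[].
  rewrite -IH; apply/mapP/idP => [[v vw [->]] //|ww]; by exists w.
case: w => [|b w]; first by rewrite mem_cat; apply/negP => /orP[] /mapP[].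
rewrite mem_cat /= eqSS; case: b => /=; rewrite ?add0n ?add1n ?eqSS -IH.
  rewrite (_ : (_ \in map _ (words i j.+1)) = false); last by apply/negP => /mapP[].
  by apply/mapP/idP => [[v vw [->]] //|ww]; exists w.
rewrite (_ : (_ \in map _ (words i j)) = false) ?orbF; last by apply/negP => /mapP[].
by apply/mapP/idP => [[v vw [->]] //|ww]; exists w.
Qed.

Lemma words_uniq i j : uniq (words i j).
Proof.
have cinj b : injective (cons b : seq bool -> _) by move=> u v [].
elim: i j => [|i IH] [|j] //=; first by rewrite map_inj_uniq.
rewrite cat_uniq !map_inj_uniq // !IH /= andbT; apply/hasPn => w /mapP[v _ ->].
by apply/negP => /mapP[].
Qed.

Section WordSums.
Variable V : zmodType.
Implicit Type phi : seq bool -> V.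

Definition wsum phi i j := \sum_(w <- words i j) phi w.

Lemma wsum00 phi : wsum phi 0 0 = phi [::].
Proof. by rewrite /wsum big_seq1. Qed.

Lemma wsum0S phi j : wsum phi 0 j.+1 = 0.
Proof. by rewrite /wsum big_nil. Qed.

Lemma wsumS0 phi i : wsum phi i.+1 0 = wsum (phi \o cons false) i 0.
Proof. by rewrite /wsum big_map. Qed.

Lemma wsumSS phi i j : wsum phi i.+1 j.+1 =
  wsum (phi \o cons false) i j.+1 + wsum (phi \o cons true) i j.
Proof. by rewrite /wsum big_cat !big_map. Qed.

Lemma wsumS0r phi i : wsum phi i.+1 0 = wsum (phi \o rcons^~ false) i 0.
Proof.
elim: i phi => [|i IH] phi; first by rewrite wsumS0 !wsum00.
by rewrite wsumS0 IH wsumS0.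
Qed.

Lemma wsumSSr phi i j : wsum phi i.+1 j.+1 =
  wsum (phi \o rcons^~ false) i j.+1 + wsum (phi \o rcons^~ true) i j.
Proof.
elim: i j phi => [|i IH] j phi.
  rewrite wsumSS !wsum0S !add0r; case: j => [|j]; last by rewrite !wsum0S.
  by rewrite !wsum00.
rewrite [LHS]wsumSS [X in X + _ = _]IH; case: j => [|j]; last first.
  by rewrite [X in _ + X = _]IH !wsumSS addrACA.
by rewrite [X in _ + X = _]wsumS0r wsumSS wsumS0 addrAC -addrA.
Qed.

Lemma wsum_small phi i j : (i < j)%N -> wsum phi i j = 0.
Proof.
move=> lt_ij; rewrite /wsum big_seq big1 // => w; rewrite mem_words.
case/andP=> /eqP sw /eqP cw; have := count_size (pred1 true) w.
by rewrite sw cw leqNgt lt_ij.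
Qed.

Lemma eq_wsum phi phi' i j :
  {in words i j, phi =1 phi'} -> wsum phi i j = wsum phi' i j.
Proof.
by move=> E; apply: eq_big_seq.
Qed.

End WordSums.

Section WordProducts.
Variable R : pzRingType.
Implicit Types a x : R.

Definition wprod a x (w : seq bool) : R := \prod_(b <- w) (if b then a else x).

Lemma wprod_cons a x b w : wprod a x (b :: w) = (if b then a else x) * wprod a x w.
Proof. by rewrite /wprod big_cons. Qed.

Lemma wprod_cat a x u w : wprod a x (u ++ w) = wprod a x u * wprod a x w.
Proof. by rewrite /wprod big_cat. Qed.

(** P(j, i - j), indexed by the total number i of letters: both recurrences
    below change i by one. *)
Definition Q a x i j := wsum (wprod a x) i j.

Lemma Q0 a x j : Q a x 0 j = (j == 0%N)%:R.
Proof.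
by case: j => [|j]; rewrite /Q ?wsum0S // wsum00 /wprod big_nil.
Qed.

Lemma QSl a x i j :
  Q a x i.+1 j = x * Q a x i j + (if j is j'.+1 then a * Q a x i j' else 0).
Proof.
have E b i' j' : wsum (wprod a x \o cons b) i' j' = (if b then a else x) * Q a x i' j'.
  by rewrite /Q /wsum mulr_sumr; apply: eq_bigr => w _; rewrite /= wprod_cons.
by case: j => [|j]; rewrite /Q ?wsumS0 ?wsumSS !E ?addr0.
Qed.

Lemma QSr a x i j :
  Q a x i.+1 j = Q a x i j * x + (if j is j'.+1 then Q a x i j' * a else 0).
Proof.
have E b i' j' : wsum (wprod a x \o rcons^~ b) i' j' = Q a x i' j' * (if b then a else x).
  rewrite /Q /wsum mulr_suml; apply: eq_bigr => w _; rewrite /=.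
  by rewrite -cats1 wprod_cat /wprod big_seq1.
by case: j => [|j]; rewrite /Q ?wsumS0r ?wsumSSr !E ?addr0.
Qed.

Lemma Q_small a x i j : (i < j)%N -> Q a x i j = 0.
Proof. exact: wsum_small. Qed.

Lemma Q_diag a x i : Q a x i i = a ^+ i.
Proof.
elim: i => [|i IH]; first by rewrite Q0.
by rewrite QSl Q_small // mulr0 add0r IH exprS.
Qed.

Lemma Q_col0 a x i : Q a x i 0 = x ^+ i.
Proof.
by elim: i => [|i IH]; rewrite ?Q0 // QSl addr0 IH exprS.
Qed.

Lemma word_sumE a x j i : word_sum a x j i = Q a x (j + i) j.
Proof.
rewrite /word_sum -big_filter.
rewrite -(big_map (@tval _ _) xpredT (fun w => \prod_(b <- w) (if b then a else x))).
apply: perm_big; apply: uniq_perm.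
- rewrite map_inj_uniq; last exact: val_inj.
  by rewrite filter_uniq // index_enum_uniq.
- exact: words_uniq.
move=> w; rewrite mem_words; apply/mapP/andP.
  by case=> t; rewrite mem_filter => /andP[ct _] ->; rewrite size_tuple.
case=> sw cw; exists (Tuple sw) => //.
by rewrite mem_filter cw mem_index_enum.
Qed.

End WordProducts.

Section Sigma.
Variables (k : fieldType) (g : {poly k}) (R : pzAlgType k).
Implicit Types a x : R.

(** This is the coefficient of t^j in g(x + t a) for a central variable t. *)
Definition gcoef a x j : R := \sum_(i < size g) (g`_i)%:K * Q a x i j.

Lemma gcoef0 a x : gcoef a x 0 = peval g x.
Proof. by apply: eq_bigr => i _; rewrite Q_col0. Qed.

Lemma gcoef_big a x j : (deg g < j)%N -> gcoef a x j = 0.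
Proof.
move=> lt_j; rewrite /gcoef big1 // => i _; rewrite Q_small ?mulr0 //.
by apply: leq_trans lt_j; rewrite /deg; case: (size g) i => [[]|s []].
Qed.

(** g(x + t a) commutes with x + t a; the coefficients of t^(j+1) are compared. *)
Lemma gcoef_comm a x j :
  x * gcoef a x j.+1 + a * gcoef a x j = gcoef a x j.+1 * x + gcoef a x j * a.
Proof.
rewrite /gcoef !mulr_sumr !mulr_suml -!big_split; apply: eq_bigr => i _ /=.
by rewrite !mulrA -!(algCC _ _) -!mulrA -!mulrDr -QSl -QSr.
Qed.

Hypothesis g0 : g != 0.

Let size_g : size g = (deg g).+1.
Proof. by rewrite /deg prednK // size_poly_gt0. Qed.

Lemma gcoef_deg a x : gcoef a x (deg g) = (g`_(deg g))%:K * a ^+ deg g.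
Proof.
rewrite /gcoef size_g big_ord_recr /= Q_diag big1 ?add0r // => i _.
by rewrite Q_small ?mulr0.
Qed.

Lemma sigma_inE a x j : sigma_in g x a j = gcoef a x j.
Proof.
rewrite /gcoef size_g -(big_mkord xpredT (fun i => (g`_i)%:K * Q a x i j)).
rewrite /sigma_in; have [le_j|lt_j] := leqP j (deg g).
  have low : \sum_(0 <= i < j) (g`_i)%:K * Q a x i j = 0.
    by rewrite big_nat big1 // => i lt_ij; rewrite Q_small ?mulr0.
  rewrite (big_cat_nat (leq0n j) (leqW le_j)) /= low add0r.
  by apply: eq_big_nat => i /andP[le_ji _]; rewrite word_sumE subnKC.
rewrite [LHS]big_geq //; rewrite big_nat big1 // => i /= lt_i; rewrite Q_small ?mulr0 //.
exact: leq_trans lt_i lt_j.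
Qed.

(** Up to constant terms, the relations of A(x,a,g) say that
    g(x + t a) = g(x) + g(t) a^n. For j >= n the coefficients of t^j agree in
    any algebra. *)
Lemma Axag_dataP a x a' : Axag_data g x a a' <->
  [/\ a * a' = 1, a' * a = 1 &
      forall j, (0 < j)%N -> gcoef a x j = (g`_j)%:K * a ^+ deg g].
Proof.
split=> [[av va sig]|[av va sig]]; split=> //.
  move=> j j0; case: (ltngtP j (deg g)) => [lt_j|lt_j|->].
  - by rewrite -sig ?j0 // -sigma_inE.
  - by rewrite gcoef_big // nth_default ?size_g // algC0 mul0r.
  exact: gcoef_deg.
by move=> j /andP[j0 _]; rewrite -sig // -sigma_inE.
Qed.

Section Relations.
Variables a x a' : R.
Hypothesis ax : Axag_data g x a a'.

Let sig : forall j, (0 < j)%N -> gcoef a x j = (g`_j)%:K * a ^+ deg g.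
Proof. by case/Axag_dataP: ax. Qed.


Lemma Axag_gx_x : GRing.comm (peval g x) x.
Proof.
rewrite /GRing.comm /peval mulr_sumr mulr_suml; apply: eq_bigr => i _.
by rewrite -mulrA -exprSr exprS !mulrA; congr (_ * _); apply: algCC.
Qed.

Hypothesis deg_g : (1 < deg g)%N.

Let lead_unit (u v : R) : (g`_(deg g))%:K * u = (g`_(deg g))%:K * v -> u = v.
Proof.
move/(congr1 (fun w => (g`_(deg g))^-1%:K * w)); rewrite !mulrA -!algCM.
by rewrite mulVf ?algC1 ?mul1r // -lead_coefE lead_coef_eq0.
Qed.

(** Comparing the coefficients of t^n in [x + t a, g(x + t a)] = 0. *)
Lemma Axag_an_x : GRing.comm (a ^+ deg g) x.
Proof.
apply: lead_unit; have := gcoef_comm a x (deg g).-1.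
rewrite prednK; last exact: ltnW.
rewrite !sig //; [|by rewrite -subn1 subn_gt0 |exact: ltnW].
have -> : a * ((g`_(deg g).-1)%:K * a ^+ deg g) = (g`_(deg g).-1)%:K * a ^+ deg g * a.
  by rewrite mulrA -algCC -!mulrA -exprS -exprSr.
move/addIr; rewrite mulrA -[x * _]algCC -!mulrA => E; symmetry; exact: E.
Qed.

(** Comparing the coefficients of t in [x + t a, g(x + t a)] = 0. *)
Lemma Axag_gx_a : GRing.comm (peval g x) a.
Proof.
have := gcoef_comm a x 0; rewrite gcoef0 sig //.
rewrite mulrA -algCC -!mulrA -Axag_an_x => /addrI E; symmetry; exact: E.
Qed.

End Relations.

End Sigma.

(** * Comultiplication of sums of words *)

Section Comul.
Variables (k : fieldType) (H : pzAlgType k).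
Implicit Types a x : H.

(** The sums of words are the entries of a matrix that is multiplicative for
    the comultiplication: a word in the letters 1 (x) x + x (x) a and a (x) a
    is expanded according to the letters of its right tensor factor. *)
Lemma Q_comul a x i j N : (i < N)%N ->
  Q (ptens a a) (ptens 1 x + ptens x a) i j
    = \sum_(l < N) ptens (Q a x l j) (Q a x i l).
Proof.
elim: i j N => [|i IH] j [//|N] lt_iN.
  rewrite big_ord_recl big1 => [|l _]; last by rewrite [Q _ _ 0 (lift _ _)]Q0 ptens0r.
  by rewrite addr0 !Q0; case: j => [|j] //; rewrite ptens0l.
pose tl j' : talg H H := \sum_(l < N) ptens (Q a x l j') (Q a x i l).
have -> : \sum_(l < N.+1) ptens (Q a x l j) (Q a x i.+1 l) =
    \sum_(l < N) ptens (Q a x l j) (x * Q a x i l)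
      + \sum_(l < N) ptens (Q a x l.+1 j) (a * Q a x i l).
  transitivity (\sum_(l < N.+1) (ptens (Q a x l j) (x * Q a x i l)
     + ptens (Q a x l j) (if val l is l'.+1 then a * Q a x i l' else 0))).
    by apply: eq_bigr => l _; rewrite QSl ptensDr.
  rewrite big_split /=; congr (_ + _).
    by rewrite big_ord_recr /= [Q _ _ i N]Q_small // mulr0 ptens0r addr0.
  by rewrite big_ord_recl /= ptens0r add0r.
rewrite QSl mulrDl !(IH _ N) // !mulr_sumr -addrA; congr (_ + _).
  by apply: eq_bigr => l _; rewrite ptensM mul1r.
case: j tl => [|j] _.
  by rewrite addr0; apply: eq_bigr => l _; rewrite ptensM QSl addr0.
rewrite (IH _ N) // mulr_sumr -big_split; apply: eq_bigr => l _ /=.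
by rewrite !ptensM -ptensDl QSl.
Qed.

Variables (g : {poly k}) (a x a' : H).
Hypotheses (ax : Axag_data g x a a') (g_neq0 : g != 0) (g0 : g`_0 = 0).

Let size_g : size g = (deg g).+1.
Proof. by rewrite /deg prednK // size_poly_gt0. Qed.

Let sig : forall j, (0 < j)%N -> gcoef g a x j = (g`_j)%:K * a ^+ deg g.
Proof. by case/(Axag_dataP g_neq0): ax. Qed.

(** The relations turn the right factors of [Q_comul], summed over the
    coefficients of g, into multiples of a^n. For j = 0 this says that g(x) is
    skew-primitive, for j > 0 that the relations are preserved. *)
Lemma gcoef_comul j : gcoef g (ptens a a) (ptens 1 x + ptens x a) j
  = ptens (j == 0%N)%:R (peval g x) + ptens (gcoef g a x j) (a ^+ deg g).
Proof.
transitivity (\sum_(l < size g) ptens (Q a x l j) (gcoef g a x l)).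
  transitivity (\sum_(i < size g) \sum_(l < size g)
      ptens (Q a x l j) ((g`_i)%:K * Q a x i l)).
    apply: eq_bigr => i _; rewrite (Q_comul _ _ _ (ltn_ord i)) mulr_sumr.
    by apply: eq_bigr => l _; rewrite ptensZr.
  rewrite exchange_big; apply: eq_bigr => l _ /=.
  by rewrite /gcoef (big_morph _ (ptensDr _) (ptens0r _ _)).
rewrite {2}/gcoef size_g !big_ord_recl g0 algC0 mul0r add0r gcoef0 Q0.
congr (_ + _); rewrite (big_morph _ (ptensDl _) (ptens0l _ _)).
by apply: eq_bigr => l _; rewrite sig // ptensZ.
Qed.

Lemma ptensX (u v : H) n : ptens u v ^+ n = ptens (u ^+ n) (v ^+ n).
Proof. by elim: n => [|n IH]; rewrite ?expr0 // !exprS IH ptensM. Qed.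

Lemma Axag_data_comul :
  Axag_data g (ptens 1 x + ptens x a) (ptens a a) (ptens a' a').
Proof.
have [av va _] := ax; apply/(Axag_dataP g_neq0); split; rewrite ?ptensM ?av ?va //.
move=> j j0; rewrite gcoef_comul sig // ptensX -ptensZl.
by case: j j0 => // j _; rewrite ptens0l add0r.
Qed.

Lemma peval_comul : peval g (ptens 1 x + ptens x a)
  = ptens 1 (peval g x) + ptens (peval g x) (a ^+ deg g).
Proof. by rewrite -(gcoef0 g (ptens a a)) gcoef_comul gcoef0. Qed.

End Comul.

(** * The opposite algebra and the antipode *)

Lemma expr_inverse (R : pzRingType) (u v : R) n :
  u * v = 1 -> v * u = 1 -> u ^+ n * v ^+ n = 1.
Proof.
by move=> uv vu; rewrite -exprMn_comm ?uv ?expr1n // /GRing.comm uv vu.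
Qed.

Section Converse.
Variables (k : comNzRingType) (A : pzAlgType k).

Fact conv_algCM : {morph (fun c : k => c%:K : A^c) : c d / c * d}.
Proof. by move=> c d; rewrite mulrC algCM. Qed.

(* The antipode and the reversal of words are homomorphisms to this algebra. *)
HB.instance Definition _ := @PzRing_isPzAlgebra.Build k A^c (fun c => c%:K : A)
  (@algC1 k A) (@algCD k A) conv_algCM
  (fun c u => commr_sym (algCC c (u : A))).

End Converse.

Section Antipode.
Variables (k : fieldType) (H : pzAlgType k).
Implicit Types a x : H.

(** Reversing all words permutes the words with j letters a and i - j letters x. *)
Lemma Q_conv a x i j : Q (a : H^c) (x : H^c) i j = Q a x i j.
Proof.
elim: i j => [|i IH] j; first by rewrite !Q0; case: j.
by rewrite QSl QSr IH; case: j => [|j] //; rewrite IH.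
Qed.

Lemma gcoef_conv (g : {poly k}) a x j :
  gcoef g (a : H^c) (x : H^c) j = gcoef g a x j.
Proof. by apply: eq_bigr => i _; rewrite Q_conv [LHS]algCC. Qed.

Lemma exprn_conv a n : (a : H^c) ^+ n = a ^+ n.
Proof. by elim: n => [|n IH] //; rewrite exprS exprSr IH. Qed.

Lemma Axag_data_conv (g : {poly k}) x a a' : g != 0 ->
  Axag_data g x a a' -> Axag_data g (x : H^c) (a : H^c) (a' : H^c).
Proof.
move=> g_neq0 /(Axag_dataP g_neq0)[av va sig]; apply/(Axag_dataP g_neq0).
split=> // j j0; rewrite gcoef_conv sig // exprn_conv; exact: (@algCC k H).
Qed.

(** The sums of words in the images of the letters under the antipode form the
    inverse of the matrix of [Q_comul]. *)
Lemma Q_antipode a x a' i j N : a' * a = 1 -> (i < N)%N ->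
  \sum_(l < N) Q a' (- (x * a')) l j * Q a x i l = (i == j)%:R.
Proof.
move=> va; elim: i j N => [|i IH] j [//|N] lt_iN.
  rewrite big_ord_recl big1 => [|l _]; last by rewrite [Q _ _ 0 (lift _ _)]Q0 mulr0.
  by rewrite addr0 !Q0 mulr1 eq_sym.
set y := - _; have ya : y * a = - x by rewrite /y mulNr -mulrA va mulr1.
have -> : \sum_(l < N.+1) Q a' y l j * Q a x i.+1 l =
    (\sum_(l < N) Q a' y l j * Q a x i l) * x
      + \sum_(l < N) Q a' y l.+1 j * Q a x i l * a.
  transitivity (\sum_(l < N.+1) (Q a' y l j * Q a x i l * x
     + Q a' y l j * (if val l is l'.+1 then Q a x i l' * a else 0))).
    by apply: eq_bigr => l _; rewrite QSr mulrDr mulrA.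
  rewrite big_split /=; congr (_ + _).
    by rewrite big_ord_recr /= [Q _ _ i N]Q_small // mulr0 mul0r addr0 mulr_suml.
  by rewrite big_ord_recl /= mulr0 add0r; apply: eq_bigr => l _; rewrite mulrA.
rewrite IH // -mulr_suml.
have -> : \sum_(l < N) Q a' y l.+1 j * Q a x i l
    = y * (i == j)%:R + (if j is j'.+1 then a' * (i == j')%:R else 0).
  rewrite -(IH _ _ lt_iN) mulr_sumr; case: j => [|j].
    by rewrite addr0; apply: eq_bigr => l _; rewrite QSl addr0 mulrA.
  rewrite -(IH j _ lt_iN) mulr_sumr -big_split; apply: eq_bigr => l _ /=.
  by rewrite QSl mulrDl !mulrA.
rewrite mulrDl; have -> : (y * (i == j)%:R) * a = - ((i == j)%:R * x).
  by case: eqP => _; rewrite ?mulr1 ?mul1r // !(mulr0, mul0r) oppr0.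
rewrite addrA subrr add0r; case: j => [|j]; first by rewrite mul0r.
by rewrite eqSS; case: eqP => _; rewrite ?mulr1 // mulr0 mul0r.
Qed.

Variables (g : {poly k}) (a x a' : H).
Hypotheses (ax : Axag_data g x a a') (g_neq0 : g != 0) (g0 : g`_0 = 0).

Let size_g : size g = (deg g).+1.
Proof. by rewrite /deg prednK // size_poly_gt0. Qed.

Let sig : forall j, (0 < j)%N -> gcoef g a x j = (g`_j)%:K * a ^+ deg g.
Proof. by case/(Axag_dataP g_neq0): ax. Qed.

(** The inverse matrix of [Q_antipode] turns the relations for x and a into
    those for their images under the antipode. *)
Lemma gcoef_antipode j : gcoef g a' (- (x * a')) j * a ^+ deg g
  = (g`_j)%:K - (j == 0%N)%:R * peval g x.
Proof.
have va : a' * a = 1 by case: ax.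
pose y := - (x * a').
have E : \sum_(l < size g) Q a' y l j * gcoef g a x l = (g`_j)%:K.
  transitivity (\sum_(i < size g) \sum_(l < size g)
      (g`_i)%:K * (Q a' y l j * Q a x i l)).
    rewrite exchange_big; apply: eq_bigr => l _; rewrite mulr_sumr.
    by apply: eq_bigr => i _; rewrite mulrA -algCC mulrA.
  transitivity (\sum_(i < size g) (g`_i)%:K * (i == j :> nat)%:R : H).
    by apply: eq_bigr => i _; rewrite -mulr_sumr Q_antipode.
  have [lt_j|le_j] := ltnP j (size g).
    rewrite (bigD1 (Ordinal lt_j)) //= eqxx mulr1 big1 ?addr0 // => i.
    by rewrite -val_eqE /= => /negPf ->; rewrite mulr0.
  rewrite nth_default // algC0 big1 // => i _; rewrite ltn_eqF ?mulr0 //.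
  exact: leq_trans le_j.
apply: (addrI ((j == 0%N)%:R * peval g x)); rewrite addrC [RHS]addrC subrK -E.
have -> : gcoef g a' y j = \sum_(l < deg g) (g`_l.+1)%:K * Q a' y l.+1 j.
  by rewrite /gcoef size_g big_ord_recl g0 algC0 mul0r add0r.
rewrite size_g big_ord_recl Q0 gcoef0 addrC mulr_suml.
congr (_ + _); apply: eq_bigr => l _.
by rewrite sig // mulrA -(algCC _ (Q _ _ _ _)).
Qed.

Let expVn n : a ^+ n * a' ^+ n = 1.
Proof. by case: ax => av va _; apply: expr_inverse. Qed.

Lemma Axag_data_antipode :
  Axag_data g (- (x * a') : H^c) (a' : H^c) (a : H^c).
Proof.
have [av va _] := ax; apply/(Axag_dataP g_neq0).
split=> // j j0; rewrite gcoef_conv exprn_conv.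
have := gcoef_antipode j; case: j j0 => // j _; rewrite mul0r subr0 => E.
by rewrite -[LHS]mulr1 -(expVn (deg g)) mulrA E; apply: (@algCC k H).
Qed.

Lemma peval_antipode :
  peval g (- (x * a') : H^c) = - (peval g x * a' ^+ deg g) :> H.
Proof.
rewrite -(gcoef0 g (a' : H^c)) gcoef_conv -[LHS]mulr1 -(expVn (deg g)).
by rewrite mulrA gcoef_antipode g0 algC0 sub0r mul1r mulNr.
Qed.

End Antipode.

(** * The Hopf algebra structure *)

Section Counit.
Variables (k : fieldType) (B : pzAlgType k).

Lemma Q_counit i j : Q (1 : B) 0 i j = (i == j)%:R.
Proof.
elim: i j => [|i IH] j; first by rewrite Q0 eq_sym.
by rewrite QSl mul0r add0r; case: j => [|j] //; rewrite mul1r IH eqSS.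
Qed.

Lemma Axag_data_counit (g : {poly k}) : g != 0 -> Axag_data g (0 : B) 1 1.
Proof.
move=> g_neq0; apply/(Axag_dataP g_neq0); split; rewrite ?mulr1 // => j _.
rewrite expr1n mulr1 /gcoef; have [lt_j|le_j] := ltnP j (size g).
  rewrite (bigD1 (Ordinal lt_j)) //= Q_counit eqxx mulr1 big1 ?addr0 // => i.
  by rewrite -val_eqE /= Q_counit => /negPf ->; rewrite mulr0.
rewrite nth_default // algC0 big1 // => i _; rewrite Q_counit ltn_eqF ?mulr0 //.
exact: leq_trans le_j.
Qed.

Lemma peval_0 (g : {poly k}) : g`_0 = 0 -> peval g (0 : B) = 0.
Proof.
move=> g0; rewrite /peval big1 // => -[[|i] lt_i] _ /=.
  by rewrite g0 algC0 mul0r.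
by rewrite exprS mul0r mulr0.
Qed.

End Counit.

Section Convolution.
Variables (k : comNzRingType) (H : pzAlgType k) (S : H -> H).
Hypothesis hS : alghom (S : H -> H^c).

Let SD : {morph S : u v / u + v}. Proof. by case: hS. Qed.
Let SM u v : S (u * v) = S v * S u. Proof. by case: hS => _ ->. Qed.
Let SK (c : k) : S c%:K = c%:K. Proof. by case: hS => _ _ ->. Qed.

Fact convl_balanced (w : H) : balanced (fun (c : k) (u : H) => c%:K * u)
  (fun (c : k) (v : H) => c%:K * v) (fun u v => S u * w * v).
Proof.
split=> [v u u'|u v v'|c u v]; rewrite ?SD ?mulrDl ?mulrDr //.
by rewrite SM SK -(algCC c (S u)) -!mulrA !(mulrA w) -(algCC c w) !mulrA (algCC c).
Qed.

Fact convr_balanced (w : H) : balanced (fun (c : k) (u : H) => c%:K * u)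
  (fun (c : k) (v : H) => c%:K * v) (fun u v => u * w * S v).
Proof.
split=> [v u u'|u v v'|c u v]; rewrite ?SD ?mulrDl ?mulrDr //.
by rewrite SM SK -(algCC c (S v)) !mulrA -(algCC c) !mulrA.
Qed.

Definition convl w (t : talg H H) : H := talift (fun u v => S u * w * v) t.
Definition convr w (t : talg H H) : H := talift (fun u v => u * w * S v) t.

Lemma convl1E t : talift (fun u v => S u * v) t = convl 1 t.
Proof.
by rewrite /convl; congr talift; apply/funext=> u; apply/funext=> v; rewrite mulr1.
Qed.

Lemma convr1E t : talift (fun u v => u * S v) t = convr 1 t.
Proof.
by rewrite /convr; congr talift; apply/funext=> u; apply/funext=> v; rewrite mulr1.
Qed.

Lemma convl_ptens w u v : convl w (ptens u v) = S u * w * v.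
Proof. exact: tlift_pure _ _ (convl_balanced w). Qed.

Lemma convr_ptens w u v : convr w (ptens u v) = u * w * S v.
Proof. exact: tlift_pure _ _ (convr_balanced w). Qed.

Lemma convlD w : {morph convl w : t t' / t + t'}.
Proof. exact: tliftD (convl_balanced w). Qed.

Lemma convrD w : {morph convr w : t t' / t + t'}.
Proof. exact: tliftD (convr_balanced w). Qed.

(** S reverses products, so in S(u u') v v' = S(u') (S(u) v) v' the inner factor
    can be collapsed first. Hence the antipode identity passes to products. *)
Lemma convlM t t' : convl 1 (t * t') = convl (convl 1 t) t'.
Proof.
have addl (t1 t2 : H) : convl (t1 + t2) t' = convl t1 t' + convl t2 t'.
  elim/talg_ind: t' => [|t3 t4 IH IH'|u v].
  - by rewrite !(morph0 (convlD _)) addr0.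
  - by rewrite !convlD IH IH' addrACA.
  by rewrite !convl_ptens mulrDr mulrDl.
have F0 := morph0 (f := fun w => convl w t') addl.
elim/talg_ind: t => [|t1 t2 IH IH'|u v].
- by rewrite mul0r !(morph0 (convlD _)) F0.
- by rewrite mulrDl !convlD IH IH' addl.
elim/talg_ind: t' {addl F0} => [|t1 t2 IH IH'|u' v'].
- by rewrite mulr0 !(morph0 (convlD _)).
- by rewrite mulrDr !convlD IH IH'.
by rewrite ptensM !convl_ptens SM !mulr1 !mulrA.
Qed.

Lemma convrM t t' : convr 1 (t * t') = convr (convr 1 t') t.
Proof.
have addl (t1 t2 : H) : convr (t1 + t2) t = convr t1 t + convr t2 t.
  elim/talg_ind: t => [|t3 t4 IH IH'|u v].
  - by rewrite !(morph0 (convrD _)) addr0.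
  - by rewrite !convrD IH IH' addrACA.
  by rewrite !convr_ptens mulrDr mulrDl.
have F0 := morph0 (f := fun w => convr w t) addl.
elim/talg_ind: t' => [|t1 t2 IH IH'|u' v'].
- by rewrite mulr0 !(morph0 (convrD _)) F0.
- by rewrite mulrDr !convrD IH IH' addl.
elim/talg_ind: t {addl F0} => [|t1 t2 IH IH'|u v].
- by rewrite mul0r !(morph0 (convrD _)).
- by rewrite mulrDl !convrD IH IH'.
by rewrite ptensM !convr_ptens SM !mulr1 !mulrA.
Qed.

Lemma convl_scalar (c : k) t : convl c%:K t = c%:K * convl 1 t.
Proof.
elim/talg_ind: t => [|t1 t2 IH IH'|u v].
- by rewrite !(morph0 (convlD _)) mulr0.
- by rewrite !convlD IH IH' mulrDr.
by rewrite !convl_ptens mulr1 -(algCC c (S u)) mulrA.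
Qed.

Lemma convr_scalar (c : k) t : convr c%:K t = c%:K * convr 1 t.
Proof.
elim/talg_ind: t => [|t1 t2 IH IH'|u v].
- by rewrite !(morph0 (convrD _)) mulr0.
- by rewrite !convrD IH IH' mulrDr.
by rewrite !convr_ptens mulr1 -(algCC c u) mulrA.
Qed.

Variables (Delta : H -> talg H H) (eps : H -> k^o).
Hypotheses (hD : alghom Delta) (he : alghom eps).

Lemma antipodel_subalg : subalgebra (fun h => convl 1 (Delta h) = (eps h)%:K).
Proof.
case: hD he => DD DM DK [eD eM eK]; apply: subalgebraI => [c|u v E E'|u v E E'].
- by rewrite DK eK convl_ptens SK !mulr1.
- by rewrite DD eD convlD E E' algCD.
by rewrite DM eM convlM E convl_scalar E' algCM.
Qed.

Lemma antipoder_subalg : subalgebra (fun h => convr 1 (Delta h) = (eps h)%:K).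
Proof.
case: hD he => DD DM DK [eD eM eK]; apply: subalgebraI => [c|u v E E'|u v E E'].
- by rewrite DK eK convr_ptens (alghom1 hS) !mulr1.
- by rewrite DD eD convrD E E' algCD.
by rewrite DM eM convrM E' convr_scalar E -algCM mulrC algCM.
Qed.

End Convolution.

(** Everything below depends on A(g, f) only through this property. *)
Record Agf_universal (k : comNzRingType) (g f : {poly k}) (H : pzAlgType k)
    (x a a' y b b' : H) : Prop := AgfUniversal {
  univ_data : Agf_data g f x a a' y b b';
  univ_generated : generated (fun z => [\/ z = x, z = a | z = a'] \/
                                       [\/ z = y, z = b | z = b']);
  univ_lift : forall (B : pzAlgType k) (x1 a1 a1' y1 b1 b1' : B),
    Agf_data g f x1 a1 a1' y1 b1 b1' ->
    exists2 F : H -> B, alghom F &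
      [/\ [/\ F x = x1, F a = a1 & F a' = a1'] & [/\ F y = y1, F b = b1 & F b' = b1']] }.

Lemma Agf_is_universal (k : comNzRingType) (g f : {poly k}) :
  Agf_universal g f (Agf_x g f) (Agf_a g f) (Agf_ainv g f)
    (Agf_y g f) (Agf_b g f) (Agf_binv g f).
Proof.
split; [exact: Agf_generic | exact: Agf_generated |].
by move=> B x a a' y b b'; apply: Agf_lift.
Qed.

Section HopfStructure.
Variables (k : fieldType) (g f : {poly k}) (H : pzAlgType k).
Variables (x a a' y b b' : H).
Hypothesis U : Agf_universal g f x a a' y b b'.
Hypotheses (g_neq0 : g != 0) (g0 : g`_0 = 0) (f_neq0 : f != 0) (f0 : f`_0 = 0).

Lemma ptens_comm (u v u' v' : H) : GRing.comm u u' -> GRing.comm v v' ->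
  GRing.comm (ptens u v) (ptens u' v').
Proof. by rewrite /GRing.comm !ptensM => -> ->. Qed.

Let comm_xy u v : u \in [:: x; a; a'] -> v \in [:: y; b; b'] -> GRing.comm u v.
Proof. by case: U => -[_ _ comm _ _] _ _; apply: comm. Qed.

Lemma comul_exists : exists2 Delta : H -> talg H H, alghom Delta &
  [/\ [/\ Delta x = ptens 1 x + ptens x a, Delta a = ptens a a & Delta a' = ptens a' a']
    & [/\ Delta y = ptens 1 y + ptens y b, Delta b = ptens b b & Delta b' = ptens b' b']].
Proof.
have [[dx dy _ ab xy] _ lift] := U; apply: lift; split.
- exact: Axag_data_comul.
- exact: Axag_data_comul.
- have [cx ca ca'] : [/\ forall v, v \in [:: y; b; b'] -> GRing.comm x v,
    forall v, v \in [:: y; b; b'] -> GRing.comm a v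
    & forall v, v \in [:: y; b; b'] -> GRing.comm a' v].
    by split=> v; apply: comm_xy; rewrite !inE eqxx ?orbT.
  have c1 (u : H) : GRing.comm 1 u := commr_sym (commr1 u).
  have [yy bb bb'] : [/\ y \in [:: y; b; b'], b \in [:: y; b; b'] & b' \in [:: y; b; b']].
    by rewrite !inE !eqxx ?orbT.
  move=> u v; rewrite !inE => /or3P[] /eqP -> /or3P[] /eqP ->;
  repeat (first [apply: commrD | apply: commr_sym; apply: commrD; apply: commr_sym]);
  apply: ptens_comm;
  first [exact: c1 | exact: commr1 | exact: cx | exact: ca | exact: ca'].
- by rewrite !ptensX ab.
by rewrite (peval_comul dx) // (peval_comul dy) // xy ab.
Qed.


Lemma counit_exists : exists2 eps : H -> k^o, alghom eps &
  [/\ [/\ eps x = 0, eps a = 1 & eps a' = 1] & [/\ eps y = 0, eps b = 1 & eps b' = 1]].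
Proof.
have [_ _ lift] := U; apply: lift; split.
- exact: (@Axag_data_counit k k^o).
- exact: (@Axag_data_counit k k^o).
- by move=> u v _ _; apply: mulrC.
- by rewrite !expr1n.
by rewrite !peval_0.
Qed.

Lemma antipode_exists : exists2 S : H -> H^c, alghom S &
  [/\ [/\ S x = - (x * a'), S a = a' & S a' = a] & [/\ S y = - (y * b'), S b = b' & S b' = b]].
Proof.
have [[dx dy _ ab xy] _ lift] := U.
have ab' : a' ^+ deg g = b' ^+ deg f.
  have [av va _] := dx; have [bv vb _] := dy.
  rewrite -[LHS]mulr1 -(expr_inverse (deg f) bv vb) -ab mulrA.
  by rewrite (expr_inverse _ va av) mul1r.
apply: lift; split.
- exact: Axag_data_antipode.
- exact: Axag_data_antipode.
- have [cx ca ca'] : [/\ x \in [:: x; a; a'], a \in [:: x; a; a'] & a' \in [:: x; a; a']].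
    by rewrite !inE !eqxx ?orbT.
  have [yy bb bb'] : [/\ y \in [:: y; b; b'], b \in [:: y; b; b'] & b' \in [:: y; b; b']].
    by rewrite !inE !eqxx ?orbT.
  have comm1 (u v : H) : u \in [:: - (x * a'); a'; a] -> v \in [:: y; b; b'] -> GRing.comm v u.
    move=> + vy; rewrite !inE => /or3P[] /eqP ->; try exact/commr_sym/comm_xy.
    by apply/commrN/commrM; apply/commr_sym/comm_xy.
  move=> u v ux vy; have {ux} comm2 := comm1 _ _ ux.
  suff: GRing.comm (v : H) (u : H) by [].
  move: vy; rewrite !inE => /or3P[] /eqP ->; try exact: comm2.
  by apply/commr_sym/commrN/commrM; apply/commr_sym/comm2.
- by rewrite !exprn_conv.
by rewrite (peval_antipode dx) // (peval_antipode dy) // xy ab'.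
Qed.

Definition hopf_spec (HH : hopf H) : Prop :=
  [/\ [/\ comul HH a = ptens a a, comul HH x = ptens 1 x + ptens x a,
          counit HH a = 1 & counit HH x = 0],
      antipode HH a = a' /\ antipode HH x = - (x * a'),
      [/\ comul HH b = ptens b b, comul HH y = ptens 1 y + ptens y b,
          counit HH b = 1 & counit HH y = 0]
    & antipode HH b = b' /\ antipode HH y = - (y * b')].

Lemma hopf_exists : exists HH : hopf H, hopf_spec HH.
Proof.
have [D hD [[Dx Da Da'] [Dy Db Db']]] := comul_exists.
have [e he [[ex ea ea'] [ey eb eb']]] := counit_exists.
have [S hS [[Sx Sa Sa'] [Sy Sb Sb']]] := antipode_exists.
have [[dx dy _ _ _] gen _] := U; have [av va _] := dx; have [bv vb _] := dy.
have [SD SM SK] := hS.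
have hid := @alghom_id _ H.
have hDi := atmap_alghom hD hid; have hiD := atmap_alghom hid hD.
have DA : forall h, tassoc (atmap D id (D h)) = atmap id D (D h).
  apply: (generated_eq gen (alghom_comp (tassoc_alghom _ _ _) (alghom_comp hDi hD))
                           (alghom_comp hiD hD)) => z /=.
  have [mD mM _] := hDi; have [mD' mM' _] := hiD.
  have pD u v := atmap_ptens u v hD hid; have pD' u v := atmap_ptens u v hid hD.
  have [tD _ _] := tassoc_alghom H H H.
  have gr w : D w = ptens w w -> tassoc (atmap D id (D w)) = atmap id D (D w).
    by move=> Dw; rewrite Dw pD pD' Dw tassoc_ptens.
  have sk v w : D v = ptens 1 v + ptens v w -> D w = ptens w w ->
      tassoc (atmap D id (D v)) = atmap id D (D v).
    move=> Dv Dw; rewrite Dv mD mD' !pD !pD' Dv Dw (alghom1 hD) ptensDl ptensDr.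
    by rewrite tD tD !tassoc_ptens; apply: addrA.
  case=> -[] ->; [exact: (sk _ _ Dx Da) | exact: (gr _ Da) | exact: (gr _ Da')
                 |exact: (sk _ _ Dy Db) | exact: (gr _ Db) | exact: (gr _ Db')].
have ek : alghom (fun h => (e h)%:K : H).
  have [eD eM eK] := he; split=> [u v|u v|c]; [by rewrite eD algCD|by rewrite eM algCM|by rewrite eK].
have cl : alghom (talift (fun u v => (e u)%:K * v) : talg H H -> H).
  by apply: talift_alghom => // u v; apply: algCC.
have clp u v : talift (fun u v => (e u)%:K * v) (ptens u v) = (e u)%:K * v :> H.
  exact: (talift_ptens ek hid).
have crE : (fun u v => (e v)%:K * u) = (fun u v => u * (e v)%:K) :> (H -> H -> H).
  by apply/funext=> u; apply/funext => v; rewrite algCC.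
have cr : alghom (talift (fun u v => (e v)%:K * u) : talg H H -> H).
  by rewrite crE; apply: talift_alghom => // u v; apply/commr_sym/algCC.
have crp u v : talift (fun u v => (e v)%:K * u) (ptens u v) = (e v)%:K * u :> H.
  by rewrite crE (talift_ptens hid ek) algCC.
have eL : forall h, talift (fun u v => (e u)%:K * v) (D h) = h.
  apply: (generated_eq gen (alghom_comp cl hD) hid) => z /=.
  have [clD _ _] := cl.
  by case=> -[] ->; rewrite ?(Dx, Da, Da', Dy, Db, Db') ?clD !clp
    ?(ex, ea, ea', ey, eb, eb', alghom1 he) algC1 ?algC0 mul1r ?mul0r ?addr0.
have eR : forall h, talift (fun u v => (e v)%:K * u) (D h) = h.
  apply: (generated_eq gen (alghom_comp cr hD) hid) => z /=.
  have [crD _ _] := cr.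
  by case=> -[] ->; rewrite ?(Dx, Da, Da', Dy, Db, Db') ?crD !crp
    ?(ex, ea, ea', ey, eb, eb', alghom1 he) algC1 ?algC0 mul1r ?mul0r ?add0r.
have S1 : S 1 = 1 := alghom1 hS.
have sl : forall h, talift (fun u v => (S u : H) * v) (D h) = (e h)%:K.
  move=> h; rewrite convl1E; move: h.
  apply: gen; first exact: (antipodel_subalg hS hD he).
  move=> z [] [] ->; rewrite ?(Dx, Da, Da', Dy, Db, Db') ?(convlD hS) !(convl_ptens hS)
    ?(ex, ea, ea', ey, eb, eb', Sx, Sa, Sa', Sy, Sb, Sb') ?S1 ?mulr1 ?mul1r ?mulNr
    -?mulrA ?(av, va, bv, vb) ?mulr1 ?subrr ?algC0 ?algC1 //.
have sr : forall h, talift (fun u v => u * (S v : H)) (D h) = (e h)%:K.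
  move=> h; rewrite convr1E; move: h.
  apply: gen; first exact: (antipoder_subalg hS hD he).
  move=> z [] [] ->; rewrite ?(Dx, Da, Da', Dy, Db, Db') ?(convrD hS) !(convr_ptens hS)
    ?(ex, ea, ea', ey, eb, eb', Sx, Sa, Sa', Sy, Sb, Sb') ?S1 ?mulr1 ?mul1r
    ?(av, va, bv, vb) ?addNr ?algC0 ?algC1 //.
have SZ : forall (c : k) u, S (c%:K * u) = c%:K * (S u : H).
  by move=> c u; rewrite SM SK; apply: esym; apply: (algCC c (S u : H)).
exists (Hopf hD he SD SZ DA eL eR sl sr).
by split; split.
Qed.

End HopfStructure.

(** * Pointedness *)

Section Subspaces.
Variables (k : fieldType) (H : pzAlgType k).
Implicit Types W D : H -> Prop.

Lemma subspD W u v : subspace W -> W u -> W v -> W (u + v).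
Proof. by case=> _ Wl Wu Wv; rewrite -[u]mul1r -(@algC1 k); apply: Wl. Qed.

Lemma subspZ W (c : k) u : subspace W -> W u -> W (c%:K * u).
Proof. by case=> W0 Wl Wu; rewrite -[_ * _]addr0; apply: Wl. Qed.

Lemma subspN W u : subspace W -> W u -> W (- u).
Proof. by move=> sW Wu; rewrite -mulN1r -algC1 -algCN; apply: subspZ. Qed.

Lemma subspB W u v : subspace W -> W u -> W v -> W (u - v).
Proof. by move=> sW Wu Wv; apply: subspD => //; apply: subspN. Qed.

Lemma subsp_sum W I (r : seq I) (P : pred I) F : subspace W ->
  (forall i, P i -> W (F i)) -> W (\sum_(i <- r | P i) F i).
Proof.
move=> sW WF; elim/big_rec: _ => [|i u Pi Wu]; first by case: sW.
by apply: subspD => //; apply: WF.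
Qed.

Lemma algCVK (c : k) (u : H) : c != 0 -> (c^-1)%:K * (c%:K * u) = u.
Proof. by move=> c0; rewrite mulrA -algCM mulVf // algC1 mul1r. Qed.

(** By Zorn's lemma W extends to a hyperplane missing v. *)
Lemma linear_form_exists W v : subspace W -> ~ W v ->
  exists phi : H -> k,
    [/\ {morph phi : u w / u + w}, forall (c : k) u, phi (c%:K * u) = c * phi u,
        forall u, W u -> phi u = 0 & phi v = 1].
Proof.
move=> sW Wv; pose cup (X : H -> Prop) u := X u \/ W u.
pose P (X : H -> Prop) := subspace (cup X) /\ ~ cup X v.
have [F FP Ftot|A [[sA Av] Amax]] := @classical_sets.Zorn_bigcup H P.
  have [[X0 FX0]|F0] := pselect (exists X, F X); last first.
    have E : cup (classical_sets.bigcup F id) = W.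
      apply/funext => u; apply/propext; split; last by right.
      by case=> // -[X FX _]; case: F0; exists X.
    by rewrite /P E.
  split; last first.
    case=> [[X FX Xv]|//]; have [_] := FP X FX; apply.
    by left.
  split=> [|c u w]; first by right; case: sW.
  have lift u' : cup (classical_sets.bigcup F id) u' -> exists2 X, F X & cup X u'.
    by case=> [[X FX Xu]|Wu]; [exists X => //; left | exists X0 => //; right].
  move=> /lift[X FX Xu] /lift[Y FY Yw].
  have [Z FZ [XZ YZ]] : exists2 Z, F Z & cup Z u /\ cup Z w.
    have [XY|YX] := Ftot X Y FX FY.
      by exists Y => //; split=> //; case: Xu => [/XY|]; [left|right].
    by exists X => //; split=> //; case: Yw => [/YX|]; [left|right].
  have [[_ Zl] _] := FP Z FZ.
  by case: (Zl c _ _ XZ YZ) => [Zu|]; [left; exists Z | right].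
pose M := cup A.
have ex u : exists c : k, M (u - c%:K * v).
  have [Mu|Mu] := pselect (M u); first by exists 0; rewrite algC0 mul0r subr0.
  pose B w := exists m (d : k), M m /\ w = m + d%:K * u.
  have MB m : M m -> B m by move=> Mm; exists m, 0; rewrite algC0 mul0r addr0.
  have sB : subspace B.
    split=> [|c w w' [m [d [Mm ->]]] [m' [d' [Mm' ->]]]].
      by exists 0, 0; rewrite algC0 mul0r addr0; split=> //; case: sA.
    exists (c%:K * m + m'), (c * d + d'); split; first by case: sA => _; apply.
    by rewrite mulrDr algCD algCM mulrDl !mulrA addrACA.
  have cB : cup B = B.
    apply/funext => w; apply/propext; split=> [[//|Ww]|]; last by left.
    by apply: MB; right.
  have [Bv|nBv] := pselect (B v); last first.
    case: (Amax B) => //; last by rewrite /P cB.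
    split; first by move=> w Aw; apply: MB; left.
    move=> BA; case: Mu; left; apply: BA; exists 0, 1.
    by rewrite algC1 mul1r add0r; split=> //; case: sA.
  have [m [d [Mm vE]]] := Bv.
  have d0 : d != 0 by apply/eqP => d0; case: Av; rewrite vE d0 algC0 mul0r addr0.
  exists d^-1; rewrite vE mulrDr algCVK // opprD addrCA subrr addr0.
  by apply: subspN => //; apply: subspZ.
have uniq u c d : M (u - c%:K * v) -> M (u - d%:K * v) -> c = d.
  move=> Mc Md; apply/eqP; rewrite -subr_eq0; apply/negPn/negP => cd.
  case: Av; rewrite -(algCVK v cd); apply: (subspZ _ sA).
  have -> : (c - d)%:K * v = (u - d%:K * v) - (u - c%:K * v).
    by rewrite algCD algCN mulrDl mulNr opprB [RHS]addrC subrKA.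
  exact: subspB.
have [phi phiP] := choice ex.
exists phi; split=> [u w|c u|u Wu|].
- apply: (uniq (u + w)) => //; rewrite algCD mulrDl opprD addrACA.
  by apply: (subspD sA); apply: phiP.
- apply: (uniq (c%:K * u)) => //; rewrite algCM -mulrA -mulrBr.
  by apply: (subspZ _ sA); apply: phiP.
- by apply: (uniq u) => //; rewrite algC0 mul0r subr0; right.
by apply: (uniq v) => //; rewrite algC1 mul1r subrr; case: sA.
Qed.

End Subspaces.

Section IndependentExpansion.
Variables (k : fieldType) (H : pzAlgType k) (T : zmodType) (beta : H -> H -> T).
Hypothesis betaDl : forall v, {morph beta^~ v : u u' / u + u'}.
Hypothesis betaDr : forall u, {morph beta u : v v' / v + v'}.
Hypothesis betaZ : forall (c : k) u v, beta (c%:K * u) v = beta u (c%:K * v).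

Variables P E F : H -> Prop.
Hypotheses (sE : subspace E) (sF : subspace F).
Hypothesis PF : forall N (d : 'I_N -> H) (c : 'I_N -> k), (forall i, P (d i)) ->
  F (\sum_i (c i)%:K * d i) -> \sum_i (c i)%:K * d i = 0.

(** In a shortest expansion of t as a sum of values of a bilinear map, the
    left arguments are linearly independent (modulo F), hence have dual linear
    forms. *)
Lemma independent_expansion N (d h : 'I_N -> H) :
    (forall i, P (d i)) -> (forall i, E (h i)) ->
  exists M (d' h' : 'I_M -> H),
    [/\ forall i, P (d' i), forall i, E (h' i),
        \sum_i beta (d i) (h i) = \sum_i beta (d' i) (h' i)
      & forall i, exists phi : H -> k,
          [/\ {morph phi : u w / u + w}, forall (c : k) u, phi (c%:K * u) = c * phi u,
              forall u, F u -> phi u = 0 & forall j, phi (d' j) = (i == j)%:R]].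
Proof.
elim: N d h => [|N IH] d h Pd Eh; first by exists 0, d, h; split=> // -[].
pose W (i : 'I_N.+1) (u : H) := exists f (c : 'I_N -> k), F f /\ u = f + \sum_j (c j)%:K * d (lift i j).
have [[i [f [c [Ff dE]]]]|indep] := pselect (exists i, W i (d i)); last first.
  exists N.+1, d, h; split=> // i.
  have sW : subspace (W i).
    split=> [|c u v [f1 [c1 [Ff1 ->]]] [f2 [c2 [Ff2 ->]]]].
      exists 0, (fun=> 0); split; first by case: sF.
      by rewrite add0r big1 // => j _; rewrite algC0 mul0r.
    exists (c%:K * f1 + f2), (fun j => c * c1 j + c2 j); split.
      by case: sF => _; apply.
    rewrite mulrDr addrACA mulr_sumr -big_split; congr (_ + _).
    by apply: eq_bigr => j _ /=; rewrite algCD algCM mulrDl mulrA.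
  have [|phi [phiD phiZ phiW phid]] := linear_form_exists (v := d i) sW.
    by move=> Wi; apply: indep; exists i.
  exists phi; split=> // [u Fu|j].
    apply: phiW; exists u, (fun=> 0); split=> //.
    by rewrite big1 ?addr0 // => j _; rewrite algC0 mul0r.
  case: (unliftP i j) => [l ->|->]; last by rewrite eqxx phid.
  rewrite eq_liftF; apply: phiW; exists 0, (fun j' => (j' == l)%:R).
  split; first by case: sF.
  rewrite add0r (bigD1 l) //= eqxx algC1 mul1r big1 ?addr0 // => j' /negPf ->.
  by rewrite algC0 mul0r.
have f0 : f = 0.
  have fE : f = \sum_j (if unlift i j is Some l then - c l else 1)%:K * d j.
    rewrite (bigD1_ord i) //= unlift_none algC1 mul1r {1}dE -addrA -big_split big1 ?addr0 //.
    by move=> j _ /=; rewrite liftK algCN mulNr subrr.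
  by rewrite fE; apply: PF => //; rewrite -fE.
have [M [d' [h' [Pd' Eh' tE dual]]]] := IH (fun j => d (lift i j))
    (fun j => h (lift i j) + (c j)%:K * h i) (fun j => Pd _)
    (fun j => subspD sE (Eh _) (subspZ _ sE (Eh _))).
exists M, d', h'; split=> //; rewrite -tE.
rewrite (bigD1_ord i) //= {1}dE f0 add0r (big_morph _ (betaDl _) (morph0 (betaDl _))).
rewrite -big_split; apply: eq_bigr => j _ /=.
by rewrite betaDr betaZ addrC.
Qed.

End IndependentExpansion.

Section TensorSums.
Variables (k : comNzRingType) (A B : pzAlgType k).

Inductive sums (P : A -> B -> Prop) : talg A B -> Prop :=
| sums0 : sums P 0
| sumsD t t' of sums P t & sums P t' : sums P (t + t')
| sums_ptens u v of P u v : sums P (ptens u v).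

Lemma sums_sum (P : A -> B -> Prop) I (r : seq I) F :
  (forall i, sums P (F i)) -> sums P (\sum_(i <- r) F i).
Proof.
move=> PF; elim/big_ind: _ => [||i _]; [exact: sums0|exact: sumsD|exact: PF].
Qed.

Lemma sumsW (P P' : A -> B -> Prop) t :
  (forall u v, P u v -> P' u v) -> sums P t -> sums P' t.
Proof.
move=> PP'; elim=> [|u v _ Pu _ Pv|u v /PP' Puv].
- exact: sums0.
- exact: sumsD.
exact: sums_ptens.
Qed.

Lemma sumsM (P1 P2 P : A -> B -> Prop) t t' :
    (forall u v u' v', P1 u v -> P2 u' v' -> P (u * u') (v * v')) ->
  sums P1 t -> sums P2 t' -> sums P (t * t').
Proof.
move=> PM Pt Pt'; elim: Pt => {t} [|t1 t2 _ H1 _ H2|u v P1uv].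
- by rewrite mul0r; apply: sums0.
- by rewrite mulrDl; apply: sumsD.
elim: Pt' => {t'} [|t1 t2 _ H1 _ H2|u' v' P2uv].
- by rewrite mulr0; apply: sums0.
- by rewrite mulrDr; apply: sumsD.
by rewrite ptensM; apply/sums_ptens/PM.
Qed.

Lemma sums_seq (P : A -> B -> Prop) t : sums P t ->
  exists2 s : seq (A * B), forall p, p \in s -> P p.1 p.2
    & t = \sum_(p <- s) ptens p.1 p.2.
Proof.
elim=> {t} [|t t' _ [s sP ->] _ [s' sP' ->]|u v Puv].
- by exists [::] => //; rewrite big_nil.
- exists (s ++ s'); last by rewrite big_cat.
  by move=> p; rewrite mem_cat => /orP[/sP|/sP'].
exists [:: (u, v)]; last by rewrite big_seq1.
by move=> p; rewrite inE => /eqP ->.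
Qed.

Lemma seq_sums (P : A -> B -> Prop) (s : seq (A * B)) :
  (forall p, p \in s -> P p.1 p.2) -> sums P (\sum_(p <- s) ptens p.1 p.2).
Proof.
move=> sP; rewrite big_seq; elim/big_ind: _ => [||p ps].
- exact: sums0.
- exact: sumsD.
by apply/sums_ptens/sP.
Qed.

Lemma sums_fin (P : A -> B -> Prop) t : sums P t ->
  exists N (u : 'I_N -> A) (v : 'I_N -> B),
    (forall i, P (u i) (v i)) /\ t = \sum_i ptens (u i) (v i).
Proof.
case/sums_seq=> s sP ->; exists (size s).
exists (fun i => (tnth (in_tuple s) i).1), (fun i => (tnth (in_tuple s) i).2).
by split=> [i|]; [apply/sP/mem_tnth | rewrite [LHS]big_tnth].
Qed.

End TensorSums.

(** Slices turn an identity in H (x) H into identities in H. *)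
Section Slices.
Variables (k : comNzRingType) (H : pzAlgType k) (phi : H -> k).
Hypotheses (phiD : {morph phi : u v / u + v})
  (phiZ : forall (c : k) u, phi (c%:K * u) = c * phi u).

Definition lslice (t : talg H H) : H := talift (fun u v => (phi u)%:K * v) t.
Definition rslice (t : talg H H) : H := talift (fun u v => (phi v)%:K * u) t.

Fact lslice_balanced : balanced (fun (c : k) (u : H) => c%:K * u)
  (fun (c : k) (v : H) => c%:K * v) (fun u v => (phi u)%:K * v).
Proof.
split=> [v u u'|u v v'|c u v]; first by rewrite phiD algCD mulrDl.
  by rewrite mulrDr.
by rewrite phiZ mulrC algCM mulrA.
Qed.

Fact rslice_balanced : balanced (fun (c : k) (u : H) => c%:K * u)
  (fun (c : k) (v : H) => c%:K * v) (fun u v => (phi v)%:K * u).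
Proof.
split=> [v u u'|u v v'|c u v]; last by rewrite phiZ mulrC algCM mulrA.
  by rewrite mulrDr.
by rewrite phiD algCD mulrDl.
Qed.

Lemma lsliceD : {morph lslice : t t' / t + t'}.
Proof. exact: tliftD lslice_balanced. Qed.

Lemma lslice_ptens u v : lslice (ptens u v) = (phi u)%:K * v.
Proof. exact: tlift_pure _ _ lslice_balanced. Qed.

Lemma rsliceD : {morph rslice : t t' / t + t'}.
Proof. exact: tliftD rslice_balanced. Qed.

Lemma rslice_ptens u v : rslice (ptens u v) = (phi v)%:K * u.
Proof. exact: tlift_pure _ _ rslice_balanced. Qed.

Lemma rsliceZ (c : k) t : rslice (c%:K * t) = c%:K * rslice t.
Proof.
elim/talg_ind: t => [|t t' IH IH'|u v]; first by rewrite mulr0 (morph0 rsliceD) mulr0.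
  by rewrite mulrDr !rsliceD IH IH' mulrDr.
by rewrite -ptensZl !rslice_ptens !mulrA -!algCM mulrC.
Qed.

(* The map id (x) id (x) phi. *)
Definition rslice3 (t : talg H (talg H H)) : talg H H :=
  talift (fun u s => ptens u (rslice s)) t.

Fact rslice3_balanced : balanced (fun (c : k) (u : H) => c%:K * u)
  (fun (c : k) (v : talg H H) => c%:K * v) (fun u s => ptens u (rslice s)).
Proof.
split=> [v u u'|u v v'|c u v]; first exact: ptensDl.
  by rewrite rsliceD ptensDr.
by rewrite rsliceZ ptensZ.
Qed.

Lemma rslice3D : {morph rslice3 : t t' / t + t'}.
Proof. exact: tliftD rslice3_balanced. Qed.

Lemma rslice3_ptens u s : rslice3 (ptens u s) = ptens u (rslice s).
Proof. exact: tlift_pure _ _ rslice3_balanced. Qed.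

Lemma rslice3_assoc (t : talg H H) w : rslice3 (tassoc (ptens t w)) = (phi w)%:K * t.
Proof.
have [tD _ _] := tassoc_alghom H H H.
elim/talg_ind: t => [|t t' IH IH'|u v].
- have z := alghom0 (tassoc_alghom H H H).
  by rewrite ptens0l z (morph0 rslice3D) mulr0.
- by rewrite ptensDl tD rslice3D IH IH' mulrDr.
by rewrite tassoc_ptens rslice3_ptens rslice_ptens ptensZr.
Qed.

End Slices.

Section Pointed.
Variables (k : fieldType) (H : pzAlgType k) (HH : hopf H).

Definition grouplike (w : H) : Prop :=
  comul HH w = ptens w w /\ counit HH w = 1.

Let hD : alghom (comul HH) := comul_alghom HH.
Let he : alghom (counit HH) := counit_alghom HH.

Lemma grouplike1 : grouplike 1.
Proof. by split; [rewrite (alghom1 hD) | rewrite (alghom1 he)]. Qed.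

Lemma grouplikeM u v : grouplike u -> grouplike v -> grouplike (u * v).
Proof.
have [_ DM _] := hD; have [_ eM _] := he.
by case=> Du eu [Dv ev]; split; rewrite ?DM ?eM ?Du ?Dv ?ptensM ?eu ?ev ?mulr1.
Qed.

Inductive gspan : H -> Prop :=
| gspan_grouplike w of grouplike w : gspan w
| gspanZ (c : k) u of gspan u : gspan (c%:K * u)
| gspanD u v of gspan u & gspan v : gspan (u + v).

Lemma gspan_subspace : subspace gspan.
Proof.
split=> [|c u v gu gv]; last by apply: gspanD => //; apply: gspanZ.
rewrite -(mul0r 1) -(@algC0 k); apply/gspanZ/gspan_grouplike; exact: grouplike1.
Qed.

Lemma gspanM u v : gspan u -> gspan v -> gspan (u * v).
Proof.
elim=> {u} [w gw|c u _ IH|u u' _ IH _ IH'] gv.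
- elim: gv => {v} [v gv|c v _ IH|v v' _ IH _ IH'].
  + exact/gspan_grouplike/grouplikeM.
  + by rewrite mulrA -algCC -mulrA; apply: gspanZ.
  by rewrite mulrDr; apply: gspanD.
- by rewrite -mulrA; apply/gspanZ/IH.
by rewrite mulrDl; apply: gspanD; [apply: IH | apply: IH'].
Qed.

(** The line k w is itself a subcoalgebra. *)
Lemma simple_grouplike (D : H -> Prop) w :
  simple_subcoalgebra HH D -> D w -> grouplike w -> one_dimensional D.
Proof.
move=> [[sD _] _ simp] Dw [Dw2 ew].
have w0 : w <> 0.
  move=> w0; have := oner_neq0 k; rewrite -[1](ew : counit HH w = 1 :> k) w0.
  by rewrite (alghom0 he) eqxx.
pose E u := exists c : k, u = c%:K * w.
have EE : subcoalgebra HH E.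
  split=> [|_ [c ->]].
    split=> [|c _ _ [d ->] [d' ->]]; first by exists 0; rewrite algC0 mul0r.
    by exists (c * d + d'); rewrite algCD algCM mulrDl mulrA.
  exists [:: (c%:K * w, w)]; last first.
    by rewrite big_seq1 (alghomZ _ _ hD) Dw2 ptensZl.
  move=> p; rewrite inE => /eqP -> /=.
  by split; [exists c | exists 1; rewrite algC1 mul1r].
have ED u : E u -> D u by case=> c ->; apply: subspZ.
exists w => // u; split; last exact: ED.
case: (simp E EE ED) => [E0|DE]; last exact: DE.
by case: w0; apply: E0; exists 1; rewrite algC1 mul1r.
Qed.

Variables Gr Sk : H -> Prop.
Hypothesis Gr_grouplike : forall w, Gr w -> grouplike w.
Hypothesis Sk_skew : forall s, Sk s ->
  exists2 w, Gr w & comul HH s = ptens 1 s + ptens s w.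
Hypothesis generatedGS : generated (fun z => Gr z \/ Sk z).

(** Counting skew-primitive factors gives a coalgebra filtration that starts
    with the span of the group-like elements. *)
Inductive filt : nat -> H -> Prop :=
| filt_Gr w of Gr w : filt 0 w
| filt_Sk s of Sk s : filt 1 s
| filtK (c : k) : filt 0 c%:K
| filtS n u of filt n u : filt n.+1 u
| filtD n u v of filt n u & filt n v : filt n (u + v)
| filtM n m u v of filt n u & filt m v : filt (n + m) (u * v).

Lemma filt_leq n m u : (n <= m)%N -> filt n u -> filt m u.
Proof.
move=> /subnKC <-; elim: (m - n)%N => [|d IH] fu; first by rewrite addn0.
by rewrite addnS; apply/filtS/IH.
Qed.

Lemma filt_subspace n : subspace (filt n).
Proof.
split=> [|c u v fu fv]; first by rewrite -(@algC0 k); exact/(filt_leq (leq0n n))/filtK.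
by apply: filtD => //; rewrite -[n]add0n; apply: filtM => //; apply: filtK.
Qed.

Lemma filt_exhaustive u : exists n, filt n u.
Proof.
move: u; apply: generatedGS => [|z [Gz|Sz]]; last 2 first.
- by exists 0; apply: filt_Gr.
- by exists 1%N; apply: filt_Sk.
apply: subalgebraI => [c|v w [n fv] [m fw]|v w [n fv] [m fw]].
- by exists 0; apply: filtK.
- exists (n + m)%N; apply: filtD.
    exact: filt_leq (leq_addr _ _) fv.
  exact: filt_leq (leq_addl _ _) fw.
by exists (n + m)%N; apply: filtM.
Qed.

Definition filt_pair n u v :=
  filt n u /\ (gspan v \/ exists2 m, n = m.+1 & filt m u).

(** Comultiplication respects the filtration; only its components with right
    factor in degree 0 keep the full degree on the left. *)
Lemma comul_filt n u : filt n u -> sums (filt_pair n) (comul HH u).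
Proof.
have [DD DM DK] := hD.
have g1 := gspan_grouplike grouplike1.
have f1 : filt 0 1 by rewrite -(@algC1 k); apply: filtK.
elim=> {n u} [w Gw|s Ss|c|n u _ IH|n u v _ IH _ IH'|n m u v _ IH _ IH'].
- have gw := Gr_grouplike Gw; rewrite gw.1; apply: sums_ptens.
  by split; [apply: filt_Gr | left; apply: gspan_grouplike].
- have [w Gw ->] := Sk_skew Ss; apply: sumsD; apply: sums_ptens.
    by split; [apply: filtS | right; exists 0].
  by split; [apply: filt_Sk | left; apply/gspan_grouplike/Gr_grouplike].
- by rewrite DK; apply: sums_ptens; split; [apply: filtK | left].
- apply: sumsW IH => v w [fv _]; split; first exact: filtS.
  by right; exists n.
- by rewrite DD; apply: sumsD.
rewrite DM; apply: sumsM IH IH' => u1 v1 u2 v2 [fu1 H1] [fu2 H2].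
split; first exact: filtM.
case: H1 => [gv1|[n' -> fu1']]; last first.
  by right; exists (n' + m)%N => //; apply: filtM.
case: H2 => [gv2|[m' -> fu2']]; first by left; apply: gspanM.
by right; exists (n + m')%N; [rewrite addnS | apply: filtM].
Qed.

(** A nonzero element d of minimal filtration degree in a simple subcoalgebra D
    has its comultiplication in D (x) k G, so d is a sum of eigenvectors for
    group-like elements, and these are multiples of the group-like elements. *)
Lemma pointed_generated : pointed HH.
Proof.
move=> D simpD; have [[sD DD] [d0 Dd0 d0_neq0] _] := simpD.
pose P n := `[< exists d, [/\ D d, d <> 0 & filt n d] >].
have exP : exists n, P n.
  by have [n fn] := filt_exhaustive d0; exists n; apply/asboolP; exists d0.
case: (ex_minnP exP) => n /asboolP[d [Dd d_neq0 fd]] nmin {exP d0 Dd0 d0_neq0}.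
pose F u := if n is m.+1 then filt m u else u = 0.
have sF : subspace F.
  rewrite /F; case: (n) => [|m]; last exact: filt_subspace.
  by split=> // c u v -> ->; rewrite mulr0 addr0.
(* F is the filtration step below n; it meets D in 0 by minimality of n. *)
have DF u : D u -> F u -> u = 0.
  move=> Du Fu; apply: contrapT => u0; move: Fu; rewrite /F.
  case: n nmin {fd F sF} => [|m] nmin // fu.
  have /nmin : P m by apply/asboolP; exists u.
  by rewrite ltnn.
have [s sD2 Ds] := DD d Dd.
have [N [u [v [uvP Dd_uv]]]] := sums_fin (seq_sums (P := fun u _ => D u) (fun p ps => (sD2 p ps).1)).
have sT : subspace (fun _ : H => True) by split.
have DFsum N' (w : 'I_N' -> H) (c : 'I_N' -> k) : (forall i, D (w i)) ->
    F (\sum_i (c i)%:K * w i) -> \sum_i (c i)%:K * w i = 0.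
  by move=> Dw; apply: DF; apply: subsp_sum => // i _; apply: subspZ.
have [M [u' [v' [Du' _ uv' dual]]]] :=
  independent_expansion (d := u) (h := v) (fun v => ptensDl v) (fun u => ptensDr u)
    (fun c u v => ptensZ c u v) sT sF DFsum uvP (fun=> I).
have Dd_uv' : comul HH d = \sum_i ptens (u' i) (v' i) by rewrite Ds Dd_uv uv'.
(* A form dual to u' i and zero on F sees only the terms of [comul_filt] with *)
(* a right factor in degree 0.                                                *)
have gv' i : gspan (v' i).
  have [phi [phiD phiZ phiF phiu]] := dual i.
  have -> : v' i = lslice phi (comul HH d).
    rewrite Dd_uv' (big_morph _ (lsliceD phiD phiZ) (morph0 (lsliceD phiD phiZ))).
    rewrite (bigD1 i) //= big1 ?addr0 => [|j /negPf ji].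
      by rewrite lslice_ptens // phiu eqxx algC1 mul1r.
    by rewrite lslice_ptens // phiu eq_sym ji algC0 mul0r.
  have gs := gspan_subspace.
  elim: (comul_filt fd) => [|t t' _ gt _ gt'|w1 w2 [_ Hw]].
  - by rewrite (morph0 (lsliceD phiD phiZ)); case: gs.
  - by rewrite (lsliceD phiD phiZ); apply: gspanD.
  rewrite lslice_ptens //; case: Hw => [gw2|[m nm fw1]]; first exact: gspanZ.
  by rewrite phiF ?algC0 ?mul0r /F ?nm //; case: gs.
have sums_g : sums (fun u g => D u /\ grouplike g) (comul HH d).
  rewrite Dd_uv'; apply: sums_sum => i; move: (Du' i); move: (u' i).
  elim: (gv' i) => [w gw u1 Du1|c w _ IH u1 Du1|w w' _ IH _ IH' u1 Du1].
  - exact: sums_ptens.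
  - by rewrite -ptensZ; apply: IH; apply: subspZ.
  by rewrite ptensDr; apply: sumsD; [apply: IH | apply: IH'].
have {u v uvP Dd_uv u' v' Du' uv' dual Dd_uv' gv' N M} [N [u [w [uwP Dd_uw]]]] := sums_fin sums_g.
have s0 : subspace (fun u : H => u = 0).
  by split=> // c u1 u2 -> ->; rewrite mulr0 addr0.
have [M [w' [u' [gw' Du' uw' dual]]]] :=
  independent_expansion (beta := fun w u : H => ptens u w)
    (fun u => ptensDr u) (fun w => ptensDl w) (fun c w u => esym (ptensZ c u w))
    sD s0 (fun _ _ _ _ => id) (fun i => (uwP i).2) (fun i => (uwP i).1).
have {uw'} Dd : comul HH d = \sum_i ptens (u' i) (w' i) by rewrite Dd_uw uw'.
(* Coassociativity, read through a form dual to w' i. *)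
have Du'2 i : comul HH (u' i) = ptens (u' i) (w' i).
  have [phi [phiD phiZ _ phiw]] := dual i.
  have hl := atmap_alghom hD (@alghom_id _ H).
  have hr := atmap_alghom (@alghom_id _ H) hD.
  have rD := rslice3D phiD phiZ.
  have L : rslice3 phi (tassoc (atmap (comul HH) id (comul HH d))) = comul HH (u' i).
    rewrite Dd (alghom_sum hl) (alghom_sum (tassoc_alghom H H H)).
    rewrite (big_morph _ rD (morph0 rD)) (bigD1 i) //= big1 ?addr0 => [|j /negPf ji].
      by rewrite atmap_ptens // rslice3_assoc // phiw eqxx algC1 mul1r.
    by rewrite atmap_ptens // rslice3_assoc // phiw eq_sym ji algC0 mul0r.
  have R : rslice3 phi (atmap id (comul HH) (comul HH d)) = ptens (u' i) (w' i).
    rewrite Dd (alghom_sum hr).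
    rewrite (big_morph _ rD (morph0 rD)) (bigD1 i) //= big1 ?addr0 => [|j /negPf ji].
      by rewrite atmap_ptens // (gw' i).1 rslice3_ptens // rslice_ptens // phiw eqxx algC1 mul1r.
    rewrite atmap_ptens // (gw' j).1 rslice3_ptens // rslice_ptens // phiw eq_sym ji.
    by rewrite algC0 mul0r ptens0r.
  by rewrite -L -R comulA.
have ek : alghom (fun h => (counit HH h)%:K : H).
  have [eD eM eK] := he.
  by split=> [h h'|h h'|c]; [rewrite eD algCD | rewrite eM algCM | rewrite eK].
have [i ui0] : exists i, u' i <> 0.
  apply: contrapT => no; apply: d_neq0; rewrite -(counitl HH d) Dd big1 => [|i _].
    by apply: alghom0 (talift_alghom ek (@alghom_id _ H) _) => u1 u2; apply: algCC.
  by have -> : u' i = 0 by [apply: contrapT => ui; apply: no; exists i]; rewrite ptens0l.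
apply: (simple_grouplike (w := w' i)) => //.
have uE : u' i = (counit HH (u' i))%:K * w' i.
  by rewrite -[LHS](counitl HH) Du'2 (talift_ptens ek (@alghom_id _ H)).
have e0 : counit HH (u' i) != 0 :> k.
  by apply/eqP => e0; apply: ui0; rewrite uE e0 algC0 mul0r.
by rewrite -(algCVK (w' i) e0) -uE; apply: subspZ.
Qed.

End Pointed.

(** * Normal forms of words *)

(** ** The degree-lexicographic order *)

Section Code.
Local Open Scope nat_scope.

Fixpoint val2 (w : seq bool) : nat :=
  if w is b :: w' then b * 2 ^ size w' + val2 w' else 0.

(** The binary number with digits 1w; its order is the degree-lexicographic
    order on words, with x = false < a = true. *)
Definition code (w : seq bool) : nat := 2 ^ size w + val2 w.

Lemma val2_lt w : val2 w < 2 ^ size w.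
Proof.
elim: w => //= b w IH; rewrite expnS; case: b; rewrite ?mul1n ?mul0n; lia.
Qed.

Lemma val2_cat u w : val2 (u ++ w) = val2 u * 2 ^ size w + val2 w.
Proof.
by elim: u => //= b u ->; rewrite size_cat expnD mulnDl addnA mulnA.
Qed.

Lemma val2_inj u w : size u = size w -> val2 u = val2 w -> u = w.
Proof.
elim: u w => [|b u IH] [|c w] //= [suw]; rewrite suw => E.
have := val2_lt u; have := val2_lt w; rewrite suw => lw lu.
have bc : b = c by move: E; case: b; case: c => //; rewrite ?mul1n ?mul0n; lia.
by rewrite bc (IH w) //; move: E; rewrite bc => /addnI.
Qed.

Lemma code_size_lt u w : size u < size w -> code u < code w.
Proof.
move=> lt_uw; rewrite /code; have := val2_lt u.
have : 2 ^ (size u).+1 <= 2 ^ size w by rewrite leq_exp2l.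
rewrite expnS; lia.
Qed.

Lemma code_lt_size u w : code u < code w -> size u <= size w.
Proof.
move=> lt_c; rewrite leqNgt; apply/negP => lt_s.
by have := code_size_lt lt_s; rewrite ltnNge ltnW.
Qed.

Lemma code_context u v t t' : code t < code t' ->
  code (u ++ t ++ v) < code (u ++ t' ++ v).
Proof.
move=> lt_c; have := code_lt_size lt_c; rewrite leq_eqVlt => /orP[/eqP st|st].
  move: lt_c; rewrite /code !val2_cat !size_cat st ltn_add2l => lt_v.
  by rewrite ltn_add2l ltn_add2l ltn_add2r ltn_pmul2r // expn_gt0.
by apply: code_size_lt; rewrite !size_cat ltn_add2l ltn_add2r.
Qed.

Variable n : nat.

(** Leading in the j-th relation for n = deg g, by [code_lead]. *)
Definition lead_word j := nseq j true ++ nseq (n - j) false.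

Lemma size_lead_word j : j <= n -> size (lead_word j) = n.
Proof. by move=> le_j; rewrite size_cat !size_nseq subnKC. Qed.

Lemma count_lead_word j : count_mem true (lead_word j) = j.
Proof. by rewrite count_cat !count_nseq /= mul1n mul0n addn0. Qed.

Lemma val2_nseq_false m : val2 (nseq m false) = 0.
Proof. by elim: m => //= m ->; rewrite mul0n. Qed.

(** The letters a of the largest word come first. *)
Lemma val2_lead t j : size t = n -> count_mem true t = j -> t != lead_word j ->
  val2 t < val2 (lead_word j).
Proof.
move=> st ct; rewrite /lead_word -st.
have le (w : seq bool) i : count_mem true w = i ->
    val2 w <= val2 (nseq i true ++ nseq (size w - i) false).
  elim: w i => [|b w IH] i /=; first by move=> <-.
  have cs := count_size (pred1 true) w.
  case: b => /=.
    rewrite add1n => <- /=; rewrite subSS !size_cat !size_nseq subnKC //.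
    by rewrite leq_add2l IH.
  rewrite add0n mul0n add0n => ci; apply: leq_trans (IH i ci) _.
  rewrite -ci subSn // !val2_cat !val2_nseq_false !addn0 !size_nseq.
  by rewrite leq_mul2l leq_exp2l // leqnSn orbT.
rewrite ltn_neqAle le // andbT => ne; apply: contra ne => /eqP E.
apply/eqP/val2_inj => //; rewrite size_cat !size_nseq subnKC //.
by rewrite -ct; apply: count_size.
Qed.

Lemma code_lead i j t : i <= n -> 0 < j -> t \in words i j -> t != lead_word j ->
  code t < code (lead_word j).
Proof.
rewrite mem_words => le_i j0 /andP[/eqP st /eqP ct] ne.
have le_j : j <= n by rewrite -ct; apply: leq_trans (count_size _ _) _; rewrite st.
move: le_i; rewrite leq_eqVlt => /orP[/eqP E|lt_i].
  rewrite /code st E size_lead_word // ltn_add2l; apply: val2_lead => //.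
  by rewrite st.
by apply: code_size_lt; rewrite size_lead_word // st.
Qed.

Lemma code_nil_lead j : 0 < j <= n -> code [::] < code (lead_word j).
Proof. by case/andP=> j0 le_j; apply: code_size_lt; rewrite size_lead_word // (leq_trans j0). Qed.

(** ** The rightmost occurrence of a leading word *)

Definition redex (w : seq bool) : option nat :=
  let j := count_mem true (take n w) in
  if (0 < j) && (take n w == lead_word j) then Some j else None.

Fixpoint last_redex (w : seq bool) : option (seq bool * nat * seq bool) :=
  if w is b :: w' then
    if last_redex w' is Some (u, j, v) then Some (b :: u, j, v)
    else if redex w is Some j then Some ([::], j, drop n w) else None
  else None.

Lemma redexP w j : redex w = Some j -> 0 < j <= n /\ w = lead_word j ++ drop n w.
Proof.
rewrite /redex; case: ifP => // /andP[j0 /eqP E] [jE]; rewrite jE in j0 E.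
rewrite j0 -E cat_take_drop; split=> //=; rewrite -jE.
by apply: leq_trans (count_size _ _) _; rewrite size_take_min geq_minl.
Qed.

Lemma redex_lead j v : 0 < j <= n -> redex (lead_word j ++ v) = Some j.
Proof.
by case/andP=> j0 le_j; rewrite /redex take_size_cat ?size_lead_word // count_lead_word j0 eqxx.
Qed.

Lemma redex_false w : 0 < n -> redex (false :: w) = None.
Proof.
move=> n0; rewrite /redex; case: ifP => // /andP[j0 /eqP]; move: j0.
by set j := count_mem _ _; case: j n0 => // j; case: (n) => // m _ _.
Qed.

Lemma last_redexP w u j v : last_redex w = Some (u, j, v) ->
  0 < j <= n /\ w = u ++ lead_word j ++ v.
Proof.
elim: w u j v => //= b w IH u j v.
case E : (last_redex w) => [[[u' j'] v']|].
  by case=> <- <- <-; have [jn wE] := IH _ _ _ E; split; rewrite // {1}wE.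
case R : (redex (b :: w)) => [j'|] // [<- <- <-].
by have [jn wE] := redexP R; split; rewrite // {1}wE.
Qed.

Lemma last_redex_cat p w u j v :
  last_redex w = Some (u, j, v) -> last_redex (p ++ w) = Some (p ++ u, j, v).
Proof. by move=> E; elim: p => //= b p ->. Qed.

Lemma last_redex_false m w : 0 < n ->
  last_redex w = None -> last_redex (nseq m false ++ w) = None.
Proof.
by move=> n0 E; elim: m => //= m ->; rewrite redex_false.
Qed.

(** An occurrence further to the right would start inside the leading word and
    end in v, which the conditions on v exclude. *)
Lemma last_redex_lead j v : 0 < j <= n -> last_redex v = None ->
    (j = 1 \/ v = [::] \/ (j < n /\ exists v', v = true :: v')) ->
  last_redex (lead_word j ++ v) = Some ([::], j, v).
Proof.
move=> jn nv cond; have n0 : 0 < n by lia.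
suff tail : last_redex (nseq j.-1 true ++ nseq (n - j) false ++ v) = None.
  have E : lead_word j ++ v = true :: (nseq j.-1 true ++ nseq (n - j) false ++ v).
    by rewrite /lead_word; case: (j) jn => // j' _; rewrite /= catA.
  rewrite E /= tail -E redex_lead // drop_size_cat // size_lead_word //.
  by case/andP: jn.
have base := last_redex_false (n - j) n0 nv.
case: cond => [->|cond]; first by rewrite /= last_redex_false.
have : j.-1 < j by lia.
elim: (j.-1) => //= i IH lt_i; rewrite IH; last by lia.
rewrite -[true :: _]/(nseq i.+1 true ++ _); set w := _ ++ _.
case R : (redex w) => [j'|] //; have [jn' wE] := redexP R.
have sw : n <= size w by rewrite wE size_cat size_lead_word //; lia.
have nthL m : m < n -> nth false w m = (m < j').
  move=> lt_m; rewrite wE nth_cat size_lead_word; last by lia.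
  rewrite lt_m /lead_word nth_cat size_nseq; case: ltnP => lt_mj.
    by rewrite nth_nseq lt_mj.
  by rewrite nth_nseq if_same.
case: cond => [v0|[lt_j [v' vE]]].
  by move: sw; rewrite /w v0 cats0 size_cat !size_nseq; lia.
have := nthL i.+1; rewrite /w nth_cat size_nseq ltnn subnn nth_cat size_nseq.
rewrite subn_gt0 lt_j nth_nseq if_same => h1.
have := nthL (i.+1 + (n - j)); rewrite /w nth_cat size_nseq.
have -> : (i.+1 + (n - j) < i.+1) = false by lia.
have -> : i.+1 + (n - j) - i.+1 = n - j by lia.
rewrite nth_cat size_nseq ltnn subnn vE /= => h2.
by have := h1 ltac:(lia); have := h2 ltac:(lia); lia.
Qed.

End Code.

(** ** Normal form functionals *)

Section NormalForm.
Variables (k : fieldType) (g : {poly k}) (V : lmodType k).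
Variables (X W : {linear V -> V}).
Hypothesis XW : forall v, X (W v) = W (X v).
Hypotheses (g_neq0 : g != 0) (deg_g : (0 < deg g)%N).
Implicit Types (u v w : seq bool) (phi : seq bool -> V).

Local Notation n := (deg g).
Let c := g`_n.

Let c0 : c != 0. Proof. by rewrite /c -lead_coefE lead_coef_eq0. Qed.

Let size_g : size g = n.+1.
Proof. by rewrite /deg prednK // size_poly_gt0. Qed.

(** The value of a functional at the j-th relation, W playing the role of the
    central element a^n. *)
Definition relation phi j : V :=
  \sum_(i < size g) g`_i *: wsum phi i j - g`_j *: W (phi [::]).

Lemma eq_relation phi phi' j : phi =1 phi' -> relation phi j = relation phi' j.
Proof.
by move=> E; rewrite /relation E; congr (_ - _); apply: eq_bigr => i _; rewrite (eq_wsum (phi' := phi')).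
Qed.

Lemma relation_eq0 phi j : phi =1 (fun=> 0) -> relation phi j = 0.
Proof.
move=> E; rewrite (eq_relation _ E) /relation linear0 scaler0 subr0 big1 // => i _.
by rewrite /wsum big1 ?scaler0.
Qed.

Lemma relation_big phi j : (n < j)%N -> relation phi j = 0.
Proof.
move=> lt_j; rewrite /relation nth_default ?size_g // scale0r subr0 big1 // => i _.
rewrite wsum_small ?scaler0 //; exact: leq_trans (ltn_ord i) lt_j.
Qed.

(** All other words of the j-th relation are smaller than the leading word. *)
Lemma relation_lead phi j : (0 < j <= n)%N ->
    (forall w, (code w < code (lead_word n j))%N -> phi w = 0) ->
  relation phi j = c *: phi (lead_word n j).
Proof.
move=> jn phi0; have [j0 le_j] := andP jn.
rewrite /relation phi0 ?code_nil_lead // linear0 scaler0 subr0 size_g big_ord_recr /=.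
rewrite big1 => [|i _]; last first.
  rewrite /wsum big_seq big1 ?scaler0 // => t tw; apply: phi0.
  apply: (code_lead (ltnW (ltn_ord i)) j0 tw); apply: contraTneq tw => ->.
  by rewrite mem_words size_lead_word // gtn_eqF.
have tw : lead_word n j \in words n j.
  by rewrite mem_words size_lead_word // count_lead_word !eqxx.
rewrite add0r /wsum (bigD1_seq _ tw (words_uniq _ _)) /= big_seq_cond big1 ?addr0 // => t.
by case/andP=> tw' ne; apply/phi0/(code_lead (leqnn _) j0).
Qed.

(** The identity [x + t a, g(x + t a)] = 0, read in the free algebra. *)
Lemma relation_syzygy phi j :
  relation (phi \o cons false) j.+1 + relation (phi \o cons true) j
    = relation (phi \o rcons^~ false) j.+1 + relation (phi \o rcons^~ true) j.
Proof.
rewrite /relation [LHS]addrACA [RHS]addrACA -!big_split /=; congr (_ + _).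
by apply: eq_bigr => i _; rewrite -!scalerDr -wsumSS -wsumSSr.
Qed.

Lemma relationP d phi phi' j :
  relation (fun t => d *: phi t + phi' t) j = d *: relation phi j + relation phi' j.
Proof.
rewrite /relation.
have -> : g`_j *: W (d *: phi [::] + phi' [::])
    = d *: (g`_j *: W (phi [::])) + g`_j *: W (phi' [::]).
  by rewrite linearP scalerDr !scalerA mulrC.
rewrite scalerBr addrACA -opprD; congr (_ - _).
rewrite scaler_sumr -big_split; apply: eq_bigr => i _ /=.
rewrite scalerA mulrC -scalerA -scalerDr; congr (_ *: _).
by rewrite /wsum scaler_sumr -big_split.
Qed.

Lemma relationD phi phi' j :
  relation (fun t => phi t + phi' t) j = relation phi j + relation phi' j.
Proof.
rewrite -[relation phi j]scale1r -relationP.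
by apply: eq_relation => t; rewrite scale1r.
Qed.

Lemma relationZ d phi j : relation (fun t => d *: phi t) j = d *: relation phi j.
Proof.
rewrite -[RHS]addr0 -(@relation_eq0 (fun=> 0) j) // -relationP.
by apply: eq_relation => t; rewrite addr0.
Qed.

Lemma relation_sum (I : Type) (r : seq I) (F : I -> seq bool -> V) j :
  relation (fun t => \sum_(i <- r) F i t) j = \sum_(i <- r) relation (F i) j.
Proof.
elim: r => [|i r IH]; last rewrite big_cons -IH -relationD.
  by rewrite big_nil relation_eq0 // => t; rewrite big_nil.
by apply: eq_relation => t; rewrite big_cons.
Qed.

Lemma relation_op (L : {linear V -> V}) phi j : (forall z, L (W z) = W (L z)) ->
  relation (fun t => L (phi t)) j = L (relation phi j).
Proof.
move=> LW; rewrite /relation [RHS]linearB /= [L (g`_j *: _)]linearZ /= LW; congr (_ - _).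
rewrite linear_sum; apply: eq_bigr => i _; rewrite linearZ; congr (_ *: _).
by rewrite /wsum linear_sum.
Qed.

(** Two relations applied at different places of a word can be exchanged. *)
Lemma relationC (F : seq bool -> seq bool -> V) i j :
  relation (fun s => relation (F^~ s) j) i = relation (fun t => relation (F t) i) j.
Proof.
rewrite [RHS]/relation -(relation_op (L := W)) // -relationZ -scaleN1r -relationZ.
have -> : \sum_(l < size g) g`_l *: wsum (fun t => relation (F t) i) l j
    = relation (fun s => \sum_(l < size g) g`_l *: wsum (F^~ s) l j) i.
  rewrite relation_sum; apply: eq_bigr => l _; rewrite relationZ; congr (_ *: _).
  by rewrite /wsum relation_sum.
rewrite -relationD; apply: eq_relation => s.
by rewrite scaleN1r.
Qed.

(** *** The functional *)

Variables (v0 : V) (e : seq bool).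

(** The coefficient of e, with powers of x on the left evaluated at X. *)
Definition normal_value w : V :=
  if drop (find id w) w == e then iter (find id w) X v0 else 0.

(* N bounds the code of w, which drops in each reduction. *)
Fixpoint nf_fuel N w : V :=
  if N is N'.+1 then
    if last_redex n w is Some (u, j, v) then
      - c^-1 *: relation (fun t =>
          if t == lead_word n j then 0 else nf_fuel N' (u ++ t ++ v)) j
    else normal_value w
  else 0.

(** The linear functional that rewrites a word to normal form, reducing its
    rightmost leading word first. *)
Definition nf w := nf_fuel (code w).+1 w.

Lemma eq_relation_low phi phi' j : (0 < j <= n)%N ->
    (forall w, (code w < code (lead_word n j))%N -> phi w = phi' w) ->
  phi (lead_word n j) = phi' (lead_word n j) -> relation phi j = relation phi' j.
Proof.
move=> jn E El; apply/eqP; rewrite -subr_eq0 -scaleN1r addrC -relationP.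
rewrite relation_lead // => [|w /E ->]; first by rewrite El scaleN1r addNr scaler0.
by rewrite scaleN1r addNr.
Qed.

Lemma nf_fuel_stable N M w : (code w < N)%N -> (code w < M)%N ->
  nf_fuel N w = nf_fuel M w.
Proof.
elim: N M w => // N IH [//|M] w lt_N lt_M /=.
case E : (last_redex n w) => [[[u j] v]|] //; have [jn wE] := last_redexP E.
congr (_ *: _); apply: eq_relation_low => // [t lt_t|]; last by rewrite eqxx.
case: ifP => // _; have := code_context u v lt_t; rewrite -wE => lt_w.
by apply: IH; apply: (leq_trans lt_w); rewrite -ltnS.
Qed.

(** The definition of the functional, freed of the bound on the code. *)
Lemma nf_redex w u j v : last_redex n w = Some (u, j, v) ->
  relation (fun t => nf (u ++ t ++ v)) j = 0.
Proof.
move=> E; have [jn wE] := last_redexP E.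
pose low t := if t == lead_word n j then 0 else nf (u ++ t ++ v).
pose top t := if t == lead_word n j then nf (u ++ t ++ v) else 0.
have -> : relation (fun t => nf (u ++ t ++ v)) j = relation (fun t => low t + top t) j.
  by apply: eq_relation => t; rewrite /low /top; case: ifP; rewrite ?add0r ?addr0.
rewrite relationD [relation top j]relation_lead // => [|t]; last first.
  by rewrite /top; case: eqP => // ->; rewrite ltnn.
rewrite /top eqxx -wE /nf /= E scalerA mulrN mulfV // scaleN1r.
apply/eqP; rewrite subr_eq0; apply/eqP; apply: eq_relation_low => // [t lt_t|].
  rewrite /low; case: ifP => // _; apply: nf_fuel_stable => //.
  by rewrite [X in (_ < code X)%N]wE; apply: code_context.
by rewrite /low eqxx.
Qed.

Lemma nf_normal w : last_redex n w = None -> nf w = normal_value w.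
Proof. by rewrite /nf /= => ->. Qed.

Lemma size_context (u v t t' : seq bool) : (code t < code t')%N ->
  (size (u ++ t ++ v) <= size (u ++ t' ++ v))%N.
Proof. by move=> /code_lt_size lt_t; rewrite !size_cat leq_add2l leq_add2r. Qed.

(** Rightmost reduction is confluent: the functional kills the relations in any
    context. The induction is on the length of v, then on j, then on the code
    of v. If v is not normal, its rightmost leading word can be reduced before or
    after the j-th relation. If v is normal and does not overlap with the leading
    word, the j-th relation is the next reduction, so it is killed by definition.
    Otherwise [relation_syzygy] moves the relation past the first letter of v. *)
Lemma nf_relation u j v : (0 < j)%N -> relation (fun t => nf (u ++ t ++ v)) j = 0.
Proof.
have [m] := ubnP (size v); elim: m u j v => // m IHm u j.
elim: j u => // j IHj u v + _.
have [l] := ubnP (code v); elim: l v => // l IHl v lt_l lt_m.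
have [lt_j|le_j] := ltnP n j.+1; first exact: relation_big.
case nv : (last_redex n v) => [[[v1 i] v2]|].
  have [iN vE] := last_redexP nv.
  pose F t s := nf (u ++ t ++ v1 ++ s ++ v2).
  have FE t : relation (F t) i = 0.
    have R := nf_redex (last_redex_cat (u ++ t) nv); rewrite -[RHS]R.
    by apply: eq_relation => s; rewrite /F -!catA.
  have := relationC F i j.+1; rewrite [RHS]relation_eq0 //.
  rewrite relation_lead // => [/eqP|s lt_s]; last first.
    rewrite IHl //.
      have := code_context v1 v2 lt_s; rewrite -vE; lia.
    by have := size_context v1 v2 lt_s; rewrite -vE; lia.
  by rewrite scaler_eq0 (negPf c0) /F -vE => /eqP.
(* No overlap: the leading word in front of v is the rightmost one. *)
have def_case : (j.+1 = 1 \/ v = [::] \/ (j.+1 < n /\ exists v', v = true :: v'))%N ->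
    relation (fun t => nf (u ++ t ++ v)) j.+1 = 0.
  move=> cond; have jn : (0 < j.+1 <= n)%N by [].
  have R := nf_redex (last_redex_cat u (last_redex_lead jn nv cond)).
  by rewrite -[RHS]R; apply: eq_relation => t; rewrite cats0.
case: v nv lt_m lt_l IHl def_case => [|[] v] nv lt_m lt_l IHl def_case.
- by apply: def_case; right; left.
- have [lt_j|ge_j] := ltnP j.+1 n; first by apply: def_case; right; right; split=> //; exists v.
  have jE : j.+1 = n by apply/eqP; rewrite eqn_leq le_j.
  (* a^n commutes with a. *)
  have := relation_syzygy (fun t => nf (u ++ t ++ v)) j.+1.
  rewrite !(relation_big _ (j := j.+2)) ?jE // !add0r -jE.
  rewrite (eq_relation (phi' := fun t => nf (rcons u true ++ t ++ v))).
    rewrite IHm // => E; rewrite [RHS]E; apply: eq_relation => t.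
    by rewrite /= cat_rcons.
  by move=> t /=; rewrite cat_rcons.
(* The word a^j x^(n-j) x overlaps with a a^(j-1) x^(n-j+1), if j > 1. *)
case: j IHj IHl def_case le_j => [|j] IHj IHl def_case le_j; first by apply: def_case; left.
have := relation_syzygy (fun t => nf (u ++ t ++ v)) j.+1.
rewrite (eq_relation (phi' := fun t => nf (rcons u false ++ t ++ v))); last first.
  by move=> t /=; rewrite cat_rcons.
rewrite [X in _ + X = _](eq_relation (phi' := fun t => nf (rcons u true ++ t ++ v))); last first.
  by move=> t /=; rewrite cat_rcons.
rewrite [X in X + _ = _]IHm // [X in _ + X = _]IHm // addr0 => /esym.
rewrite [X in _ + X](eq_relation (phi' := fun t => nf (u ++ t ++ true :: v))); last first.
  by move=> t /=; rewrite cat_rcons.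
rewrite [X in _ + X = _]IHj // addr0 => E; rewrite -[RHS]E; apply: eq_relation => t.
by rewrite /= cat_rcons.
Qed.

(** Reduction of words to normal words, modulo a subspace M. *)
Lemma relation_closed (M : V -> Prop) phi :
    M 0 -> (forall d z z', M z -> M z' -> M (d *: z + z')) ->
    (forall z, M z -> M (W z)) ->
    (forall u v j, (0 < j)%N -> M (relation (fun t => phi (u ++ t ++ v)) j)) ->
    (forall w, last_redex n w = None -> M (phi w)) ->
  forall w, M (phi w).
Proof.
move=> M0 Mlin MW phiR Mnormal w.
have MZ d z : M z -> M (d *: z) by move=> Mz; rewrite -[_ *: _]addr0; apply: Mlin.
have MD z z' : M z -> M z' -> M (z + z').
  by move=> Mz Mz'; rewrite -[z]scale1r; apply: Mlin.
have [m] := ubnP (code w); elim: m w => // m IH w lt_m.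
case E : (last_redex n w) => [[[u j] v]|]; last exact: Mnormal.
have [jn wE] := last_redexP E; have [j0 _] := andP jn.
pose low t := if (code t < code (lead_word n j))%N then phi (u ++ t ++ v) else 0.
have Mlow t : M (low t).
  rewrite /low; case: ifP => // lt_t; apply: IH.
  by have := code_context u v lt_t; rewrite -wE; lia.
have Mrel : M (relation low j).
  have MN z : M z -> M (- z) by rewrite -scaleN1r; apply: MZ.
  rewrite /relation; apply: (MD); last exact/MN/MZ/MW.
  elim/big_ind: _ => // i _; apply: MZ; rewrite /wsum.
  by elim/big_ind: _.
have -> : phi w = c^-1 *: (relation (fun t => phi (u ++ t ++ v)) j + -1 *: relation low j).
  rewrite addrC -relationP relation_lead // => [|t lt_t]; last first.
    by rewrite /low lt_t scaleN1r addNr.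
  by rewrite /low ltnn scaler0 add0r scalerA mulVf // scale1r wE.
by apply/MZ/MD; [apply: phiR | apply: MZ].
Qed.

(** Functionals that kill the relations are compared on normal words. *)
Lemma relation_unique phi :
    (forall u v j, (0 < j)%N -> relation (fun t => phi (u ++ t ++ v)) j = 0) ->
    (forall w, last_redex n w = None -> phi w = 0) ->
  phi =1 (fun=> 0).
Proof.
apply: (relation_closed (M := fun z => z = 0)) => // [d z z' -> ->|z ->].
  by rewrite scaler0 addr0.
exact: linear0.
Qed.

Lemma nf_false w : nf (false :: w) = X (nf w).
Proof.
apply/eqP; rewrite -subr_eq0 -scaleN1r addrC; apply/eqP; move: w.
apply: relation_unique => [u v j j0|w nw].
  rewrite relationP relation_op // (nf_relation u) // linear0 scaler0 add0r.
  exact: (nf_relation (false :: u)).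
rewrite !nf_normal //; last exact: (last_redex_false 1 deg_g nw).
rewrite /normal_value /=; case: ifP => _; rewrite ?linear0 ?scaler0 ?addr0 //.
by rewrite scaleN1r addNr.
Qed.

Definition starts_true w := if w is b :: _ then b else true.

Lemma nf_basis w : starts_true w -> last_redex n w = None ->
  nf w = if w == e then v0 else 0.
Proof.
move=> sw nw; rewrite nf_normal // /normal_value.
by case: w sw {nw} => [|[] w].
Qed.

End NormalForm.

Section NormalFormStart.
Variables (k : fieldType) (g : {poly k}) (V : lmodType k).
Variables (X W : {linear V -> V}).
Hypotheses (g_neq0 : g != 0) (deg_g : (0 < deg g)%N).

Local Notation nf v e := (nf g X W v e).

Lemma nf_lin d v v' e w : nf (d *: v + v') e w = d *: nf v e w + nf v' e w.
Proof.
have iter_lin i : iter i X (d *: v + v') = d *: iter i X v + iter i X v'.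
  by elim: i => //= i ->; rewrite linearP.
apply/eqP; rewrite -subr_eq0 -scaleN1r addrC; apply/eqP; move: w.
apply: (relation_unique (W := W) g_neq0 deg_g) => [u w j j0|w nw].
  by rewrite !relationP !nf_relation // !scaler0 !addr0 scaler0.
rewrite !nf_normal // /normal_value; case: ifP => _; last first.
  by rewrite !scaler0 !addr0 scaler0.
by rewrite iter_lin scaleN1r addNr.
Qed.

Lemma nf_op (L : {linear V -> V}) v e w :
    (forall z, L (X z) = X (L z)) -> (forall z, L (W z) = W (L z)) ->
  nf (L v) e w = L (nf v e w).
Proof.
move=> LX LW.
have iterL i : iter i X (L v) = L (iter i X v) by elim: i => //= i ->; rewrite LX.
apply/eqP; rewrite -subr_eq0 -scaleN1r addrC; apply/eqP; move: w.
apply: (relation_unique (W := W) g_neq0 deg_g) => [u w j j0|w nw].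
  by rewrite !relationP relation_op // !nf_relation // linear0 scaler0 add0r.
rewrite !nf_normal // /normal_value; case: ifP => _; last first.
  by rewrite linear0 scaler0 addr0.
by rewrite iterL scaleN1r addNr.
Qed.

End NormalFormStart.

(** * Algebras of linear operators *)

Section FunctionSpace.
Variables (k : comNzRingType) (T : Type) (V : lmodType k).

Definition funsp : Type := T -> V.
HB.instance Definition _ := gen_eqMixin funsp.
HB.instance Definition _ := gen_choiceMixin funsp.

Implicit Types p q r : funsp.

Fact funsp_addA : associative (fun p q : funsp => (fun t => p t + q t) : funsp).
Proof. by move=> p q r; apply/funext => t; rewrite addrA. Qed.
Fact funsp_addC : commutative (fun p q : funsp => (fun t => p t + q t) : funsp).
Proof. by move=> p q; apply/funext => t; rewrite addrC. Qed.
Fact funsp_add0 : left_id ((fun=> 0) : funsp) (fun p q : funsp => (fun t => p t + q t) : funsp).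
Proof. by move=> p; apply/funext => t; rewrite add0r. Qed.
Fact funsp_addN : left_inverse ((fun=> 0) : funsp) (fun p : funsp => (fun t => - p t) : funsp)
  (fun p q : funsp => (fun t => p t + q t) : funsp).
Proof. by move=> p; apply/funext => t; rewrite addNr. Qed.
HB.instance Definition _ :=
  GRing.isZmodule.Build funsp funsp_addA funsp_addC funsp_add0 funsp_addN.

Definition funsp_scale (c : k) p : funsp := fun t => c *: p t.
Fact funsp_scaleA c d p : funsp_scale c (funsp_scale d p) = funsp_scale (c * d) p.
Proof. by apply/funext => t; apply: scalerA. Qed.
Fact funsp_scale1 : left_id 1 funsp_scale.
Proof. by move=> p; apply/funext => t; apply: scale1r. Qed.
Fact funsp_scaleDr : right_distributive funsp_scale +%R.
Proof. by move=> c p q; apply/funext => t; apply: scalerDr. Qed.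
Fact funsp_scaleDl p : {morph funsp_scale^~ p : c d / c + d}.
Proof. by move=> c d; apply/funext => t; apply: scalerDl. Qed.
HB.instance Definition _ := GRing.Zmodule_isLmodule.Build k funsp
  funsp_scaleA funsp_scale1 funsp_scaleDr funsp_scaleDl.

Lemma funspDE p q t : (p + q) t = p t + q t. Proof. by []. Qed.
Lemma funspZE c p t : (c *: p) t = c *: p t. Proof. by []. Qed.
Lemma funsp0E t : (0 : funsp) t = 0. Proof. by []. Qed.

End FunctionSpace.

Section AlgebraModule.
Variables (k : comNzRingType) (A : pzAlgType k).

Definition algmod : Type := A.
HB.instance Definition _ := GRing.Zmodule.on algmod.

Definition algmod_scale (c : k) (u : algmod) : algmod := c%:K * (u : A).
Fact algmod_scaleA c d u : algmod_scale c (algmod_scale d u) = algmod_scale (c * d) u.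
Proof. by rewrite /algmod_scale mulrA algCM. Qed.
Fact algmod_scale1 : left_id 1 algmod_scale.
Proof. by move=> u; rewrite /algmod_scale algC1 mul1r. Qed.
Fact algmod_scaleDr : right_distributive algmod_scale +%R.
Proof. by move=> c u v; apply: mulrDr. Qed.
Fact algmod_scaleDl u : {morph algmod_scale^~ u : c d / c + d}.
Proof. by move=> c d; rewrite /algmod_scale algCD mulrDl. Qed.
HB.instance Definition _ := GRing.Zmodule_isLmodule.Build k algmod
  algmod_scaleA algmod_scale1 algmod_scaleDr algmod_scaleDl.

End AlgebraModule.

Section Operators.
Variables (k : comNzRingType) (V : lmodType k).

Definition oper : Type := {F : V -> V | `[< linear F >]}.
HB.instance Definition _ := gen_eqMixin oper.
HB.instance Definition _ := gen_choiceMixin oper.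

Definition oper_fun (F : oper) : V -> V := sval F.
Coercion oper_fun : oper >-> Funclass.

Definition mkoper (F : V -> V) (lF : linear F) : oper := exist _ F (asboolT lF).

Lemma operP (F G : oper) : F =1 G -> F = G.
Proof.
case: F G => [F lF] [G lG] /= /funext FG.
by move: lF lG; rewrite /oper_fun /= in FG; rewrite FG => lF lG; congr exist; apply: bool_irrelevance.
Qed.

Lemma oper_linear (F : oper) : linear F.
Proof. by case: F => F /= lF; apply/asboolP. Qed.

Lemma operD (F : oper) : {morph F : u v / u + v}.
Proof. by move=> u v; rewrite -[u in LHS]scale1r oper_linear scale1r. Qed.

Lemma oper0 (F : oper) : F 0 = 0.
Proof. exact: morph0 (operD F). Qed.

Lemma operZ (F : oper) c u : F (c *: u) = c *: F u.
Proof. by rewrite -[c *: u]addr0 oper_linear oper0 addr0. Qed.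

Fact oper_add_linear (F G : oper) : linear (fun v => F v + G v).
Proof. by move=> c u v; rewrite !oper_linear scalerDr addrACA. Qed.
Fact oper_zero_linear : linear (fun _ : V => 0 : V).
Proof. by move=> c u v; rewrite scaler0 addr0. Qed.
Fact oper_opp_linear (F : oper) : linear (fun v => - F v).
Proof. by move=> c u v; rewrite oper_linear opprD scalerN. Qed.
Fact oper_comp_linear (F G : oper) : linear (fun v => F (G v)).
Proof. by move=> c u v; rewrite !oper_linear. Qed.
Fact oper_one_linear : linear (fun v : V => v).
Proof. by []. Qed.
Fact oper_scalar_linear (c : k) : linear (fun v : V => c *: v).
Proof. by move=> d u v; rewrite scalerDr !scalerA mulrC. Qed.

Definition oper_add F G := mkoper (oper_add_linear F G).
Definition oper_zero := mkoper oper_zero_linear.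
Definition oper_opp F := mkoper (oper_opp_linear F).
Definition oper_mul F G := mkoper (oper_comp_linear F G).
Definition oper_one := mkoper oper_one_linear.
Definition oper_scalar c := mkoper (oper_scalar_linear c).

Fact oper_addA : associative oper_add.
Proof. by move=> F G K; apply: operP => v; apply: addrA. Qed.
Fact oper_addC : commutative oper_add.
Proof. by move=> F G; apply: operP => v; apply: addrC. Qed.
Fact oper_add0 : left_id oper_zero oper_add.
Proof. by move=> F; apply: operP => v; apply: add0r. Qed.
Fact oper_addN : left_inverse oper_zero oper_opp oper_add.
Proof. by move=> F; apply: operP => v; apply: addNr. Qed.
HB.instance Definition _ :=
  GRing.isZmodule.Build oper oper_addA oper_addC oper_add0 oper_addN.

Fact oper_mulA : associative oper_mul.
Proof. by move=> F G K; apply: operP. Qed.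
Fact oper_mul1l : left_id oper_one oper_mul.
Proof. by move=> F; apply: operP. Qed.
Fact oper_mul1r : right_id oper_one oper_mul.
Proof. by move=> F; apply: operP. Qed.
Fact oper_mulDl : left_distributive oper_mul +%R.
Proof. by move=> F G K; apply: operP. Qed.
Fact oper_mulDr : right_distributive oper_mul +%R.
Proof. by move=> F G K; apply: operP => v; apply: (operD F). Qed.
HB.instance Definition _ := GRing.Zmodule_isPzRing.Build oper
  oper_mulA oper_mul1l oper_mul1r oper_mulDl oper_mulDr.

Fact oper_scalar1 : oper_scalar 1 = 1.
Proof. by apply: operP => v; apply: scale1r. Qed.
Fact oper_scalarD : {morph oper_scalar : c d / c + d}.
Proof. by move=> c d; apply: operP => v; apply: scalerDl. Qed.
Fact oper_scalarM : {morph oper_scalar : c d / c * d}.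
Proof. by move=> c d; apply: operP => v; apply: esym; apply: scalerA. Qed.
Fact oper_scalarC c F : GRing.comm (oper_scalar c) F.
Proof. by apply: operP => v; apply: esym; apply: (operZ F). Qed.
HB.instance Definition _ := @PzRing_isPzAlgebra.Build k oper oper_scalar
  oper_scalar1 oper_scalarD oper_scalarM oper_scalarC.

Lemma operDE (F G : oper) v : oper_fun (F + G) v = F v + G v. Proof. by []. Qed.
Lemma operME (F G : oper) v : oper_fun (F * G) v = F (G v). Proof. by []. Qed.
Lemma oper1E v : oper_fun 1 v = v. Proof. by []. Qed.
Lemma operKE (c : k) v : oper_fun c%:K v = c *: v. Proof. by []. Qed.

Lemma oper_sumE I (r : seq I) (F : I -> oper) v :
  oper_fun (\sum_(i <- r) F i) v = \sum_(i <- r) F i v.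
Proof.
by elim: r => [|i r IH]; rewrite ?big_nil // !big_cons operDE IH.
Qed.

End Operators.

(** * The module of functionals *)

Section FunctionalModule.
Variables (k : fieldType) (g f : {poly k}) (V : lmodType k).
Variables (X Y W W' : {linear V -> V}).
Hypotheses (XW : forall z, X (W z) = W (X z)) (YW : forall z, Y (W z) = W (Y z))
  (XY : forall z, X (Y z) = Y (X z))
  (XW' : forall z, X (W' z) = W' (X z)) (YW' : forall z, Y (W' z) = W' (Y z))
  (WK : cancel W W') (W'K : cancel W' W).
Hypotheses (g_neq0 : g != 0) (deg_g : (1 < deg g)%N)
  (f_neq0 : f != 0) (deg_f : (1 < deg f)%N).
Hypothesis gXfY : forall z : V, \sum_(i < size g) g`_i *: iter i X z
                         = \sum_(i < size f) f`_i *: iter i Y z.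

Local Notation word := (seq bool).
Local Notation F := (funsp (word * word) V).

(** Functionals on pairs of words that kill the relations of A(x,a,g) in the
    first word and those of A(y,b,f) in the second one, where a^n and b^m act
    as W, and that are linear over the letters x and y on the left. *)
Definition functional_axioms (p : F) : Prop :=
  [/\ forall u u' v j, (0 < j)%N -> relation g W (fun t => p (u ++ t ++ u', v)) j = 0,
      forall u v v' j, (0 < j)%N -> relation f W (fun t => p (u, v ++ t ++ v')) j = 0,
      forall u v, p (false :: u, v) = X (p (u, v))
    & forall u v, p (u, false :: v) = Y (p (u, v))].

Definition functional_pred : pred F := fun p => `[< functional_axioms p >].

Fact functional_submod : submod_closed functional_pred.
Proof.
split=> [|c p q /asboolP[p1 p2 p3 p4] /asboolP[q1 q2 q3 q4]]; apply/asboolP.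
  by split=> *; rewrite ?relation_eq0 ?funsp0E ?linear0.
split=> [u u' v j j0|u v v' j j0|u v|u v]; rewrite ?funspDE ?funspZE.
- by rewrite relationP p1 // q1 // scaler0 addr0.
- by rewrite relationP p2 // q2 // scaler0 addr0.
- by rewrite p3 q3 linearP.
by rewrite p4 q4 linearP.
Qed.

Definition functional : Type := {p : F | functional_pred p}.
HB.instance Definition _ := SubChoice.on functional.
HB.instance Definition _ := GRing.SubChoice_isSubLmodule.Build k F functional_pred
  functional functional_submod.

Lemma functionalP (p : functional) : functional_axioms (val p).
Proof. by apply/asboolP; case: p. Qed.

(** All six generators of A(g, f) act by maps of this form. *)
Section Translation.
Variables (s s' : word) (L : {linear V -> V}).
Hypotheses (LX : forall z, L (X z) = X (L z)) (LY : forall z, L (Y z) = Y (L z))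
  (LW : forall z, L (W z) = W (L z)).

Definition trans_fun (p : F) : F := fun uv => L (p (uv.1 ++ s, uv.2 ++ s')).

Fact trans_axioms (p : functional) : functional_pred (trans_fun (val p)).
Proof.
have [p1 p2 p3 p4] := functionalP p; apply/asboolP.
split=> [u u' v j j0|u v v' j j0|u v|u v]; rewrite /trans_fun /=.
- rewrite relation_op // -[RHS](linear0 L) -(p1 u (u' ++ s) (v ++ s') j j0).
  by congr (L _); apply: eq_relation => t; rewrite -!catA.
- rewrite relation_op // -[RHS](linear0 L) -(p2 (u ++ s) v (v' ++ s') j j0).
  by congr (L _); apply: eq_relation => t; rewrite -!catA.
- by rewrite p3 LX.
by rewrite p4 LY.
Qed.

Definition trans_sub (p : functional) : functional := exist (fun q : F => functional_pred q) _ (trans_axioms p).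

Fact trans_linear : linear trans_sub.
Proof.
by move=> c p q; apply: val_inj; apply/funext => uv; apply: (linearP L).
Qed.

Definition trans : oper functional := mkoper trans_linear.

Lemma transE p u v : val (trans p) (u, v) = L (val p (u ++ s, v ++ s')).
Proof. by []. Qed.

End Translation.

Let idC (L : {linear V -> V}) z : idfun (L z) = L (idfun z). Proof. by []. Qed.

Definition op_letter b := trans [:: b] [::] (idC X) (idC Y) (idC W).
Definition op_letter' b := trans [::] [:: b] (idC X) (idC Y) (idC W).
Let W'X z : W' (X z) = X (W' z) := esym (XW' z).
Let W'Y z : W' (Y z) = Y (W' z) := esym (YW' z).
Let W'W z : W' (W z) = W (W' z). Proof. by rewrite WK W'K. Qed.
Definition op_ainv := trans (nseq (deg g).-1 true) [::] W'X W'Y W'W.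
Definition op_binv := trans [::] (nseq (deg f).-1 true) W'X W'Y W'W.

Lemma functional_eq (p q : functional) :
  (forall u v, val p (u, v) = val q (u, v)) -> p = q.
Proof. by move=> pq; apply: val_inj; apply/funext => -[]. Qed.

Lemma op_wprod w p u v :
  val (oper_fun (wprod (op_letter true) (op_letter false) w) p) (u, v)
    = val p (u ++ w, v).
Proof.
elim: w u => [|b w IH] u; first by rewrite /wprod big_nil oper1E cats0.
rewrite wprod_cons operME; transitivity (val (oper_fun (op_letter b)
    (oper_fun (wprod (op_letter true) (op_letter false) w) p)) (u, v)).
  by case: b.
by rewrite transE /= cats0 IH -catA.
Qed.

Lemma op_wprod' w p u v :
  val (oper_fun (wprod (op_letter' true) (op_letter' false) w) p) (u, v)
    = val p (u, v ++ w).
Proof.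
elim: w v => [|b w IH] v; first by rewrite /wprod big_nil oper1E cats0.
rewrite wprod_cons operME; transitivity (val (oper_fun (op_letter' b)
    (oper_fun (wprod (op_letter' true) (op_letter' false) w) p)) (u, v)).
  by case: b.
by rewrite transE /= cats0 IH -catA.
Qed.

Lemma functional_sumE I (r : seq I) (p : I -> functional) u v :
  val (\sum_(i <- r) p i) (u, v) = \sum_(i <- r) val (p i) (u, v).
Proof. by elim: r => [|i r IH]; rewrite ?big_nil // !big_cons /= -IH. Qed.

Lemma functionalZE (c : k) (p : functional) u v :
  val (c *: p) (u, v) = c *: val p (u, v).
Proof. by []. Qed.

Lemma op_gcoef (h : {poly k}) j p u v :
  val (oper_fun (gcoef h (op_letter true) (op_letter false) j) p) (u, v)
    = \sum_(i < size h) h`_i *: wsum (fun t => val p (u ++ t, v)) i j.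
Proof.
rewrite /gcoef oper_sumE functional_sumE; apply: eq_bigr => i _.
rewrite operME operKE functionalZE /Q /wsum oper_sumE functional_sumE.
by congr (_ *: _); apply: eq_bigr => w _; rewrite op_wprod.
Qed.

Lemma op_gcoef' (h : {poly k}) j p u v :
  val (oper_fun (gcoef h (op_letter' true) (op_letter' false) j) p) (u, v)
    = \sum_(i < size h) h`_i *: wsum (fun t => val p (u, v ++ t)) i j.
Proof.
rewrite /gcoef oper_sumE functional_sumE; apply: eq_bigr => i _.
rewrite operME operKE functionalZE /Q /wsum oper_sumE functional_sumE.
by congr (_ *: _); apply: eq_bigr => w _; rewrite op_wprod'.
Qed.

Lemma wprod_nseq (R : pzRingType) (a x : R) i : wprod a x (nseq i true) = a ^+ i.
Proof.
by elim: i => [|i IH]; rewrite /= ?wprod_cons ?IH ?exprS // /wprod big_nil.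
Qed.

Lemma relation_an (h : {poly k}) (phi : word -> V) : h != 0 ->
  relation h W phi (deg h) = 0 -> phi (nseq (deg h) true) = W (phi [::]).
Proof.
move=> h0; have lh : h`_(deg h) != 0 by rewrite -lead_coefE lead_coef_eq0.
have sh : size h = (deg h).+1 by rewrite /deg prednK // size_poly_gt0.
rewrite /relation sh big_ord_recr /= big1 ?add0r => [|i _]; last first.
  by rewrite wsum_small ?scaler0.
move/eqP; rewrite subr_eq0 => /eqP /(scalerI lh) <-; rewrite /wsum.
have tw : nseq (deg h) true \in words (deg h) (deg h).
  by rewrite mem_words size_nseq count_nseq /= mul1n !eqxx.
rewrite (bigD1_seq _ tw (words_uniq _ _)) /= big_seq_cond big1 ?addr0 // => t.
case/andP; rewrite mem_words => /andP[/eqP st /eqP ct] /eqP[].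
have : all (pred1 true) t by rewrite all_count ct st.
by move/all_pred1P; rewrite st.
Qed.

Lemma op_an p u v :
  val (oper_fun (op_letter true ^+ deg g) p) (u, v) = W (val p (u, v)).
Proof.
rewrite -(wprod_nseq _ (op_letter false)) op_wprod; have [p1 _ _ _] := functionalP p.
have R : relation g W (fun t => val p (u ++ t, v)) (deg g) = 0.
  rewrite -[RHS](p1 u [::] v (deg g)); last exact: ltnW.
  by apply: eq_relation => t; rewrite cats0.
by rewrite (relation_an g_neq0 R) cats0.
Qed.

Lemma op_bm p u v :
  val (oper_fun (op_letter' true ^+ deg f) p) (u, v) = W (val p (u, v)).
Proof.
rewrite -(wprod_nseq _ (op_letter' false)) op_wprod'; have [_ p2 _ _] := functionalP p.
have R : relation f W (fun t => val p (u, v ++ t)) (deg f) = 0.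
  rewrite -[RHS](p2 u v [::] (deg f)); last exact: ltnW.
  by apply: eq_relation => t; rewrite cats0.
by rewrite (relation_an f_neq0 R) cats0.
Qed.

Lemma functional_Axag : Axag_data g (op_letter false) (op_letter true) op_ainv.
Proof.
have pg : (deg g).-1.+1 = deg g by apply: prednK; apply: ltnW.
have Wn (p : functional) u v : val p (u ++ nseq (deg g) true, v) = W (val p (u, v)).
  by rewrite -op_an -(wprod_nseq _ (op_letter false)) op_wprod.
apply/(Axag_dataP g_neq0); split.
- apply: operP => p; apply: functional_eq => u v.
  rewrite operME oper1E !transE /= !cats0 -catA.
  by rewrite -[[:: true] ++ _]/(nseq (deg g).-1.+1 true) pg Wn WK.
- apply: operP => p; apply: functional_eq => u v.
  rewrite operME oper1E !transE /= !cats0 -catA.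
  by rewrite -[[:: true]]/(nseq 1 true) -nseqD addn1 pg Wn WK.
move=> j j0; apply: operP => p; apply: functional_eq => u v.
rewrite op_gcoef operME operKE functionalZE op_an.
have [p1 _ _ _] := functionalP p; apply/eqP; rewrite -subr_eq0; apply/eqP.
rewrite -[RHS](p1 u [::] v j j0) /relation !cats0; congr (_ - _).
by apply: eq_bigr => i _; congr (_ *: _); apply: eq_bigr => t _; rewrite cats0.
Qed.

Lemma functional_Axbf : Axag_data f (op_letter' false) (op_letter' true) op_binv.
Proof.
have pf : (deg f).-1.+1 = deg f by apply: prednK; apply: ltnW.
have Wn (p : functional) u v : val p (u, v ++ nseq (deg f) true) = W (val p (u, v)).
  by rewrite -op_bm -(wprod_nseq _ (op_letter' false)) op_wprod'.
apply/(Axag_dataP f_neq0); split.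
- apply: operP => p; apply: functional_eq => u v.
  rewrite operME oper1E !transE /= !cats0 -catA.
  by rewrite -[[:: true] ++ _]/(nseq (deg f).-1.+1 true) pf Wn WK.
- apply: operP => p; apply: functional_eq => u v.
  rewrite operME oper1E !transE /= !cats0 -catA.
  by rewrite -[[:: true]]/(nseq 1 true) -nseqD addn1 pf Wn WK.
move=> j j0; apply: operP => p; apply: functional_eq => u v.
rewrite op_gcoef' operME operKE functionalZE op_bm.
have [_ p2 _ _] := functionalP p; apply/eqP; rewrite -subr_eq0; apply/eqP.
rewrite -[RHS](p2 u v [::] j j0) /relation !cats0; congr (_ - _).
by apply: eq_bigr => i _; congr (_ *: _); apply: eq_bigr => t _; rewrite cats0.
Qed.

Lemma functional_x_iter (p : functional) i (u v : word) : val p (nseq i false ++ u, v) = iter i X (val p (u, v)).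
Proof.
have [_ _ p3 _] := functionalP p.
by elim: i => //= i <-; rewrite p3.
Qed.

Lemma functional_y_iter (p : functional) i (u v : word) : val p (u, nseq i false ++ v) = iter i Y (val p (u, v)).
Proof.
have [_ _ _ p4] := functionalP p.
by elim: i => //= i <-; rewrite p4.
Qed.

Lemma comm_wprod (R : pzRingType) (z a x : R) w :
  GRing.comm z x -> GRing.comm z a -> GRing.comm z (wprod a x w).
Proof.
move=> zx za; rewrite /wprod; elim/big_ind: _ => [|y1 y2|b _]; first exact: commr1.
  exact: commrM.
by case: b.
Qed.

Lemma wsum_col0 (phi : word -> V) i : wsum phi i 0 = phi (nseq i false).
Proof. by elim: i phi => [|i IH] phi; rewrite ?wsum00 // wsumS0 IH. Qed.

(** g(x) is central, so its right translation may be moved to the left, where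
    it acts through X. *)
Lemma op_peval p u v : val (oper_fun (peval g (op_letter false)) p) (u, v)
  = \sum_(i < size g) g`_i *: iter i X (val p (u, v)).
Proof.
have dx := functional_Axag.
have gc : GRing.comm (peval g (op_letter false)) (wprod (op_letter true) (op_letter false) u).
  by apply: comm_wprod; [exact: Axag_gx_x | exact: (Axag_gx_a g_neq0 dx deg_g)].
rewrite -[u]cat0s -op_wprod -operME -gc operME -(gcoef0 g (op_letter true)) op_gcoef.
apply: eq_bigr => i _; congr (_ *: _); rewrite wsum_col0 /=.
by rewrite -[nseq i false]cats0 functional_x_iter op_wprod.
Qed.

Lemma op_peval' p u v : val (oper_fun (peval f (op_letter' false)) p) (u, v)
  = \sum_(i < size f) f`_i *: iter i Y (val p (u, v)).
Proof.
have dy := functional_Axbf.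
have fc : GRing.comm (peval f (op_letter' false)) (wprod (op_letter' true) (op_letter' false) v).
  by apply: comm_wprod; [exact: Axag_gx_x | exact: (Axag_gx_a f_neq0 dy deg_f)].
rewrite -[v]cat0s -op_wprod' -operME -fc operME -(gcoef0 f (op_letter' true)) op_gcoef'.
apply: eq_bigr => i _; congr (_ *: _); rewrite wsum_col0 /=.
by rewrite -[nseq i false]cats0 functional_y_iter op_wprod'.
Qed.

Lemma functional_Agf : Agf_data g f
  (op_letter false) (op_letter true) op_ainv
  (op_letter' false) (op_letter' true) op_binv.
Proof.
split; [exact: functional_Axag | exact: functional_Axbf | | |].
- move=> A B; rewrite !inE => /or3P[] /eqP -> /or3P[] /eqP ->;
  apply: operP => p; apply: functional_eq => u v;
  by rewrite !operME !transE /= ?cats0.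
- by apply: operP => p; apply: functional_eq => u v; rewrite op_an op_bm.
apply: operP => p; apply: functional_eq => u v.
by rewrite op_peval op_peval' gXfY.
Qed.

Section Coordinate.
Variables (v0 : V) (e e' : word).

Definition nf2 : F := fun uv => nf g X W (nf f Y W v0 e' uv.2) e uv.1.

Fact nf2_axioms : functional_pred nf2.
Proof.
have [g1 f1] := (ltnW deg_g, ltnW deg_f).
apply/asboolP; split=> [u u' v j j0|u v v' j j0|u v|u v]; rewrite /nf2 /=.
- exact: nf_relation.
- have lin : linear (fun z => nf g X W z e u) by move=> d z z'; apply: nf_lin.
  pose L : {linear V -> V} := HB.pack (fun z => nf g X W z e u)
    (GRing.isLinear.Build k V V _ _ lin).
  have LW z : L (W z) = W (L z) by apply: nf_op.
  apply: etrans (relation_op (L := L) _ _ _ LW) _.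
  by rewrite nf_relation // linear0.
- exact: nf_false.
rewrite nf_false //.
by apply: nf_op => // z; rewrite XY.
Qed.

Definition nf2_functional : functional :=
  exist (fun q : F => functional_pred q) nf2 nf2_axioms.

Variables (H : pzAlgType k) (x a a' y b b' : H).
Hypothesis U : Agf_universal g f x a a' y b b'.

(** Coordinate functions: H acts on the functionals, and the action of h on the
    normal form functional is evaluated at the empty words. *)
Lemma coordinate_exists : exists kappa : H -> V,
  [/\ forall c h h', kappa (c%:K * h + h') = c *: kappa h + kappa h',
      forall h, kappa (x * h) = X (kappa h), forall h, kappa (y * h) = Y (kappa h),
      forall h, kappa (a ^+ deg g * h) = W (kappa h)
    & forall u v, kappa (wprod a x u * wprod b y v) = nf2 (u, v)].
Proof.
have [R hR [[Rx Ra _] [Ry Rb _]]] := univ_lift U functional_Agf.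
have [RD RM RK] := hR.
exists (fun h => val (oper_fun (R h) nf2_functional) ([::], [::])).
split=> [c h h'|h|h|h|u v].
- by rewrite RD (alghomZ _ _ hR) operDE operME operKE.
- rewrite RM operME Rx transE.
  by have [_ _ p3 _] := functionalP (oper_fun (R h) nf2_functional); apply: p3.
- rewrite RM operME Ry transE.
  by have [_ _ _ p4] := functionalP (oper_fun (R h) nf2_functional); apply: p4.
- by rewrite RM (alghomX _ hR) Ra operME op_an.
have Rw c z w : R (wprod c z w) = wprod (R c) (R z) w.
  by rewrite /wprod (alghom_prod hR); apply: eq_bigr => -[].
by rewrite RM operME !Rw Ra Rx Rb Ry op_wprod op_wprod'.
Qed.

End Coordinate.

End FunctionalModule.

(** * A basis of A(g, f) over the coordinate ring *)

Section Freeness.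
Variables (k : fieldType) (g f : {poly k}).
Hypotheses (g_neq0 : g != 0) (deg_g : (1 < deg g)%N)
  (f_neq0 : f != 0) (deg_f : (1 < deg f)%N).
Variables (H : pzAlgType k) (x a a' y b b' : H).
Hypothesis U : Agf_universal g f x a a' y b b'.
Variables (O : pzAlgType k) (ox oy : O).
Hypotheses (O_comm : forall u v : O, GRing.comm u v)
  (O_gen : generated (fun z => z = ox \/ z = oy))
  (O_gf : peval g ox = peval f oy).
Variable phi : O -> H.
Hypotheses (phi_hom : alghom phi) (phix : phi ox = x) (phiy : phi oy = y).

Local Notation word := (seq bool).
Local Notation V := (funsp int (algmod O)).

(** The module of functions from the integers to O is O[w, w^-1], completed;
    x and y multiply by the coordinate functions and w shifts. *)
Definition mulop (o : O) (p : V) : V := fun i => (o : O) * (p i : O).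
Definition shift (d : int) (p : V) : V := fun i => p (i - d).

Fact mulop_linear o : linear (mulop o).
Proof.
move=> c p q; apply/funext => i; rewrite /mulop /=.
by apply: etrans (mulrDr _ _ _) _; congr (_ + _); rewrite [LHS]mulrA -(algCC c o) -mulrA.
Qed.

Fact shift_linear d : linear (shift d).
Proof. by []. Qed.

Definition mulopL o : {linear V -> V} :=
  HB.pack (mulop o) (GRing.isLinear.Build k V V _ _ (mulop_linear o)).
Definition shiftL d : {linear V -> V} :=
  HB.pack (shift d) (GRing.isLinear.Build k V V _ _ (shift_linear d)).

Fact mulop_peval (p : {poly k}) o (z : V) :
  \sum_(i < size p) p`_i *: iter i (mulopL o) z = mulop (peval p o) z.
Proof.
apply/funext => j; have iterE i : iter i (mulopL o) z j = o ^+ i * (z j : O).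
  by elim: i => [|i IH]; rewrite ?mul1r // exprS -mulrA -IH.
transitivity (\sum_(i < size p) (p`_i)%:K * (o ^+ i * (z j : O)) : O).
  have sumE (I : Type) (r : seq I) (q : I -> V) : (\sum_(i <- r) q i) j = \sum_(i <- r) q i j.
    by elim: r => [|i r IH]; rewrite ?big_nil // !big_cons funspDE IH.
  rewrite sumE; apply: eq_bigr => i _; rewrite funspZE iterE; by [].
by rewrite /mulop /peval mulr_suml; apply: eq_bigr => i _; rewrite mulrA.
Qed.

Definition delta0 : V := fun i => (i == 0)%:R.

Definition wpow (i : int) : H :=
  match i with
  | Posz m => (a ^+ deg g) ^+ m
  | Negz m => (a' ^+ deg g) ^+ m.+1
  end.

(** A power of w = a^n times a normal word in a and x and a normal word in b and
    y; neither word starts with x or y, as these letters belong to O. *)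
Definition basis (I : word * word * int) : H :=
  wpow I.2 * (wprod a x I.1.1 * wprod b y I.1.2).

Definition admissible (I : word * word * int) : bool :=
  [&& starts_true I.1.1, ~~ isSome (last_redex (deg g) I.1.1),
      starts_true I.1.2 & ~~ isSome (last_redex (deg f) I.1.2)].

Let dx : Axag_data g x a a'. Proof. by case: U => -[]. Qed.
Let dy : Axag_data f y b b'. Proof. by case: U => -[]. Qed.
Let av : a * a' = 1. Proof. by case: dx. Qed.
Let va : a' * a = 1. Proof. by case: dx. Qed.
Let aw' : a ^+ deg g * a' ^+ deg g = 1. Proof. exact: expr_inverse. Qed.
Let w'a : a' ^+ deg g * a ^+ deg g = 1. Proof. exact: expr_inverse. Qed.

(** Together with [spanned_all]: H is a free left module over O. *)
Lemma coordinates_exist : exists coord : word * word * int -> H -> O,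
  [/\ forall I, {morph coord I : h h' / h + h'},
      forall I o h, coord I (phi o * h) = o * coord I h
    & forall I J, admissible J -> coord I (basis J) = (I == J)%:R].
Proof.
have sC d d' z : shift d (shift d' z) = shift d' (shift d z).
  by apply/funext => i; rewrite /shift addrAC.
have sK d z : shift d (shift (- d) z) = z.
  by apply/funext => i; rewrite /shift opprK subrK.
have sK' d z : shift (- d) (shift d z) = z.
  by apply/funext => i; rewrite /shift opprK addrK.
have gXfY z : \sum_(i < size g) g`_i *: iter i (mulopL ox) z
    = \sum_(i < size f) f`_i *: iter i (mulopL oy) z.
  by rewrite !mulop_peval O_gf.
have XY z : mulop ox (mulop oy z) = mulop oy (mulop ox z).
  by apply/funext => i; rewrite /mulop !mulrA (O_comm ox).
have ex I := @coordinate_exists k g f V (mulopL ox) (mulopL oy) (shiftL 1) (shiftL (-1))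
  (fun z => erefl) (fun z => erefl) XY (fun z => erefl) (fun z => erefl)
  (sK' 1) (sK 1) g_neq0 deg_g f_neq0 deg_f gXfY delta0 I.1 I.2 H x a a' y b b' U.
have [kappa kappaP] := choice ex.
exists (fun I h => kappa I.1 h I.2); split=> [[e i] h h' /=|[e i] o h /=|[[e e'] i] [[u v] j] /=].
- have [lin _ _ _ _] := kappaP e.
  by have := lin 1 h h'; rewrite algC1 mul1r scale1r => ->.
- have [lin kx ky _ _] := kappaP e; have [pD pM pK] := phi_hom.
  have kD h1 h2 : kappa e (h1 + h2) = kappa e h1 + kappa e h2.
    by have := lin 1 h1 h2; rewrite algC1 mul1r scale1r.
  move: h; move: o; apply: O_gen => [|o [] -> h]; last 2 first.
  + by rewrite phix kx.
  + by rewrite phiy ky.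
  apply: subalgebraI => [c h|o1 o2 E1 E2 h|o1 o2 E1 E2 h].
  + by rewrite pK -[c%:K * h]addr0 lin (morph0 kD) addr0.
  + by rewrite pD mulrDl kD funspDE E1 E2 mulrDl.
  by rewrite pM -mulrA E1 E2 mulrA.
have [lin _ _ kw kuv] := kappaP (e, e').
case/and4P=> /= su nu sv nv.
have kw' h : kappa (e, e') (a' ^+ deg g * h) = shift (-1) (kappa (e, e') h).
  by rewrite -[h in RHS]mul1r -aw' -mulrA kw /= sK'.
have kpow (m : int) h : kappa (e, e') (wpow m * h) = shift m (kappa (e, e') h).
  case: m => m /=.
    elim: m => [|m IH]; first by rewrite mul1r; apply/funext => l; rewrite /shift subr0.
    rewrite exprS -mulrA kw IH; apply/funext => l /=; rewrite /shift /=.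
    by congr (kappa _ _ _); lia.
  rewrite NegzE; elim: m => [|m IH]; first by rewrite expr1 kw'.
  rewrite exprS -mulrA kw' IH; apply/funext => l; rewrite /shift.
  by congr (kappa _ _ _); lia.
rewrite /basis /= kpow kuv /nf2 /=.
have {}nu : last_redex (deg g) u = None by case: last_redex nu.
have {}nv : last_redex (deg f) v = None by case: last_redex nv.
rewrite !nf_basis //.
rewrite !xpair_eqE (eq_sym e) (eq_sym e').
case: eqP => _ //=; case: eqP => _ //=.
rewrite /shift /delta0 subr_eq0; by [].
Qed.

Inductive spanned : H -> Prop :=
| spanned0 : spanned 0
| spannedD h h' of spanned h & spanned h' : spanned (h + h')
| spanned_basis o I of admissible I : spanned (phi o * basis I).

Lemma spannedM_phi o h : spanned h -> spanned (phi o * h).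
Proof.
have [_ pM _] := phi_hom.
elim=> {h} [|h h' _ IH _ IH'|o' I adm].
- by rewrite mulr0; apply: spanned0.
- by rewrite mulrDr; apply: spannedD.
by rewrite mulrA -pM; apply: spanned_basis.
Qed.

Let w_comm : forall h, GRing.comm (a ^+ deg g) h.
Proof.
have [[_ _ comm ab _] gen _] := U.
apply: gen => [|z [] [] ->].
- by apply: subalgebraI => [c|u v|u v]; [apply/commr_sym/algCC | exact: commrD | exact: commrM].
- exact: (Axag_an_x g_neq0 dx deg_g).
- exact/commr_sym/commrX.
- by apply/commr_sym/commrX; rewrite /GRing.comm av va.
- by rewrite ab; apply: (Axag_an_x f_neq0 dy deg_f).
- by rewrite ab; apply/commr_sym/commrX.
rewrite ab; apply/commr_sym/commrX; have [bv vb _] := dy.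
by rewrite /GRing.comm bv vb.
Qed.

Let w'_comm h : GRing.comm (a' ^+ deg g) h.
Proof.
rewrite /GRing.comm -[LHS]mulr1 -aw' !mulrA -[_ * h * _]mulrA -w_comm.
by rewrite !mulrA w'a mul1r.
Qed.

Lemma wpowS i : a ^+ deg g * wpow i = wpow (i + 1).
Proof.
case: i => [m|[|m]]; first by rewrite /= -exprS addn1.
  by rewrite /= expr1 aw'.
have -> : Negz m.+1 + 1 = Negz m by rewrite !NegzE; lia.
by rewrite /= exprS mulrA aw' mul1r.
Qed.

Lemma wpowP i : a' ^+ deg g * wpow i = wpow (i - 1).
Proof. by rewrite -{1}[i](subrK 1) -wpowS mulrA w'a mul1r. Qed.

Lemma spanned_w h : spanned h -> spanned (a ^+ deg g * h) /\ spanned (a' ^+ deg g * h).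
Proof.
elim=> {h} [|h h' _ [IH1 IH2] _ [IH1' IH2']|o [e i] adm].
- by rewrite !mulr0; split; apply: spanned0.
- by rewrite !mulrDr; split; apply: spannedD.
rewrite !mulrA (w_comm (phi o)) (w'_comm (phi o)) -!mulrA /basis /=.
rewrite !(mulrA _ (wpow i)) wpowS wpowP.
by split; [apply: (spanned_basis o (I := (e, i + 1))) | apply: (spanned_basis o (I := (e, i - 1)))].
Qed.

Lemma comm_xy_words u v : GRing.comm (wprod a x u) (wprod b y v).
Proof.
have comm : forall c d, c \in [:: x; a; a'] -> d \in [:: y; b; b'] -> GRing.comm c d.
  by case: U => -[].
apply: comm_wprod; apply/commr_sym/comm_wprod; apply/commr_sym/comm;
  by rewrite !inE eqxx ?orbT.
Qed.

Definition lmult (w : H) (h : algmod H) : algmod H := w * (h : H).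

Fact lmult_linear w : linear (lmult w).
Proof.
move=> c h h'; apply: etrans (mulrDr _ _ _) _; congr (_ + _).
by rewrite [LHS]mulrA -(algCC c w) -mulrA.
Qed.

Definition multL w : {linear (algmod H) -> (algmod H)} :=
  HB.pack (lmult w) (GRing.isLinear.Build k (algmod H) (algmod H) _ _ (lmult_linear w)).

Let spanned_Z (c : k) h : spanned h -> spanned (c%:K * h).
Proof. by have [_ _ pK] := phi_hom; rewrite -pK; apply: spannedM_phi. Qed.

Lemma relation_words (h : {poly k}) (A z B C : H) j : h != 0 ->
    gcoef h A z j = (h`_j)%:K * a ^+ deg g ->
  relation h (multL (a ^+ deg g)) (fun t => B * wprod A z t * C : algmod H) j = 0.
Proof.
move=> h0 rel; apply/eqP; rewrite subr_eq0; apply/eqP.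
transitivity (B * gcoef h A z j * C : H).
  rewrite /gcoef mulr_sumr mulr_suml; apply: eq_bigr => i _.
  rewrite mulrA -(algCC _ B) -!mulrA; congr (_ * _).
  rewrite /Q /wsum mulr_suml mulr_sumr; apply: eq_bigr => t _.
  by rewrite mulrA.
rewrite rel mulrA -(algCC _ B) -!mulrA; congr (_ * _).
by rewrite mulrA -(w_comm B) -mulrA /wprod big_nil mul1r.
Qed.

Lemma split_false (w : word) : w = nseq (find id w) false ++ drop (find id w) w /\
  starts_true (drop (find id w) w).
Proof. by elim: w => [|[] w [IH1 IH2]] //=; split; rewrite // {1}IH1. Qed.

Let normal_drop n w : last_redex n w = None -> last_redex n (drop (find id w) w) = None.
Proof.
move=> nw; case E : (last_redex n (drop _ _)) => [[[u j] v]|] //.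
by move: nw; rewrite (split_false w).1 (last_redex_cat _ E).
Qed.

Lemma wprod_false (R : pzRingType) (c z : R) i : wprod c z (nseq i false) = z ^+ i.
Proof.
by elim: i => [|i IH]; rewrite /= ?wprod_cons ?IH ?exprS // /wprod big_nil.
Qed.

(** Rewriting the words in x and a, then those in y and b. *)
Lemma spanned_words u v : spanned (wprod a x u * wprod b y v).
Proof.
have [g1 f1] := (ltnW deg_g, ltnW deg_f).
have [_ _ _ ab _] := univ_data U.
have Mlin (d : k) (z z' : algmod H) : spanned z -> spanned z' -> spanned (d *: z + z').
  by move=> sz sz'; apply: spannedD => //; apply: spanned_Z.
have MW z : spanned z -> spanned (multL (a ^+ deg g) z) by case/spanned_w.
have sigx j : (0 < j)%N -> gcoef g a x j = (g`_j)%:K * a ^+ deg g.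
  by case/(Axag_dataP g_neq0): dx => _ _; apply.
have sigy j : (0 < j)%N -> gcoef f b y j = (f`_j)%:K * a ^+ deg g.
  by rewrite ab; case/(Axag_dataP f_neq0): dy => _ _; apply.
move: u; apply: (relation_closed (phi := fun u => wprod a x u * wprod b y v : algmod H)
  g_neq0 g1 spanned0 Mlin MW) => [u u' j j0|u nu].
  rewrite (eq_relation _ _ (phi' := fun t => wprod a x u * wprod a x t
      * (wprod a x u' * wprod b y v) : algmod H)) => [|t]; last first.
    by rewrite !wprod_cat !mulrA.
  by rewrite relation_words ?sigx //; apply: spanned0.
have [uE su] := split_false u; have nu' := normal_drop nu.
move: (drop _ u) uE su nu' => e -> se ne.
rewrite wprod_cat wprod_false -mulrA -phix -(alghomX _ phi_hom).
apply: spannedM_phi; rewrite phix; move: v.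
apply: (relation_closed (phi := fun v => wprod a x e * wprod b y v : algmod H)
  f_neq0 f1 spanned0 Mlin MW) => [u1 u1' j j0|v nv].
  rewrite (eq_relation _ _ (phi' := fun t => wprod a x e * wprod b y u1 * wprod b y t
      * wprod b y u1' : algmod H)) => [|t]; last first.
    by rewrite !wprod_cat !mulrA.
  by rewrite relation_words ?sigy //; apply: spanned0.
have [vE sv] := split_false v; have nv' := normal_drop nv.
move: (drop _ v) vE sv nv' => e' -> se' ne'.
rewrite wprod_cat mulrA (comm_xy_words e) -mulrA wprod_false -phiy -(alghomX _ phi_hom).
apply: spannedM_phi; rewrite phiy.
have adm : admissible (e, e', 0) by rewrite /admissible /= se se' ne ne'.
have := spanned_basis 1 adm; rewrite (alghom1 phi_hom) /basis /= !mul1r; apply.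
Qed.

Inductive monomials : H -> Prop :=
| monomials0 : monomials 0
| monomialsD h h' of monomials h & monomials h' : monomials (h + h')
| monomials_mon (c : k) i u v :
    monomials (c%:K * (wpow i * (wprod a x u * wprod b y v))).

Lemma monomials_stable z h :
    (forall i u v, exists i' u' v', z * (wpow i * (wprod a x u * wprod b y v))
      = wpow i' * (wprod a x u' * wprod b y v')) ->
  monomials h -> monomials (z * h).
Proof.
move=> zmon; elim=> {h} [|h h' _ IH _ IH'|c i u v].
- by rewrite mulr0; apply: monomials0.
- by rewrite mulrDr; apply: monomialsD.
have [i' [u' [v' E]]] := zmon i u v.
by rewrite mulrA -algCC -mulrA E; apply: monomials_mon.
Qed.

Lemma wpow_comm i h : GRing.comm (wpow i) h.
Proof.
by case: i => m; apply/commr_sym/commrX/commr_sym; [apply: w_comm | apply: w'_comm].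
Qed.

(** The monomials span H, because multiplying a monomial on the left by a
    generator gives a monomial; here a^-1 = a^(n-1) w^-1 and w is central. *)
Lemma spanned_all h : spanned h.
Proof.
have [_ gen _] := U; have [bv vb _] := dy; have [_ _ _ ab _] := univ_data U.
have bw' : a' ^+ deg g = b' ^+ deg f.
  rewrite -[LHS]mulr1 -(expr_inverse (deg f) bv vb) -ab mulrA.
  by rewrite w'a mul1r.
have letx c i u v : (if c then a else x) * (wpow i * (wprod a x u * wprod b y v))
    = wpow i * (wprod a x (c :: u) * wprod b y v).
  by rewrite wprod_cons mulrA -wpow_comm -!mulrA.
have lety c i u v : (if c then b else y) * (wpow i * (wprod a x u * wprod b y v))
    = wpow i * (wprod a x u * wprod b y (c :: v)).
  rewrite mulrA -wpow_comm -!mulrA; congr (_ * _).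
  have : GRing.comm (wprod a x u) (if c then b else y).
    by have := comm_xy_words u [:: c]; rewrite wprod_cons {2}/wprod big_nil mulr1.
  move=> E.
  by rewrite wprod_cons [RHS]mulrA E -mulrA.
have sw i u v : a' ^+ deg g * (wpow i * (wprod a x u * wprod b y v))
    = wpow (i - 1) * (wprod a x u * wprod b y v) by rewrite mulrA wpowP.
have stable_a : forall h', monomials h' -> monomials (a * h').
  by move=> h'; apply: monomials_stable => i u v; exists i, (true :: u), v; apply: (letx true).
have stable_b : forall h', monomials h' -> monomials (b * h').
  by move=> h'; apply: monomials_stable => i u v; exists i, u, (true :: v); apply: (lety true).
have stable_w' : forall h', monomials h' -> monomials (a' ^+ deg g * h').
  by move=> h'; apply: monomials_stable => i u v; exists (i - 1), u, v.
have stableX z n h' : (forall h', monomials h' -> monomials (z * h')) ->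
    monomials h' -> monomials (z ^+ n * h').
  move=> zs mh; elim: n => [|n IH]; first by rewrite mul1r.
  by rewrite exprS -mulrA; apply: zs.
have inv_expr (c c' : H) n : (0 < n)%N -> c * c' = 1 -> c' * c = 1 ->
    c' = c' ^+ n * c ^+ n.-1.
  case: n => // n _ cc c'c; rewrite exprS -mulrA expr_inverse // mulr1 //.
have stable z : forall h', monomials h' -> monomials (z * h').
  move: z; apply: gen => [|z Gz h' mh]; last case: Gz => -[] ->.
  - apply: subalgebraI => [c h' mh|u v IH IH' h' mh|u v IH IH' h' mh].
    + elim: mh => [|h1 h2 _ IH _ IH'|d i u v]; rewrite ?mulr0 ?mulrDr.
      * exact: monomials0.
      * exact: monomialsD.
      by rewrite mulrA -algCM; apply: monomials_mon.
    + by rewrite mulrDl; apply: monomialsD; [apply: IH | apply: IH'].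
    by rewrite -mulrA; apply/IH/IH'.
  - by apply: monomials_stable mh => i u v; exists i, (false :: u), v; apply: (letx false).
  - exact: stable_a.
  - rewrite (inv_expr a a' (deg g)) // -?mulrA; last exact: ltnW.
    by apply/stable_w'/stableX.
  - by apply: monomials_stable mh => i u v; exists i, u, (false :: v); apply: (lety false).
  - exact: stable_b.
  rewrite (inv_expr b b' (deg f)) // -?mulrA; last exact: ltnW.
  rewrite -bw'; apply: stable_w'; exact: stableX.
have spanned_pow i h' : spanned h' -> spanned (wpow i * h').
  move=> sh; case: i => m /=.
    elim: m => [|m IH]; first by rewrite mul1r.
    by rewrite exprS -mulrA; case/spanned_w: IH.
  elim: m => [|m IH]; first by rewrite expr1; case/spanned_w: sh.
  by rewrite exprS -mulrA; case/spanned_w: IH.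
have : monomials h.
  have m1 : monomials 1.
    have := monomials_mon 1 0 [::] [::].
    by rewrite /wprod !big_nil algC1 /= expr0 !mul1r.
  by rewrite -[h]mulr1; apply: stable.
elim=> {h} [|h h' _ IH _ IH'|c i u v].
- exact: spanned0.
- exact: spannedD.
exact/spanned_Z/spanned_pow/spanned_words.
Qed.

End Freeness.

(** * Faithful flatness of free modules *)

(** Tensoring with a free module turns a module Z into a direct sum of copies
    of Z; the p i are the components and the q i the inclusions. *)
Record components (I : eqType) (A : pred I) (Z TZ : zmodType)
    (p : I -> TZ -> Z) (q : I -> Z -> TZ) : Prop := Components {
  compD : forall i, {morph p i : s t / s + t};
  inclD : forall i, {morph q i : s t / s + t};
  comp_incl : forall i j z, A j -> p i (q j z) = if i == j then z else 0;
  incl_span : forall t, exists2 l : seq (I * Z), all (A \o fst) l &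
    t = \sum_(u <- l) q u.1 u.2 }.

Section ComponentsTheory.
Variables (I : eqType) (A : pred I) (Z TZ : zmodType).
Variables (p : I -> TZ -> Z) (q : I -> Z -> TZ).
Hypothesis C : components A p q.

Lemma components_expansion t :
  exists2 s : seq I, all A s & t = \sum_(i <- s) q i (p i t).
Proof.
have [l Al tE] := incl_span C t.
exists (undup (unzip1 l)); first by rewrite all_undup all_map.
have pt i : p i t = \sum_(u <- l) if i == u.1 then u.2 else 0.
  rewrite tE (big_morph _ (compD C i) (morph0 (compD C i))).
  by apply: eq_big_seq => u ul; rewrite (comp_incl C) //; apply: (allP Al).
transitivity (\sum_(i <- undup (unzip1 l)) \sum_(u <- l) q i (if i == u.1 then u.2 else 0)).
  rewrite exchange_big [LHS]tE; apply: eq_big_seq => u ul /=.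
  have iu : u.1 \in undup (unzip1 l) by rewrite mem_undup map_f.
  rewrite (bigD1_seq _ iu (undup_uniq _)) /= eqxx big1 ?addr0 // => i /negPf ->.
  exact: morph0 (inclD C i).
by apply: eq_bigr => i _; rewrite pt (big_morph _ (inclD C i) (morph0 (inclD C i))).
Qed.

Lemma components_eq0 t : (forall i, A i -> p i t = 0) -> t = 0.
Proof.
have [s As tE] := components_expansion t => pt; rewrite tE big_seq big1 // => i si.
by rewrite pt ?(morph0 (inclD C i)) //; apply: (allP As).
Qed.

End ComponentsTheory.

Section Exactness.
Variables (I : eqType) (A : pred I) (i0 : I) (Ai0 : A i0).
Variables (Z1 Z2 Z3 T1 T2 T3 : zmodType).
Variables (p1 : I -> T1 -> Z1) (q1 : I -> Z1 -> T1) (p2 : I -> T2 -> Z2) (q2 : I -> Z2 -> T2)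
  (p3 : I -> T3 -> Z3) (q3 : I -> Z3 -> T3).
Hypotheses (C1 : components A p1 q1) (C2 : components A p2 q2) (C3 : components A p3 q3).
Variables (f : Z1 -> Z2) (g : Z2 -> Z3) (Tf : T1 -> T2) (Tg : T2 -> T3).
Hypotheses (fD : {morph f : s t / s + t}) (gD : {morph g : s t / s + t})
  (TfD : {morph Tf : s t / s + t}) (TgD : {morph Tg : s t / s + t}).
Hypotheses (Tfq : forall i z, Tf (q1 i z) = q2 i (f z))
  (Tgq : forall i z, Tg (q2 i z) = q3 i (g z)).

Let comp_map (U V TU TV : zmodType) (pU : I -> TU -> U) (qU : I -> U -> TU)
    (pV : I -> TV -> V) (qV : I -> V -> TV) (h : U -> V) (Th : TU -> TV) :
    components A pU qU -> components A pV qV ->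
    {morph h : s t / s + t} -> {morph Th : s t / s + t} ->
    (forall i z, Th (qU i z) = qV i (h z)) ->
  forall i t, pV i (Th t) = h (pU i t).
Proof.
move=> CU CV hD ThD Thq i t; have [l Al ->] := incl_span CU t.
rewrite (big_morph _ ThD (morph0 ThD)) (big_morph _ (compD CV i) (morph0 (compD CV i))).
rewrite (big_morph _ (compD CU i) (morph0 (compD CU i))) (big_morph _ hD (morph0 hD)).
apply: eq_big_seq => u ul; have Au : A u.1 := allP Al u ul.
rewrite Thq (comp_incl CV) // (comp_incl CU) //.
by case: ifP => // _; rewrite (morph0 hD).
Qed.

(** A direct sum of copies of a sequence, at least one of them, is exact if and
    only if the sequence is. *)
Lemma exact_components : exact_at f g <-> exact_at Tf Tg.
Proof.
have pf := comp_map C1 C2 fD TfD Tfq; have pg := comp_map C2 C3 gD TgD Tgq.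
have f0 := morph0 fD; have g0 := morph0 gD.
split=> ex.
  have gf z : g (f z) = 0 by apply/ex; exists z.
  move=> t; split=> [Tgt|[s <-]]; last first.
    by apply: (components_eq0 C3) => i _; rewrite pg pf gf.
  have lift i : exists z, f z = p2 i t.
    by apply/ex; rewrite -pg Tgt (morph0 (compD C3 i)).
  have [z zE] := choice lift; have [s _ tE] := components_expansion C2 t.
  exists (\sum_(i <- s) q1 i (z i)).
  rewrite (big_morph _ TfD (morph0 TfD)) [RHS]tE.
  by apply: eq_bigr => i _; rewrite Tfq zE.
move=> z; split=> [gz|[y <-]].
  have : Tg (q2 i0 z) = 0 by rewrite Tgq gz (morph0 (inclD C3 i0)).
  case/ex=> t Tft; exists (p1 i0 t).
  by rewrite -pf Tft (comp_incl C2) // eqxx.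
have : Tg (q2 i0 (f y)) = 0 by apply/ex; exists (q1 i0 y).
rewrite Tgq => /(congr1 (p3 i0)); rewrite (comp_incl C3) // eqxx => ->.
exact: morph0 (compD C3 i0).
Qed.

End Exactness.

Section FreeLeft.
Variables (R : pzRingType) (M : lmodType R) (I : eqType) (A : pred I) (i0 : I).
Variables (e : I -> M) (c : I -> M -> R).
Hypotheses (Ai0 : A i0)
  (cD : forall i, {morph c i : m m' / m + m'})
  (cZ : forall i r m, c i (r *: m) = r * c i m)
  (ce : forall i j, A j -> c i (e j) = (i == j)%:R)
  (espan : forall m, exists2 l : seq (I * R), all (A \o fst) l &
     m = \sum_(u <- l) u.2 *: e u.1).

Let comp (N : lmodType R^c) (i : I) (t : mtens N M) : N :=
  tlift (fun n m => (c i m : R^c) *: n) t.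
Let incl (N : lmodType R^c) (i : I) (n : N) : mtens N M := pure _ _ n (e i).

Let comp_balanced (N : lmodType R^c) i : balanced
  (fun (r : R) (n : N) => (r : R^c) *: n) (fun (r : R) (m : M) => r *: m)
  (fun n m => (c i m : R^c) *: n).
Proof.
split=> [m n n'|n m m'|r n m]; first exact: scalerDr.
  by rewrite cD; apply: (@scalerDl R^c).
by rewrite cZ scalerA.
Qed.

Let components_left (N : lmodType R^c) : components A (@comp N) (@incl N).
Proof.
split=> [i|i|i j n Aj|t].
- exact: tliftD (comp_balanced N i).
- exact: pureDl.
- rewrite /comp /incl (tlift_pure _ _ (comp_balanced N i)) ce //.
  by case: eqP => _; [exact: scale1r | exact: (@scale0r R^c)].
rewrite (tens_sum t); elim: (repr t) => [|[n m] s [l Al lE]].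
  by exists [::] => //; rewrite !big_nil.
have [l' Al' mE] := espan m.
exists ([seq (u.1, (u.2 : R^c) *: n) | u <- l'] ++ l).
  by rewrite all_cat Al andbT all_map.
rewrite big_cons lE big_cat big_map; congr (_ + _); rewrite /= {1}mE.
rewrite (big_morph _ (pureDr _ _ n) (morph0 (pureDr _ _ n))).
by apply: eq_bigr => u _; rewrite /incl pure_bal.
Qed.

Lemma free_faithfully_flat_left : faithfully_flat_left M.
Proof.
move=> N1 N2 N3 f g.
have hom (N N' : lmodType R^c) (h : {linear N -> N'}) : balanced
    (fun (r : R) (n : N) => (r : R^c) *: n) (fun (r : R) (m : M) => r *: m)
    (fun n m => (pure _ _ (h n) (@id M m) : mtens N' M)).
  split=> [m n n'|n m m'|r n m]; first by rewrite linearD; apply: pureDl.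
    exact: pureDr.
  by rewrite linearZ; apply: pure_bal.
apply: (exact_components Ai0 (components_left N1) (components_left N2) (components_left N3)).
- exact: linearD.
- exact: linearD.
- exact: tliftD (hom _ _ f).
- exact: tliftD (hom _ _ g).
- by move=> i n; apply: (tlift_pure _ _ (hom _ _ f)).
by move=> i n; apply: (tlift_pure _ _ (hom _ _ g)).
Qed.

End FreeLeft.

Section FreeRight.
Variables (R : pzRingType) (N : lmodType R^c) (I : eqType) (A : pred I) (i0 : I).
Variables (e : I -> N) (c : I -> N -> R).
Hypotheses (Ai0 : A i0)
  (cD : forall i, {morph c i : m m' / m + m'})
  (cZ : forall i (r : R) n, c i ((r : R^c) *: n) = c i n * r)
  (ce : forall i j, A j -> c i (e j) = (i == j)%:R)
  (espan : forall n, exists2 l : seq (I * R), all (A \o fst) l &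
     n = \sum_(u <- l) (u.2 : R^c) *: e u.1).

Let comp (M : lmodType R) (i : I) (t : mtens N M) : M :=
  tlift (fun n m => c i n *: m) t.
Let incl (M : lmodType R) (i : I) (m : M) : mtens N M := pure _ _ (e i) m.

Let comp_balanced (M : lmodType R) i : balanced
  (fun (r : R) (n : N) => (r : R^c) *: n) (fun (r : R) (m : M) => r *: m)
  (fun n m => c i n *: m).
Proof.
split=> [m n n'|n m m'|r n m]; first by rewrite cD scalerDl.
  exact: scalerDr.
by rewrite cZ scalerA.
Qed.

Let components_right (M : lmodType R) : components A (@comp M) (@incl M).
Proof.
split=> [i|i|i j n Aj|t].
- exact: tliftD (comp_balanced M i).
- exact: pureDr.
- rewrite /comp /incl (tlift_pure _ _ (comp_balanced M i)) ce //.
  by case: eqP => _; [exact: scale1r | exact: scale0r].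
rewrite (tens_sum t); elim: (repr t) => [|[n m] s [l Al lE]].
  by exists [::] => //; rewrite !big_nil.
have [l' Al' nE] := espan n.
exists ([seq (u.1, u.2 *: m) | u <- l'] ++ l).
  by rewrite all_cat Al andbT all_map.
rewrite big_cons lE big_cat big_map; congr (_ + _); rewrite /= {1}nE.
rewrite (big_morph _ (pureDl _ _ m) (morph0 (pureDl _ _ m))).
by apply: eq_bigr => u _; rewrite /incl -pure_bal.
Qed.

Lemma free_faithfully_flat_right : faithfully_flat_right N.
Proof.
move=> M1 M2 M3 f g.
have hom (M M' : lmodType R) (h : {linear M -> M'}) : balanced
    (fun (r : R) (n : N) => (r : R^c) *: n) (fun (r : R) (m : M) => r *: m)
    (fun n m => (pure _ _ (@id N n) (h m) : mtens N M')).
  split=> [m n n'|n m m'|r n m]; first exact: pureDl.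
    by rewrite linearD; apply: pureDr.
  by rewrite linearZ; apply: pure_bal.
apply: (exact_components Ai0 (components_right M1) (components_right M2) (components_right M3)).
- exact: linearD.
- exact: linearD.
- exact: tliftD (hom _ _ f).
- exact: tliftD (hom _ _ g).
- by move=> i n; apply: (tlift_pure _ _ (hom _ _ f)).
by move=> i n; apply: (tlift_pure _ _ (hom _ _ g)).
Qed.

End FreeRight.

(** * Plane curves as quantum homogeneous spaces *)

Section CurveRing.
Variables (k : comNzRingType) (g f : {poly k}).

Lemma curve_generated : generated (fun z => z = curve_x g f \/ z = curve_y g f).
Proof.
move=> D hD DG; apply: (quot_generated (@mpoly2_generated k)) => // z.
by case=> _ [] -> ->; apply: DG; [left|right].
Qed.

Lemma curve_comm (u v : curve_ring g f) : GRing.comm u v.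
Proof.
have [_ qM _] := qpi_alghom (@curve_rel k g f).
elim/qind: u => u; elim/qind: v => v; rewrite /GRing.comm.
by apply: etrans (esym (qM _ _)) _; rewrite mulrC; apply: qM.
Qed.

Lemma curve_gf : peval g (curve_x g f) = peval f (curve_y g f).
Proof.
have hq := qpi_alghom (@curve_rel k g f); apply/eqP; rewrite -subr_eq0; apply/eqP.
by apply: etrans (esym (alghom_sub_peval hq _ _ _ _)) _; apply: qpi0.
Qed.

Lemma curve_lift (B : pzAlgType k) (x y : B) : GRing.comm x y ->
    peval g x = peval f y ->
  exists2 F : curve_ring g f -> B, alghom F &
    F (curve_x g f) = x /\ F (curve_y g f) = y.
Proof.
move=> xy gf; have [ev hev [evX evY]] := mpoly2_evaluation xy.
have [s ->|F hF FE] := @quot_lift _ _ (@curve_rel k g f) _ _ hev.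
  by apply: etrans (alghom_sub_peval hev _ _ _ _) _; rewrite evX evY gf subrr.
by exists F => //; split; rewrite FE.
Qed.

End CurveRing.

Section Main.
Variables (k : fieldType) (g f : {poly k}).
Hypotheses (g_neq0 : g != 0) (g0 : g`_0 = 0) (deg_g : (1 < deg g)%N)
  (f_neq0 : f != 0) (f0 : f`_0 = 0) (deg_f : (1 < deg f)%N).
Variables (H : pzAlgType k) (x a a' y b b' : H).
Hypothesis U : Agf_universal g f x a a' y b b'.

Lemma grouplike_inv (HH : hopf H) w w' :
  grouplike HH w -> w * w' = 1 -> w' * w = 1 -> grouplike HH w'.
Proof.
move=> [Dw ew] ww' w'w; have hD := comul_alghom HH; have he := counit_alghom HH.
have [_ DM _] := hD; have [_ eM _] := he; split; last first.
  have := eM w w'; rewrite ww' ew (alghom1 he) => ->; exact: esym (mul1r _).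
have p1 : ptens w w * ptens w' w' = 1 by rewrite ptensM ww'.
by rewrite -[LHS]mulr1 -p1 mulrA -Dw -DM w'w (alghom1 hD) mul1r.
Qed.

Lemma Agf_pointed (HH : hopf H) : hopf_spec x a a' y b b' HH -> pointed HH.
Proof.
move=> [[Da Dx ea _] _ [Db Dy eb _] _].
have [[[av va _] [bv vb _] _ _ _] gen _] := U.
have ga : grouplike HH a by []. have gb : grouplike HH b by [].
apply: (@pointed_generated _ _ _ (fun w => w \in [:: a; a'; b; b']) (fun s => s \in [:: x; y])).
- move=> w; rewrite !inE => /or4P[] /eqP -> //.
    exact: grouplike_inv ga av va.
  exact: grouplike_inv gb bv vb.
- move=> s; rewrite !inE => /orP[] /eqP ->; [exists a | exists b] => //.
    by rewrite !inE eqxx.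
  by rewrite !inE eqxx !orbT.
move=> D hD DG; apply: gen => // z.
by case=> -[] ->; apply: DG; rewrite !inE eqxx ?orbT; auto.
Qed.

(** The relations are invariant under reversal of words. *)
Lemma reversal_exists : exists2 tau : H -> H^c, alghom tau &
  [/\ [/\ tau x = x, tau a = a & tau a' = a'] & [/\ tau y = y, tau b = b & tau b' = b']].
Proof.
have [[dx dy comm ab xy] _ lift] := U; apply: lift; split.
- exact: Axag_data_conv.
- exact: Axag_data_conv.
- by move=> u v ux vy; apply: esym; apply: comm.
- by rewrite !exprn_conv.
have pc (h : {poly k}) (z : H) : peval h (z : H^c) = peval h z.
  by rewrite -(gcoef0 h (1 : H^c)) gcoef_conv gcoef0.
by rewrite !pc.
Qed.

Lemma spanned_seq (O : pzAlgType k) (phi : O -> H) h : spanned g f x a a' y b phi h ->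
  exists2 l : seq (seq bool * seq bool * int * O), all (admissible g f \o fst) l &
    h = \sum_(u <- l) phi u.2 * basis g x a a' y b u.1.
Proof.
elim=> {h} [|h h' _ [l Al ->] _ [l' Al' ->]|o I adm].
- by exists [::] => //; rewrite big_nil.
- by exists (l ++ l'); rewrite ?all_cat ?Al ?big_cat.
by exists [:: (I, o)]; rewrite ?big_seq1 //= adm.
Qed.

(** The basis over O yields faithful flatness on the left. The reversal tau
    fixes O, so it carries this basis to a basis for the right module
    structure. *)
Theorem Agf_quantum_homogeneous_space : exists HH : hopf H,
  [/\ hopf_spec x a a' y b b' HH, pointed HH
    & exists phi : curve_ring g f -> H,
      [/\ alghom phi, phi (curve_x g f) = x /\ phi (curve_y g f) = y, injective phi
        & right_quantum_homogeneous_space HH (fun h => exists c, phi c = h)]].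
Proof.
have [HH spec] := hopf_exists U g_neq0 g0 f_neq0 f0.
exists HH; split=> //; first exact: Agf_pointed spec.
have [dx dy comm ab xy] := univ_data U.
have [phi hphi [phix phiy]] := curve_lift (comm _ _ (mem_head _ _) (mem_head _ _)) xy.
have [coord [cD cphi cbasis]] := coordinates_exist g_neq0 deg_g f_neq0 deg_f U
  (@curve_comm _ g f) (@curve_generated _ g f) (curve_gf g f) hphi phix phiy.
pose I0 : seq bool * seq bool * int := ([::], [::], 0).
have adm0 : admissible g f I0 by [].
have basis0 : basis g x a a' y b I0 = 1 by rewrite /basis /= /wprod !big_nil !mulr1.
have phi_inj : injective phi.
  move=> o o' /(congr1 (coord I0)); rewrite -[phi o]mulr1 -[phi o']mulr1 -basis0.
  by rewrite !cphi cbasis // eqxx !mulr1.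
have [pD pM pK] := hphi.
pose D h := exists c, phi c = h.
have Dalg : subalgebra D.
  apply: subalgebraI => [c|_ _ [o <-] [o' <-]|_ _ [o <-] [o' <-]].
  - by exists c%:K; rewrite pK.
  - by exists (o + o'); rewrite pD.
  by exists (o * o'); rewrite pM.
exists phi; split=> //; split.
  split=> // _ [o <-].
  suff : sums (fun u _ => D u) (comul HH (phi o)).
    by case/sums_seq=> l lD ->; exists l => // p pl; split=> //; apply: lD.
  have [[_ Dx _ _] _ [_ Dy _ _] _] := spec; have [DD DM DK] := comul_alghom HH.
  have D1 : D 1 by exists 1; rewrite (alghom1 hphi).
  have skew z w : D z -> sums (fun u (_ : H) => D u) (ptens 1 z + ptens z w).
    by move=> Dz; apply: sumsD; apply: sums_ptens.
  move: o; apply: curve_generated => [|o [] ->]; last 2 first.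
  - by rewrite phix Dx; apply: skew; exists (curve_x g f).
  - by rewrite phiy Dy; apply: skew; exists (curve_y g f).
  apply: subalgebraI => [c|o o' so so'|o o' so so'].
  - by rewrite pK DK; apply: sums_ptens; exists c%:K; rewrite pK.
  - by rewrite pD DD; apply: sumsD.
  rewrite pM DM; apply: sumsM so so' => _ _ _ _ [o1 <-] [o2 <-].
  by exists (o1 * o2); rewrite pM.
have Dphi o : subalg_pred D (phi o) by apply/asboolP; exists o.
pose R := subalg Dalg.
pose psi (o : curve_ring g f) : R := exist (fun h => subalg_pred D h) (phi o) (Dphi o).
have psiV (r : R) : exists o, r = psi o.
  by case: r => h hD; have /asboolP[o oh] := hD; exists o; apply: val_inj.
have psiD : {morph psi : o o' / o + o'} by move=> o o'; apply: val_inj; rewrite /= pD.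
have psiM : {morph psi : o o' / o * o'} by move=> o o'; apply: val_inj; rewrite /= pM.
have psi1 (n : bool) : psi n%:R = n%:R.
  by case: n; apply: val_inj; rewrite /= ?(alghom1 hphi) ?(alghom0 hphi).
have span h := spanned_seq (spanned_all g_neq0 deg_g f_neq0 deg_f U hphi phix phiy h).
have [tau htau [[tx ta ta'] [ty tb tb']]] := reversal_exists.
have [tD tM tK] := htau.
have tauM u v : tau (u * v) = (tau v : H) * (tau u : H) := tM u v.
have tauK h : tau (tau h : H) = h.
  have [_ gen _] := U.
  have htt : alghom (fun h => tau (tau h : H) : H).
    split=> [u v|u v|c]; [by rewrite tD tD | by rewrite !tauM | by rewrite tK tK].
  by apply: (generated_eq gen htt (@alghom_id _ H)) => z [] [] ->;
    rewrite ?(tx, ta, ta', ty, tb, tb').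
have tau_phi o : tau (phi o) = phi o.
  have hp : alghom (phi : curve_ring g f -> H^c).
    by split=> // o1 o2; rewrite (curve_comm o1 o2) pM.
  apply: (generated_eq (@curve_generated _ g f) (alghom_comp htau hphi) hp) => z [] -> /=;
  by rewrite ?phix ?phiy.
exists Dalg; split.
  apply: (@free_faithfully_flat_left R (left_over Dalg) _ (admissible g f) I0
    (basis g x a a' y b) (fun I h => psi (coord I h))) => //.
  - by move=> I h h'; rewrite cD psiD.
  - by move=> I r h; have [o ->] := psiV r; rewrite -psiM -cphi.
  - by move=> I J admJ; rewrite cbasis // psi1.
  move=> h; have [l Al ->] := span h.
  exists [seq (u.1, psi u.2) | u <- l]; first by rewrite all_map.
  by rewrite big_map.
apply: (@free_faithfully_flat_right R (right_over Dalg) _ (admissible g f) I0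
  (fun I => tau (basis g x a a' y b I)) (fun I h => psi (coord I (tau h)))) => //.
- by move=> I h h'; rewrite tD cD psiD.
- move=> I r h; have [o ->] := psiV r.
  rewrite [tau _](tauM h (phi o)) tau_phi cphi curve_comm psiM; by [].
- by move=> I J admJ; rewrite tauK cbasis // psi1.
move=> h; have [l Al hE] := span (tau h).
exists [seq (u.1, psi u.2) | u <- l]; first by rewrite all_map.
rewrite big_map -[LHS]tauK hE (alghom_sum htau); apply: eq_bigr => u _.
by apply: etrans (tauM _ _) _; rewrite tau_phi.
Qed.

End Main.

Theorem theorem0p1 (k : closedFieldType) (char0 : [pchar k] =i pred0)
    (n m : nat) (n_ge2 : (2 <= n)%N) (m_ge2 : (2 <= m)%N)
    (r s : nat -> k) (rn0 : r n != 0) (sm0 : s m != 0)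
    (g f : {poly k})
    (gE : g = \sum_(1 <= i < n.+1) r i *: 'X^i)
    (fE : f = \sum_(1 <= i < m.+1) s i *: 'X^i)
    (hf : (m <= 5)%N \/ exists e : nat, f = 'X^e)
    (hg : (n <= 5)%N \/ exists e : nat, g = 'X^e) :
  exists HH : hopf (Agf g f),
    [/\ Agf_hopf_spec HH, pointed HH, affine (Agf g f)
      & exists phi : curve_ring g f -> Agf g f,
        [/\ alghom phi,
            phi (curve_x g f) = Agf_x g f /\ phi (curve_y g f) = Agf_y g f,
            injective phi
          & right_quantum_homogeneous_space HH
              (fun h => exists c, phi c = h)]].
Proof.
have poly_facts (d : nat) (c : nat -> k) (p : {poly k}) : (2 <= d)%N -> c d != 0 ->
    p = \sum_(1 <= i < d.+1) c i *: 'X^i -> [/\ p != 0, p`_0 = 0 & (1 < deg p)%N].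
  move=> d2 cd pE.
  have coefE j : p`_j = if (0 < j <= d)%N then c j else 0.
    rewrite pE coef_sum big_nat; under eq_bigr => i _ do rewrite coefZ coefXn.
    case: ifP => jd; last first.
      rewrite big1 // => i id; case: eqP => [ji|_]; last by rewrite mulr0.
      by move: jd; rewrite ji; case/andP: id => -> ; rewrite ltnS => ->.
    rewrite -big_nat (bigD1_seq j) ?iota_uniq ?mem_index_iota //= eqxx mulr1.
    by rewrite big1 ?addr0 // => i /negPf; rewrite eq_sym => ->; rewrite mulr0.
  have pd : p`_d != 0 by rewrite coefE leqnn andbT (ltnW d2).
  have lt_d : (d < size p)%N.
    by rewrite ltnNge; apply: contra pd => le_d; rewrite nth_default.
  split; [by apply: contraNneq pd => ->; rewrite coef0 | by rewrite coefE | ].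
  by rewrite /deg -ltnS prednK; [apply: leq_trans lt_d | apply: leq_ltn_trans lt_d].
have [g_neq0 g0 deg_g] := poly_facts n r g n_ge2 rn0 gE.
have [f_neq0 f0 deg_f] := poly_facts m s f m_ge2 sm0 fE.
have [HH [spec pt quantum]] :=
  Agf_quantum_homogeneous_space g_neq0 g0 deg_g f_neq0 f0 deg_f (Agf_is_universal g f).
by exists HH; split=> //; apply: Agf_affine.
Qed.
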